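(* Let $\mathbf{T}$ be a Galton-Watson tree with progeny distribution $Z\ge 1$ with $\mathbf{E}[Z]>1$, and suppose $\mathbf{E}[Z^p]<\infty$ for each $p\ge 1$. Set $\lambda := \dfrac{2\,\mathbf{E}[Z]^2}{\mathbf{E}[Z(Z-1)]}$ and let $Y_n$ be the set of vertices at depth $n$ of $\mathbf{T}$ connected to the root in $p_c$ percolation, where $p_c = 1/\mathbf{E}[Z]$. Then for almost every $\mathbf{T}$ the following hold. (a) $n\cdot \mathbf{P}_{\mathbf{T}}[|Y_n|>0]\to \lambda W$ as $n\to\infty$. (b) The conditional law of $|Y_n|/n$ given $|Y_n|>0$, i.e. $\mathbf{P}_{\mathbf{T}}[\,|Y_n|/n\in\cdot \mid |Y_n|>0\,]$, converges weakly as $n\to\infty$ to the law of an exponential random variable with mean $\lambda^{-1}$. (c) Let $\mathbf{C}_n$ denote the number of vertices at depth $n$ in the (quenched) incipient infinite cluster of $\mathbf{T}$. Then $\mathbf{C}_n/n$ converges in distribution, as $n\to\infty$, to the random variable with density $\lambda^2 x e^{-\lambda x}$ on $[0,\infty)$.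
   Context: Galton-Watson tree: $Z$ is a random variable with values in $\{1,2,\dots\}$; $\mathbf{T}$ is the random rooted tree with root $\mathbf{0}$ in which every vertex independently has a number of children distributed as $Z$. Its law is denoted $\mathtt{GW}$, and ''almost every $\mathbf{T}$'' means $\mathtt{GW}$-almost every. Write $\mu=\mathbf{E}[Z]$, let $Z_n$ be the number of vertices of $\mathbf{T}$ at depth $n$, $W_n=Z_n/\mu^n$, and $W=\lim_{n\to\infty} W_n$, which exists almost surely. For a vertex $v$, $W(v)$ denotes the analogous limit for the subtree of descendants of $v$ (rooted at $v$): $W(v)=\lim_k Z_k(v)/\mu^k$, where $Z_k(v)$ is the number of descendants of $v$ exactly $k$ generations below $v$. Percolation: given $\mathbf{T}$, each edge is independently open with probability $p_c=1/\mu$; $\mathbf{P}_{\mathbf{T}}$ is the (quenched) conditional probability given $\mathbf{T}$, i.e. the law of this percolation on the fixed tree $\mathbf{T}$. $\mathcal{C}_{p_c}$ is the open cluster of the root. Incipient infinite cluster (IIC): for a tree $S$ let $S[n]$ be its restriction to vertices of depth at most $n$. For almost every $\mathbf{T}$, the limits $\lim_{M\to\infty}\mathbf{P}_{\mathbf{T}}[\mathcal{C}_{p_c}[n]=t \mid |Y_M|>0]$ exist for every $n$ and every subtree $t$ of $\mathbf{T}[n]$ containing the root, and equal $\frac{\sum_{v\in t_n}W(v)}{W}\mathbf{P}_{\mathbf{T}}[\mathcal{C}_{p_c}[n]=t]$, where $t_n$ is the set of vertices of $t$ at depth $n$; these are the marginals of a unique probability measure on infinite subtrees of $\mathbf{T}$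 containing the root. The quenched IIC of $\mathbf{T}$ is the random infinite subtree of $\mathbf{T}$ with this law. *)

(* Defs.v *)
From HB Require Import structures.
From mathcomp Require Import all_boot all_order all_algebra finmap.
From mathcomp Require Import all_classical all_reals all_analysis.

Set Implicit Arguments.
Unset Strict Implicit.
Unset Printing Implicit Defensive.

Import Order.TTheory GRing.Theory Num.Theory numFieldNormedType.Exports.

Local Open Scope classical_set_scope.
Local Open Scope ring_scope.

(* Trees are in Ulam-Harris form: a vertex is the word of child indices read
   along its path from the root [::], so that its depth is its length, the
   children of u are the words rcons u i, and its ancestors are the words
   take k u. The edge joining a non-root vertex v to its parent is named v. *)
Section trees.
Implicit Types (T S : set (seq nat)) (n : nat).

Definition galton_watson_tree (offspring : seq nat -> nat) : set (seq nat) :=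
  [set v | forall k, (k < size v)%N -> (nth 0%N v k < offspring (take k v))%N].

Definition level T n : set (seq nat) := [set v | T v /\ size v = n].

(* The cardinality notation is meaningful because all the trees considered
   are locally finite: fset_set A is the empty finite set if A is infinite. *)
Definition level_size T n : nat := #|` fset_set (level T n)|.

Definition truncation T n : set (seq nat) := [set v | T v /\ (size v <= n)%N].

Definition rooted_subtree T S : Prop :=
  [/\ S [::], S `<=` T & forall u i, S (rcons u i) -> S u].

Definition root_cluster T (edge_open : seq nat -> bool) : set (seq nat) :=
  [set v | T v /\ forall k, (0 < k <= size v)%N -> edge_open (take k v)].

End trees.

Section probability.
Context {R : realType}.

Definition mutually_independent d d' (Om : measurableType d)
    (E : measurableType d') (P : probability Om R) (I : eqType)
    (X : I -> {RV P >-> E}) : Prop :=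
  forall (s : seq I) (A : I -> set E), uniq s ->
    (forall i, i \in s -> measurable (A i)) ->
    P (\bigcap_(i in [set` s]) (X i @^-1` A i)) =
      (\prod_(i <- s) P (X i @^-1` A i))%E.

Definition cond_prob d (Om : measurableType d) (P : probability Om R)
    (A B : set Om) : R :=
  fine (P (A `&` B)) / fine (P B).

(* Laws are set functions on the Borel sets measurableTypeR R, the measurable
   space carrying lebesgue_measure and exponential_prob. *)
Definition law d (Om : measurableType d) (P : probability Om R)
    (X : Om -> R) : set (measurableTypeR R) -> \bar R :=
  fun A => P (X @^-1` A).

Definition cond_law d (Om : measurableType d) (P : probability Om R)
    (X : Om -> R) (B : set Om) : set (measurableTypeR R) -> \bar R :=
  fun A => (cond_prob P (X @^-1` A) B)%:E.

Definition law_of_density (g : R -> R) : set (measurableTypeR R) -> \bar R :=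
  fun A => (\int[lebesgue_measure]_(x in A) (g x)%:E)%E.

Definition gamma2_pdf (rate x : R) : R :=
  if 0 <= x then rate ^+ 2 * x * expR (- (rate * x)) else 0.

Definition weakly_converges (m_ : nat -> set (measurableTypeR R) -> \bar R)
    (m : set (measurableTypeR R) -> \bar R) : Prop :=
  forall f : R -> R, continuous f -> bounded_fun f ->
    (\int[m_ n]_x (f x)%:E)%E @[n --> \oo] --> (\int[m]_x (f x)%:E)%E.

End probability.

Section galton_watson.
Context {R : realType} d (Om : measurableType d) (P : probability Om R).

Definition progeny_mean (Z : {RV P >-> nat}) : R :=
  fine 'E_P[fun w => (Z w)%:R].

Definition GW_lambda (Z : {RV P >-> nat}) : R :=
  2 * progeny_mean Z ^+ 2 / fine 'E_P[fun w => (Z w)%:R * ((Z w)%:R - 1)].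

(* nu v is the number of children of v; it is also sampled at the words v
   that turn out not to be vertices of the tree, where it plays no role. *)
Definition iid_offspring (Z : {RV P >-> nat}) (nu : seq nat -> {RV P >-> nat})
    : Prop :=
  mutually_independent nu /\
  forall v, distribution P (nu v) =1 distribution P Z.

Definition martingale_limit (mu : R) (T : set (seq nat)) : R :=
  limn (fun n => (level_size T n)%:R / mu ^+ n : R).

End galton_watson.

Section percolation.
Context {R : realType} d (Om : measurableType d) (Q : probability Om R).
Variables (T : set (seq nat)) (xi : seq nat -> {RV Q >-> bool}).

Definition bernoulli_percolation (p : R) : Prop :=
  mutually_independent xi /\ forall v, Q (xi v @^-1` [set true]) = p%:E.

Definition open_cluster (w : Om) : set (seq nat) :=
  root_cluster T (fun v => xi v w).

Definition Y (n : nat) (w : Om) : nat := level_size (open_cluster w) n.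

Definition survives (n : nat) : set Om := [set w | (0 < Y n w)%N].

(* S is a random subtree distributed as the quenched incipient infinite
   cluster of T. Measurability of the events "v belongs to S" is measurability
   for the product sigma-algebra on sets of vertices; on this sigma-algebra
   the law of S is determined by the marginals in the last clause. *)
Definition quenched_IIC d' (Om' : measurableType d') (P' : probability Om' R)
    (S : Om' -> set (seq nat)) : Prop :=
  [/\ forall w, rooted_subtree T (S w) /\ infinite_set (S w),
      forall v, measurable [set w | S w v] &
      forall n t, rooted_subtree (truncation T n) t ->
        cond_prob Q [set w | truncation (open_cluster w) n = t] (survives M)
          @[M --> \oo] --> fine (P' [set w | truncation (S w) n = t])].

End percolation.

(* Main.v *)
(* Let G_n(b) be the quenched probability that critical percolation on the tree
   cut at depth n hits a random set that contains each vertex of depth n with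
   probability b; thus G_n(1) = P_T[|Y_n| > 0] and
   G_n(1 - s) = 1 - E_T[s^|Y_n|]. Over the tree, r_n = E G_n satisfies
   r_(n+1) = 1 - E (1 - r_n/mu)^Z, whence 1/r_(n+1) - 1/r_n -> 1/lambda, so that
   n r_n -> lambda for b = 1 and n r_n -> (1/lambda + 1/j)^-1 for
   b = 1 - e^(-j/n). The difference D_n = G_n - r_n W_n is centred and is, up to
   a noise of variance O(n^-4), a sum of independent copies of D_(n-1)/mu over
   the children of the root; hence E D_n^2 = O(n^-4) uniformly in b, and
   n D_n -> 0 almost surely by Borel-Cantelli. This gives (a) and the Laplace
   transform of |Y_n|/n at every integer j, which determines the limit law
   because bounded continuous functions of x >= 0 are, up to a multiple of
   (1 - e^-x)^N, uniform limits of polynomials in e^-x.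

   For (c), the second-order Bonferroni inequalities and (a) for subtrees give
   E[s^C_n] = sum_v c_v W(v) / W with c_v = E_T[s^|Y_n| 1(v in Y_n)] <= mu^-n.
   Since the W(v) are independent of the first n levels, sum_v c_v (W(v) - 1) has
   second moment O(mu^-n) and tends to 0 almost surely, and what is left is
   sum_v c_v = E_T[|Y_n| s^|Y_n|]: the limit law is the size-biasing of the one
   in (b). *)
Require Import Defs.
From HB Require Import structures.
From mathcomp Require Import all_boot all_order all_algebra finmap.
From mathcomp Require Import all_classical all_reals all_analysis measurable_realfun.
From mathcomp Require Import ring lra zify.

Set Implicit Arguments.
Unset Strict Implicit.
Unset Printing Implicit Defensive.

Import Order.TTheory GRing.Theory Num.Theory numFieldNormedType.Exports.

Local Open Scope classical_set_scope.
Local Open Scope ring_scope.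

(** * Discrete random variables *)

(** The space of the tree and the space of the percolation stay separate. Percolation labels all
    words, so quenched probabilities are deterministic functions of a truncated tree. As truncated
    trees form a countable type, conditioning on one of them is summing over fibres. The
    second-moment contraction, by p^2 mu = p < 1 for a centred sum over the children, is run twice.
    The first run gives E G_n^2 = O(n^-2), so that the correction from pairs of children has second
    moment O(n^-4); the second run treats D_n. Uniformity in b matters because the b of a Laplace
    transform varies with n, and n^-4 is a rate that stays summable after multiplication by n^2.
    Dividing by W requires W > 0, which comes from the functional equation of its Laplace transform.
    Null sets may be indexed only by words and integers, hence the restriction to integer arguments.
    The incipient infinite cluster is quantified after the tree, so (c) has to be deduced
    deterministically from limits on a fixed tree. *)

Section discrete.
Context d (Om : measurableType d).

Definition discrete (A : Type) (X : Om -> A) : Prop :=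
  forall a, measurable (X @^-1` [set a]).

(** Fibres are indexed by codes instead of values so that they form a sequence, as countable unions
    and series require; the code of no value gives the empty fibre. *)
Definition fiber (A : countType) (X : Om -> A) (n : nat) : set Om :=
  [set w | choice.pickle (X w) = n].

Lemma fiber_preimage (A : countType) (X : Om -> A) n :
  fiber X n = set0 \/ exists a, fiber X n = X @^-1` [set a].
Proof.
have [[w Xw]|nX] := pselect (exists w, choice.pickle (X w) = n); last first.
  by left; apply/seteqP; split => // w Xw; apply: nX; exists w.
right; exists (X w); rewrite -Xw; apply/seteqP; split => w' /=.
  by move/(pcan_inj (@choice.pickleK A)).
by move=> <-.
Qed.

Lemma measurable_fiber (A : countType) (X : Om -> A) n :
  discrete X -> measurable (fiber X n).
Proof. by move=> dX; case: (fiber_preimage X n) => [->//|[a ->]]; exact: dX. Qed.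

Lemma trivIset_fiber (A : countType) (X : Om -> A) : trivIset setT (fiber X).
Proof. by move=> i j _ _ [w [<- <-]]. Qed.

Lemma bigcup_fiber (A : countType) (X : Om -> A) : \bigcup_n fiber X n = setT.
Proof. by apply/seteqP; split => // w _; exists (choice.pickle (X w)). Qed.

Lemma discrete_preimage (A : countType) (X : Om -> A) (B : set A) :
  discrete X -> measurable (X @^-1` B).
Proof.
move=> dX; rewrite -[X @^-1` B]setTI -(bigcup_fiber X) setI_bigcupl.
apply: bigcup_measurable => n _.
case: (fiber_preimage X n) => [->|[a ->]]; first by rewrite set0I.
have [Ba|nBa] := pselect (B a).
  rewrite setIidl; first exact: dX.
  by move=> w /= ->.
rewrite (_ : _ `&` _ = set0)//; apply/seteqP; split => // w /= [Xa BX].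
by apply: nBa; rewrite -Xa.
Qed.

Lemma discrete_comp (A B : countType) (X : Om -> A) (f : A -> B) :
  discrete X -> discrete (f \o X).
Proof. by move=> dX b; rewrite comp_preimage; exact: discrete_preimage. Qed.

Lemma discrete_pair (A B : countType) (X : Om -> A) (Y : Om -> B) :
  discrete X -> discrete Y -> discrete (fun w => (X w, Y w)).
Proof.
move=> dX dY [a b]; rewrite (_ : _ @^-1` _ = X @^-1` [set a] `&` Y @^-1` [set b]).
  exact: measurableI.
by apply/seteqP; split => w /= [-> ->].
Qed.

Lemma discrete_cst (A : countType) (a : A) : discrete (fun=> a : A).
Proof.
move=> b; have [->|ab] := eqVneq a b.
  by rewrite (_ : _ @^-1` _ = setT)//; apply/seteqP; split.
by rewrite (_ : _ @^-1` _ = set0)//; apply/seteqP; split => // w /= /eqP; rewrite (negbTE ab).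
Qed.

Lemma discrete_map (I : Type) (A : countType) (X : I -> Om -> A) (s : seq I) :
  (forall i, discrete (X i)) -> discrete (fun w => [seq X i w | i <- s]).
Proof.
move=> dX; elim: s => [|i s IHs] /=; first exact: discrete_cst.
exact: (discrete_comp (fun x => x.1 :: x.2) (discrete_pair (dX i) IHs)).
Qed.

Lemma discrete_measurable (A : countType) (X : Om -> A) d'
    (T : measurableType d') (f : A -> T) :
  discrete X -> measurable_fun setT (f \o X).
Proof.
by move=> dX _ B mB; rewrite setTI comp_preimage; exact: discrete_preimage.
Qed.

(** Meant for sums whose range and coefficients are read off a random truncated tree: on each of the
    countably many fibres the parameter is constant. *)
Lemma measurable_fun_glue (A : countType) (X : Om -> A) d'
    (T : measurableType d') (F : A -> Om -> T) :
  discrete X -> (forall a, measurable_fun setT (F a)) ->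
  measurable_fun setT (fun w => F (X w) w).
Proof.
move=> dX mF _ B mB; rewrite setTI.
rewrite -[_ @^-1` B]setTI -(bigcup_fiber X) setI_bigcupl.
apply: bigcup_measurable => n _.
case: (fiber_preimage X n) => [->|[a ->]]; first by rewrite set0I.
rewrite (_ : _ `&` _ = X @^-1` [set a] `&` (F a @^-1` B)); last first.
  by apply/seteqP; split => w /= [->].
by apply: measurableI; [exact: dX|rewrite -[_ @^-1` B]setTI; exact: mF].
Qed.

End discrete.

Section discrete_integral.
Local Open Scope ereal_scope.
Context d (Om : measurableType d) (R : realType) (P : probability Om R).

(** The substitute for conditional expectation: conditioning on a discrete variable means comparing
    integrals over its fibres one by one. *)
Lemma eq_integral_fibers (A : countType) (X : Om -> A) (F H : Om -> \bar R) :
  discrete X -> P.-integrable setT F -> P.-integrable setT H ->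
  (forall a, \int[P]_(w in X @^-1` [set a]) F w =
             \int[P]_(w in X @^-1` [set a]) H w) ->
  \int[P]_w F w = \int[P]_w H w.
Proof.
move=> dX iF iH FH; rewrite -(bigcup_fiber X) !integral_bigcup//.
- apply: eq_eseriesr => n _; case: (fiber_preimage X n) => [->|[a ->]]//.
  by rewrite !integral_set0.
- exact: trivIset_fiber.
- by move=> n; exact: measurable_fiber.
- by rewrite bigcup_fiber.
- exact: trivIset_fiber.
- by move=> n; exact: measurable_fiber.
- by rewrite bigcup_fiber.
Qed.

Lemma ge0_integral_fibers (A : countType) (X : Om -> A) (F : Om -> \bar R) :
  discrete X -> measurable_fun setT F -> (forall w, 0 <= F w) ->
  \int[P]_w F w = \sum_(n <oo) \int[P]_(w in fiber X n) F w.
Proof.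
move=> dX mF F0; rewrite -{1}(bigcup_fiber X) ge0_integral_bigcup//.
- by move=> n; exact: measurable_fiber.
- by rewrite bigcup_fiber.
- exact: trivIset_fiber.
Qed.

Lemma ge0_eq_integral_fibers (A : countType) (X : Om -> A) (F H : Om -> \bar R) :
  discrete X -> measurable_fun setT F -> measurable_fun setT H ->
  (forall w, 0 <= F w) -> (forall w, 0 <= H w) ->
  (forall a, \int[P]_(w in X @^-1` [set a]) F w =
             \int[P]_(w in X @^-1` [set a]) H w) ->
  \int[P]_w F w = \int[P]_w H w.
Proof.
move=> dX mF mH F0 H0 FH; rewrite !(ge0_integral_fibers dX)//.
apply: eq_eseriesr => n _; case: (fiber_preimage X n) => [->|[a ->]]//.
by rewrite !integral_set0.
Qed.

Lemma ge0_le_integral_fibers (A : countType) (X : Om -> A) (F H : Om -> \bar R) :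
  discrete X -> measurable_fun setT F -> measurable_fun setT H ->
  (forall w, 0 <= F w) -> (forall w, 0 <= H w) ->
  (forall a, \int[P]_(w in X @^-1` [set a]) F w <=
             \int[P]_(w in X @^-1` [set a]) H w) ->
  \int[P]_w F w <= \int[P]_w H w.
Proof.
move=> dX mF mH F0 H0 FH; rewrite !(ge0_integral_fibers dX)//.
apply: lee_nneseries => [n _ _|n _]; first exact: integral_ge0.
case: (fiber_preimage X n) => [->|[a ->]]//.
by rewrite !integral_set0.
Qed.

Lemma integral_fiber_cst (A : countType) (X : Om -> A) (f : A -> \bar R) a
    (D : set Om) :
  discrete X -> measurable D ->
  \int[P]_(w in D `&` X @^-1` [set a]) f (X w) = f a * P (D `&` X @^-1` [set a]).
Proof.
move=> dX mD; rewrite -integral_cst; last by apply: measurableI => //; exact: dX.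
by apply: eq_integral => w; rewrite inE => -[_ /= ->].
Qed.

Lemma eq_law_ge0_integral (A : countType) (X Y : Om -> A) (f : A -> \bar R) :
  discrete X -> discrete Y -> (forall a, 0 <= f a) ->
  (forall a, P (X @^-1` [set a]) = P (Y @^-1` [set a])) ->
  \int[P]_w f (X w) = \int[P]_w f (Y w).
Proof.
move=> dX dY f0 XY.
rewrite (ge0_integral_fibers dX)//; last exact: (discrete_measurable f dX).
rewrite (ge0_integral_fibers dY)//; last exact: (discrete_measurable f dY).
apply: eq_eseriesr => n _.
(* The fibre of a code may be empty for one variable and not for the other. The right-hand side
   depends on [Z] only through its point probabilities, which settles all cases at once. *)
have fib (Z : Om -> A) : discrete Z -> \int[P]_(w in fiber Z n) f (Z w) =
    if choice.unpickle n is Some a then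
      if choice.pickle a == n then f a * P (Z @^-1` [set a]) else 0 else 0.
  move=> dZ; case: (fiber_preimage Z n) => [Z0|[a Za]].
    rewrite Z0 integral_set0; case un: (choice.unpickle n) => [a|//].
    case: eqP => // an; rewrite (_ : Z @^-1` [set a] = set0) ?measure0 ?mule0//.
    apply/seteqP; split => // w Zw; rewrite -Z0 /fiber /=; move: Zw => /= ->.
    exact: an.
  have := integral_fiber_cst f a dZ measurableT; rewrite setTI Za => ->.
  have [Z0|/set0P[w Zw]] := eqVneq (Z @^-1` [set a]) set0.
    rewrite Z0 measure0 mule0; case: (choice.unpickle n) => [b|//]; case: eqP => // bn.
    rewrite (_ : Z @^-1` [set b] = set0) ?measure0 ?mule0//.
    by rewrite -Z0 -Za; apply/seteqP; split => [w /= Zb|w]; [rewrite /fiber /= Zb|rewrite Za Z0].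
  have : fiber Z n w by rewrite Za.
  by rewrite /fiber /= Zw => <-; rewrite choice.pickleK eqxx.
by rewrite !fib//; case: (choice.unpickle n) => // a; case: eqP => // _; rewrite XY.
Qed.

Definition indep (A B : countType) (X : Om -> A) (Y : Om -> B) : Prop :=
  forall a b, P (X @^-1` [set a] `&` Y @^-1` [set b]) =
              P (X @^-1` [set a]) * P (Y @^-1` [set b]).

Section independent.
Variables (A B : countType) (X : Om -> A) (Y : Om -> B).
Hypotheses (dX : discrete X) (dY : discrete Y) (XY : indep X Y).

Lemma indep_ge0_restrict (f : A -> \bar R) b : (forall a, 0 <= f a) ->
  \int[P]_(w in Y @^-1` [set b]) f (X w) =
  P (Y @^-1` [set b]) * \int[P]_w f (X w).
Proof.
move=> f0; have mY := dY b; have mf := discrete_measurable f dX.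
rewrite integral_mkcond [LHS](ge0_integral_fibers dX); last 2 first.
  exact: (iffLR (measurable_restrictT (f \o X) mY) (measurable_funTS mf)).
  by move=> w; rewrite patchE; case: ifP.
rewrite (ge0_integral_fibers dX)//.
rewrite -(@fineK _ (P _)) ?fin_num_measure// -nneseriesZl; last first.
  by move=> n _; exact: integral_ge0.
rewrite fineK ?fin_num_measure//.
apply: eq_eseriesr => n _; case: (fiber_preimage X n) => [->|[a ->]].
  by rewrite !integral_set0 mule0.
rewrite -integral_mkcondr.
rewrite setIC integral_fiber_cst// setIC XY.
have := integral_fiber_cst f a dX measurableT; rewrite setTI => ->.
by rewrite muleA muleC.
Qed.

Lemma indep_ge0_integral (f : A -> \bar R) (g : B -> \bar R) :
  (forall a, 0 <= f a) -> (forall b, 0 <= g b) ->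
  \int[P]_w (f (X w) * g (Y w)) = \int[P]_w f (X w) * \int[P]_w g (Y w).
Proof.
move=> f0 g0; have mf := discrete_measurable f dX.
have mg := discrete_measurable g dY.
rewrite -ge0_integralZl//; last exact: integral_ge0.
apply: (ge0_eq_integral_fibers dY).
- exact: emeasurable_funM.
- by apply: emeasurable_funM.
- by move=> w; rewrite mule_ge0.
- by move=> w; rewrite mule_ge0// integral_ge0.
move=> b; transitivity (\int[P]_(w in Y @^-1` [set b]) (g b * f (X w))).
  by apply: eq_integral => w; rewrite inE => /= ->; rewrite muleC.
rewrite ge0_integralZl//; last exact: measurable_funTS.
rewrite indep_ge0_restrict//.
transitivity (\int[P]_(w in Y @^-1` [set b]) (cst (\int[P]_w f (X w) * g b) w)).
  by rewrite integral_cst// (muleC _ (g b)) -muleA; congr (_ * _); exact: muleC.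
by apply: eq_integral => w; rewrite inE => /= ->.
Qed.

End independent.

End discrete_integral.

Section independent_integral.
Local Open Scope ereal_scope.
Context d (Om : measurableType d) (R : realType) (P : probability Om R).
Variables (A B : countType) (X : Om -> A) (Y : Om -> B).
Hypotheses (dX : discrete X) (dY : discrete Y) (XY : indep P X Y).

Lemma indep_restrict (f : A -> R) b :
  P.-integrable setT (fun w => (f (X w))%:E) ->
  \int[P]_(w in Y @^-1` [set b]) (f (X w))%:E =
  P (Y @^-1` [set b]) * \int[P]_w (f (X w))%:E.
Proof.
move=> fi; rewrite integralE [in RHS]integralE muleBr ?fin_num_measure//; last first.
  apply: fin_num_adde_defr; apply: integrable_fin_num => //.
  exact: integrable_funepos.
have pos : (fun w => (f (X w))%:E)^\+ = (fun a => maxe (f a)%:E 0) \o X.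
  by apply/funext => w; rewrite funeposE.
have neg : (fun w => (f (X w))%:E)^\- = (fun a => maxe (- (f a)%:E) 0) \o X.
  by apply/funext => w; rewrite funenegE.
rewrite pos neg; congr (_ - _).
  by apply: (indep_ge0_restrict dX dY XY (f := fun a => maxe (f a)%:E 0)) => a; rewrite le_max lexx orbT.
by apply: (indep_ge0_restrict dX dY XY (f := fun a => maxe (- (f a)%:E) 0)) => a; rewrite le_max lexx orbT.
Qed.

Lemma indep_integrable (f : A -> R) (g : B -> R) :
  P.-integrable setT (fun w => (f (X w))%:E) ->
  P.-integrable setT (fun w => (g (Y w))%:E) ->
  P.-integrable setT (fun w => (f (X w) * g (Y w))%:E).
Proof.
move=> /integrableP[mf fi] /integrableP[mg gi]; apply/integrableP; split.
  by rewrite (_ : (fun w => _) = (fun w => (f (X w))%:E * (g (Y w))%:E)) //;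
    apply: emeasurable_funM.
rewrite (eq_integral (fun w => `|(f (X w))%:E| * `|(g (Y w))%:E|)); last first.
  by move=> w _; rewrite EFinM abseM.
rewrite (indep_ge0_integral dX dY XY (f := fun a => `|(f a)%:E|)
  (g := fun b => `|(g b)%:E|))//.
by apply: lte_mul_pinfty => //; [exact: integral_ge0|rewrite ge0_fin_numE//; exact: integral_ge0].
Qed.

Lemma indep_integral (f : A -> R) (g : B -> R) :
  P.-integrable setT (fun w => (f (X w))%:E) ->
  P.-integrable setT (fun w => (g (Y w))%:E) ->
  \int[P]_w (f (X w) * g (Y w))%:E =
  \int[P]_w (f (X w))%:E * \int[P]_w (g (Y w))%:E.
Proof.
move=> fi gi; have fE := integrable_fin_num measurableT fi.
rewrite -(fineK fE) -integralZl//; apply: (eq_integral_fibers dY).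
- exact: indep_integrable.
- exact: integrableZl.
move=> b; transitivity (\int[P]_(w in Y @^-1` [set b]) ((g b)%:E * (f (X w))%:E)).
  by apply: eq_integral => w; rewrite inE => /= ->; rewrite -EFinM mulrC.
rewrite integralZl//; last exact: integrableS fi.
rewrite indep_restrict//.
transitivity (\int[P]_(w in Y @^-1` [set b]) (cst (\int[P]_w (f (X w))%:E * (g b)%:E) w)).
  by rewrite integral_cst// (muleC _ (g b)%:E) -muleA; congr (_ * _); exact: muleC.
by apply: eq_integral => w; rewrite inE fineK// => /= ->.
Qed.

End independent_integral.

(** Independence is stated for families of sets indexed by [I], while events about trees are finite
    lists of constraints. Membership is [List.In] because sets have no decidable equality. *)
Lemma mutually_independent_list (R : realType) d d' (Om : measurableType d)
    (E : measurableType d') (P : probability Om R) (I : eqType)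
    (X : I -> {RV P >-> E}) (L : seq (I * set E)) :
  mutually_independent X -> uniq [seq x.1 | x <- L] ->
  (forall x, List.In x L -> measurable x.2) ->
  P [set w | forall x, List.In x L -> x.2 (X x.1 w)] =
  (\prod_(x <- L) P (X x.1 @^-1` x.2))%E.
Proof.
move=> mX uL mL.
(* Turns the list into a family: the full set off the list and, as the keys are distinct, the set
   paired with [i] on it. *)
pose A i : set E := [set y | forall x, List.In x L -> x.1 = i -> x.2 y].
have AE x : List.In x L -> A x.1 = x.2.
  move=> xL; apply/seteqP; split => [y Ay|y xy z zL zx]; first exact: Ay.
  suff -> : z = x by [].
  elim: L uL {mL A} xL zL => //= a L IHL /andP[aL uL] [ax|xL] [az|zL].
  - by rewrite -ax -az.
  - exfalso; move: aL; rewrite ax -zx; move/negP; apply.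
    by elim: {IHL uL} L zL => //= b L IHL [->|/IHL]; rewrite in_cons ?eqxx// => ->; rewrite orbT.
  - exfalso; move: aL; rewrite az zx; move/negP; apply.
    by elim: {IHL uL} L xL => //= b L IHL [->|/IHL]; rewrite in_cons ?eqxx// => ->; rewrite orbT.
  - exact: IHL.
have keyP i : i \in [seq x.1 | x <- L] -> exists2 x, List.In x L & x.1 = i.
  elim: L {uL mL A AE} => //= a L IHL; rewrite in_cons => /orP[/eqP->|/IHL[x xL <-]].
    by exists a; [left|].
  by exists x; [right|].
have Pkey (x : I * set E) : List.In x L -> x.1 \in [seq x.1 | x <- L].
  by elim: L {uL mL A AE keyP} => //= a L IHL [->|/IHL]; rewrite in_cons ?eqxx// => ->; rewrite orbT.
transitivity (P (\bigcap_(i in [set` [seq x.1 | x <- L]]) (X i @^-1` A i))).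
  congr (P _); apply/seteqP; split => w /= H.
    by move=> i /= _ x xL <-; exact: H.
  move=> x xL; have := H x.1 (Pkey _ xL); rewrite /= AE//.
rewrite mX//; last by move=> i /keyP[x xL <-]; rewrite AE//; exact: mL.
rewrite big_map; elim: L {uL mL keyP Pkey} A AE => [|a L IHL] A AE.
  by rewrite !big_nil.
rewrite !big_cons AE; last by left.
by congr (_ * _)%E; apply: IHL => x xL; apply: AE; right.
Qed.

(** * Truncated Galton-Watson trees *)

(* Trees cut at height m: the list of the subtrees of the children. The type is
   countable, which makes random truncated trees discrete random variables and
   reduces measurability and independence to events {X = t}. *)
Fixpoint tr (m : nat) : countType :=
  if m is m'.+1 then (seq (tr m') : countType) else (unit : countType).

Definition tr0 m : tr m := if m is m'.+1 then [::] else tt.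

Fixpoint tree (e : seq nat -> nat) (m : nat) (u : seq nat) : tr m :=
  match m with
  | 0 => tt
  | m'.+1 => [seq tree e m' (rcons u i) | i <- iota 0 (e u)]
  end.

(** The constraints that single out a tree, one for each vertex at depth less than [m] below [u]. By
    [treeP], the event that a random tree equals [t] is a conjunction of events about distinct
    offspring variables. *)
Fixpoint nodes (m : nat) (u : seq nat) : tr m -> seq (seq nat * nat) :=
  match m with
  | 0 => fun=> [::]
  | m'.+1 => fun s => (u, size (s : seq (tr m'))) ::
      flatten [seq nodes (rcons u i) (nth (tr0 m') s i) | i <- iota 0 (size s)]
  end.

Lemma treeP e m u (t : tr m) :
  reflect (tree e m u = t) (all (fun x => e x.1 == x.2) (nodes u t)).
Proof.
apply: (iffP idP) => [|<-].
  elim: m u t => [|m IHm] u t /=; first by case: t.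
  case/andP => /eqP eu /allP/= H.
  apply: (@eq_from_nth _ (tr0 m)); first by rewrite size_map size_iota.
  move=> i; rewrite size_map size_iota => ieu.
  rewrite (nth_map 0%N) ?size_iota// nth_iota// add0n; apply: IHm.
  apply/allP => x xn; apply: H; apply/flattenP; eexists; last exact: xn.
  by apply: map_f; rewrite mem_iota add0n -eu.
elim: m u {t} => [//|m IHm] u /=.
rewrite size_map size_iota eqxx/=; apply/allP => x /flattenP[s /mapP[i]].
rewrite mem_iota add0n => /= ieu ->.
rewrite (nth_map 0%N) ?size_iota// nth_iota// add0n => xn.
exact: (allP (IHm (rcons u i))).
Qed.

Lemma nodes_prefix m u (t : tr m) x : x \in nodes u t ->
  exists2 y, x.1 = u ++ y & (size y < m)%N.
Proof.
elim: m u t => [|m IHm] u t //=.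
rewrite in_cons => /orP[/eqP->/=|/flattenP[s /mapP[i _ ->]]].
  by exists [::]; rewrite ?cats0.
by move=> /IHm[y -> ym]; exists (i :: y); rewrite ?cat_rcons.
Qed.

Lemma uniq_flatten_map (I T : eqType) (s : seq I) (f : I -> seq T) :
  uniq s -> (forall i, i \in s -> uniq (f i)) ->
  (forall i j x, i \in s -> j \in s -> x \in f i -> x \in f j -> i = j) ->
  uniq (flatten [seq f i | i <- s]).
Proof.
elim: s => //= i s IHs /andP[nis us] uf fij; rewrite cat_uniq uf ?mem_head//=.
rewrite IHs//; last 2 first.
- by move=> j js; apply: uf; rewrite in_cons js orbT.
- by move=> j k x js ks; apply: fij; rewrite in_cons ?js ?ks orbT.
rewrite andbT; apply/hasPn => x /flattenP[_ /mapP[j js ->]] xj.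
apply/negP => xi; move/negP: nis; apply.
by rewrite (fij i j x)// ?mem_head// in_cons js orbT.
Qed.

Lemma map_flatten (T T' : Type) (f : T -> T') (ss : seq (seq T)) :
  map f (flatten ss) = flatten (map (map f) ss).
Proof. by elim: ss => //= s ss IH; rewrite map_cat IH. Qed.

Lemma catI_size (T : eqType) (u v x y : seq T) :
  size u = size v -> u ++ x = v ++ y -> u = v.
Proof. by move=> uv /eqP; rewrite eqseq_cat// => /andP[/eqP]. Qed.

Lemma uniq_nodes m u (t : tr m) : uniq [seq x.1 | x <- nodes u t].
Proof.
elim: m u t => [//|m IHm] u t /=.
apply/andP; split.
  apply/negP => /mapP[x /flattenP[_ /mapP[i _ ->]] /nodes_prefix[y -> _]].
  move/eqP; rewrite cat_rcons -{1}[u]cats0 eqseq_cat// => /andP[_ /eqP].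
  by [].
rewrite map_flatten -map_comp; apply: uniq_flatten_map.
- exact: iota_uniq.
- by move=> i _; exact: IHm.
move=> i j _ _ _ /mapP[x /nodes_prefix[y xy _] ->] /mapP[x' /nodes_prefix[y' xy' _] xx'].
have : rcons u i ++ y = rcons u j ++ y' by rewrite -xy -xy'.
move/catI_size; rewrite !size_rcons => /(_ erefl)/rcons_inj.
by case.
Qed.

(** Moving the root changes the words but not the offspring numbers, which is why all subtrees have
    the same law. *)
Lemma map_snd_nodes m u v (t : tr m) :
  [seq x.2 | x <- nodes u t] = [seq x.2 | x <- nodes v t].
Proof.
elim: m u v t => [//|m IHm] u v t /=; congr (_ :: _).
rewrite !map_flatten -!map_comp; congr flatten; apply: eq_map => i /=.
exact: IHm.
Qed.

(** * Independence and common law of the subtrees *)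

Section gw_independence.
Local Open Scope ereal_scope.
Context {R : realType} d (Om : measurableType d) (P : probability Om R).
Variables (Z : {RV P >-> nat}) (nu : seq nat -> {RV P >-> nat}).
Hypothesis nu_iid : iid_offspring Z nu.

Definition gw_tree m u (w : Om) : tr m := tree (fun v => nu v w) m u.

Lemma gw_treeP m u (t : tr m) w :
  reflect (gw_tree m u w = t) (all (fun x => nu x.1 w == x.2) (nodes u t)).
Proof. exact: treeP. Qed.

Lemma discrete_nat (X : {RV P >-> nat}) : discrete X.
Proof.
move=> k; rewrite -[_ @^-1` _]setTI.
exact: (@measurable_funPT _ _ _ _ X measurableT).
Qed.

Lemma nodes_probability (L : seq (seq nat * nat)) : uniq [seq x.1 | x <- L] ->
  P [set w | all (fun x => nu x.1 w == x.2) L] =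
  \prod_(k <- [seq x.2 | x <- L]) P (Z @^-1` [set k]).
Proof.
move=> uL; pose L' : seq (seq nat * set nat) := [seq (x.1, [set x.2]) | x <- L].
have := @mutually_independent_list R _ _ Om _ P _ nu L' nu_iid.1.
rewrite -map_comp => /(_ uL) => H.
transitivity (P [set w | forall x, List.In x L' -> x.2 (nu x.1 w)]).
  congr (P _); apply/seteqP; split => w /=.
    move=> + x; rewrite /L'; elim: L {uL L' H} => //= a L IHL /andP[/eqP aw Lw].
    by case=> [<-//|]; exact: IHL.
  rewrite /L'; elim: L {uL L' H} => //= a L IHL Hx; apply/andP; split.
    by apply/eqP; apply: (Hx (a.1, [set a.2])); left.
  by apply: IHL => x xL; apply: Hx; right.
rewrite H//; rewrite /L' !big_map; apply: eq_bigr => x _ /=.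
exact: (nu_iid.2 x.1 [set x.2]).
Qed.

Lemma discrete_gw_tree m u : discrete (gw_tree m u).
Proof.
elim: m u => [|m IHm] u.
  exact: (@discrete_cst _ _ _ tt).
have -> : gw_tree m.+1 u = fun w =>
    [seq gw_tree m (rcons u i) w | i <- iota 0 (nu u w)] by [].
move=> t; rewrite (_ : _ @^-1` _ = nu u @^-1` [set size t] `&`
  (fun w => [seq gw_tree m (rcons u i) w | i <- iota 0 (size t)]) @^-1` [set t]).
  apply: measurableI; first exact: discrete_nat.
  by apply: discrete_map => i; exact: IHm.
apply/seteqP; split => w /= [].
  by move=> <-; rewrite size_map size_iota.
by move=> ->.
Qed.

Lemma gw_tree_probability m u (t : tr m) :
  P (gw_tree m u @^-1` [set t]) =
  \prod_(k <- [seq x.2 | x <- nodes u t]) P (Z @^-1` [set k]).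
Proof.
rewrite -nodes_probability ?uniq_nodes//; congr (P _).
by apply/seteqP; split => w /= /gw_treeP.
Qed.

Lemma gw_tree_law m u v (t : tr m) :
  P (gw_tree m u @^-1` [set t]) = P (gw_tree m v @^-1` [set t]).
Proof. by rewrite !gw_tree_probability (map_snd_nodes u v). Qed.

Lemma gw_tree_integral m u v (f : tr m -> \bar R) : (forall t, 0 <= f t) ->
  \int[P]_w f (gw_tree m u w) = \int[P]_w f (gw_tree m v w).
Proof.
move=> f0; apply: eq_law_ge0_integral => //; try exact: discrete_gw_tree.
exact: gw_tree_law.
Qed.

Lemma nu_integral u (f : nat -> \bar R) : (forall k, 0 <= f k) ->
  \int[P]_w f (nu u w) = \int[P]_w f (Z w).
Proof.
move=> f0; apply: eq_law_ge0_integral => //; try exact: discrete_nat.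
by move=> k; exact: (nu_iid.2 u [set k]).
Qed.

(** The first [n] generations below [u] are paired with subtrees rooted at fixed words, which need
    not be vertices of the tree. Keeping both in one variable allows subtrees to be split off one at
    a time. *)
Definition joint_tree n k u (vs : seq (seq nat)) (w : Om) : tr n * seq (tr k) :=
  (gw_tree n u w, [seq gw_tree k v w | v <- vs]).

Lemma discrete_joint_tree n k u vs : discrete (joint_tree n k u vs).
Proof.
apply: discrete_pair; first exact: discrete_gw_tree.
by apply: discrete_map => v; exact: discrete_gw_tree.
Qed.

Definition joint_nodes n k u vs (x : tr n * seq (tr k)) : seq (seq nat * nat) :=
  nodes u x.1 ++ flatten [seq nodes y.1 y.2 | y <- zip vs x.2].

Lemma joint_treeP n k u vs (x : tr n * seq (tr k)) w : size vs = size x.2 ->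
  reflect (joint_tree n k u vs w = x)
    (all (fun y => nu y.1 w == y.2) (joint_nodes u vs x)).
Proof.
case: x => t ts /= sz; rewrite /joint_nodes all_cat /=.
suff H : reflect ([seq gw_tree k v w | v <- vs] = ts)
    (all (fun y => nu y.1 w == y.2) (flatten [seq nodes y.1 y.2 | y <- zip vs ts])).
  apply: (iffP andP) => [[/gw_treeP tE /H tsE]|].
    by rewrite /joint_tree tsE -tE.
  by case=> tE tsE; split; [apply/gw_treeP|apply/H].
elim: vs ts sz => [|v vs IHvs] [|t' ts]//=; first by move=> _; apply: (iffP idP).
case=> sz; rewrite all_cat; apply: (iffP andP) => [[/gw_treeP vE /(IHvs _ sz) <-]|].
  by rewrite -vE.
by case=> vE vsE; split; [apply/gw_treeP|apply/IHvs].
Qed.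

Lemma uniq_joint_nodes n k u v0 vs (x : tr n * seq (tr k)) (t0 : tr k) :
  size vs = size x.2 -> uniq (v0 :: vs) ->
  (forall v, v \in v0 :: vs -> size v = (size u + n)%N) ->
  uniq [seq y.1 | y <- joint_nodes u vs x ++ nodes v0 t0].
Proof.
case: x => t ts /= sz /andP[v0vs uvs] sv.
have zvs : [seq y.1 | y <- zip vs ts] = vs by apply: unzip1_zip; rewrite sz.
have sn v (s : tr k) y : v \in v0 :: vs -> y \in nodes v s ->
    (size u + n <= size y.1)%N.
  by move=> /sv <- /nodes_prefix[z -> _]; rewrite size_cat leq_addr.
have zin y : y \in zip vs ts -> y.1 \in vs by rewrite -{2}zvs => /(map_f fst).
have vin y : y \in zip vs ts -> y.1 \in v0 :: vs by move/zin; rewrite in_cons orbC => ->.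
have zipinj y z : y \in zip vs ts -> z \in zip vs ts -> y.1 = z.1 -> y = z.
  move=> yz zz yzE; have : uniq [seq y.1 | y <- zip vs ts] by rewrite zvs.
  elim: (zip vs ts) yz zz => //= a s IHs; rewrite !in_cons.
  move=> /orP[/eqP ya|ys] /orP[/eqP za|zs]; first by rewrite ya za.
  - by rewrite -ya yzE (map_f fst zs).
  - by rewrite -za -yzE (map_f fst ys).
  - by move=> /andP[_]; exact: IHs.
rewrite /joint_nodes !map_cat cat_uniq; apply/and3P; split.
- rewrite cat_uniq uniq_nodes/=; apply/andP; split.
    apply/hasPn => y; rewrite map_flatten -map_comp => /flattenP[_ /mapP[z zz ->]].
    move=> /mapP[y' y'z ->]; apply/negP => /mapP[y'' /nodes_prefix[q qE qn] yy].
    have := sn z.1 z.2 y' (vin _ zz) y'z.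
    by rewrite yy qE size_cat leqNgt ltn_add2l qn.
  rewrite map_flatten -map_comp; apply: uniq_flatten_map.
  + by apply: (map_uniq (f := fst)); rewrite zvs.
  + by move=> y _; exact: uniq_nodes.
  move=> y z x yz zz /mapP[y' /nodes_prefix[q qE _] ->].
  move=> /mapP[z' /nodes_prefix[q' q'E _] yz']; apply: zipinj => //.
  have : y.1 ++ q = z.1 ++ q' by rewrite -qE -q'E.
  by apply: catI_size; rewrite (sv y.1) ?vin// (sv z.1) ?vin.
- apply/hasPn => x /mapP[y /nodes_prefix[q qE _] xy].
  have sx : (size u + n <= size x)%N.
    by rewrite xy qE size_cat (sv v0) ?mem_head// leq_addr.
  rewrite -map_cat; apply/negP => /mapP[z]; rewrite mem_cat => /orP[|/flattenP[_ /mapP[a az ->]]].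
    by move=> /nodes_prefix[q' q'E q'n] xz; move: sx; rewrite xz q'E size_cat leqNgt ltn_add2l q'n.
  move=> /nodes_prefix[q' q'E _] xz.
  have : v0 ++ q = a.1 ++ q' by rewrite -qE -q'E -xy -xz.
  move/catI_size; rewrite (sv v0) ?mem_head// (sv a.1) ?vin// => /(_ erefl) v0a.
  by move/negP: v0vs; apply; rewrite v0a zin.
- exact: uniq_nodes.
Qed.

(** All the offspring variables involved sit at distinct words: those of the first generations have
    depth less than [size u + n], the others extend distinct words of exactly that depth. *)
Lemma indep_joint_tree n k u v0 vs : uniq (v0 :: vs) ->
  (forall v, v \in v0 :: vs -> size v = (size u + n)%N) ->
  indep P (joint_tree n k u vs) (gw_tree k v0).
Proof.
move=> uvs sv x t0; have [sz|sz] := eqVneq (size vs) (size x.2); last first.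
  rewrite (_ : joint_tree n k u vs @^-1` [set x] = set0).
    by rewrite set0I measure0 mul0e.
  apply/seteqP; split => // w /= wx; move/eqP: sz; apply; rewrite -wx/=.
  by rewrite size_map.
have unodes := uniq_joint_nodes t0 sz uvs sv.
have E1 : joint_tree n k u vs @^-1` [set x] =
    [set w | all (fun y => nu y.1 w == y.2) (joint_nodes u vs x)].
  by apply/seteqP; split => w /= /joint_treeP -/(_ sz).
have E2 : gw_tree k v0 @^-1` [set t0] =
    [set w | all (fun y => nu y.1 w == y.2) (nodes v0 t0)].
  by apply/seteqP; split => w /= /gw_treeP.
rewrite E1 E2.
have -> : [set w | all (fun y => nu y.1 w == y.2) (joint_nodes u vs x)] `&`
    [set w | all (fun y => nu y.1 w == y.2) (nodes v0 t0)] =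
    [set w | all (fun y => nu y.1 w == y.2) (joint_nodes u vs x ++ nodes v0 t0)].
  by apply/seteqP; split => w /=; rewrite all_cat => /andP.
move: (unodes); rewrite map_cat cat_uniq => /and3P[u1 _ u2].
by rewrite !nodes_probability// map_cat big_cat.
Qed.

End gw_independence.

Fixpoint pairs (T : Type) (s : seq T) : seq (T * T) :=
  if s is x :: s' then [seq (x, y) | y <- s'] ++ pairs s' else [::].

Lemma pairs_map (T U : Type) (f : T -> U) (s : seq T) :
  pairs (map f s) = [seq (f x.1, f x.2) | x <- pairs s].
Proof. by elim: s => //= x s ->; rewrite map_cat -!map_comp. Qed.

Lemma size_pairs (T : Type) (s : seq T) : (size (pairs s) <= size s ^ 2)%N.
Proof.
elim: s => //= x s IHs; rewrite size_cat size_map.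
by apply: leq_trans (leq_add (leqnn _) IHs) _; lia.
Qed.

Lemma mem_pairs (T : eqType) (s : seq T) x y : uniq s -> (x, y) \in pairs s ->
  [/\ x \in s, y \in s & x != y].
Proof.
elim: s => //= a s IHs /andP[as_ us]; rewrite mem_cat => /orP[/mapP[b bs [-> ->]]|].
  by rewrite mem_head in_cons bs orbT; split=> //; apply: contraNneq as_ => ->.
by move=> /(IHs us)[xs ys xy]; rewrite !in_cons xs ys !orbT.
Qed.

(** Cauchy-Schwarz against the constant sequence 1. *)
Lemma sqr_sum_le (R : realDomainType) (I : Type) (s : seq I) (a : I -> R) :
  (\sum_(i <- s) a i) ^+ 2 <= (size s)%:R * \sum_(i <- s) a i ^+ 2.
Proof.
elim: s => [|i s IHs]; first by rewrite !big_nil mul0r expr2 mulr0.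
rewrite !big_cons; set S := \sum_(j <- s) a j in IHs *.
set Q := \sum_(j <- s) _ in IHs *.
have H : 2 * a i * S <= (size s)%:R * a i ^+ 2 + Q.
  rewrite /S /Q; elim: s {IHs S Q} => [|j s IHs] /=.
    by rewrite !big_nil mulr0 mul0r addr0.
  rewrite !big_cons -natr1 mulrDr mulrDl mul1r.
  have := sqr_ge0 (a i - a j); rewrite sqrrB => H.
  by move: IHs H; rewrite -!mulrA; set x := \sum_(k <- s) a k; set y := \sum_(k <- s) _; nra.
by rewrite /= -natr1; nra.
Qed.

Definition same_depth n (vs : seq (seq nat)) : Prop :=
  uniq vs /\ forall v, v \in vs -> size v = n.

Section real_integral.
Local Open Scope ereal_scope.
Context d (Om : measurableType d) (R : realType) (P : probability Om R).
Implicit Types F G : Om -> R.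

Lemma integrable_addR F G : P.-integrable setT (fun w => (F w)%:E) ->
  P.-integrable setT (fun w => (G w)%:E) ->
  P.-integrable setT (fun w => (F w + G w)%:E).
Proof.
move=> iF iG; rewrite (_ : (fun w => _) = (fun w => (F w)%:E) \+ (fun w => (G w)%:E))//.
exact: integrableD.
Qed.

Lemma integrable_scaleR (k : R) F : P.-integrable setT (fun w => (F w)%:E) ->
  P.-integrable setT (fun w => (k * F w)%:E).
Proof.
move=> iF; rewrite (_ : (fun w => _) = (fun w => k%:E * (F w)%:E))//.
exact: integrableZl.
Qed.

Lemma integral_addR F G : P.-integrable setT (fun w => (F w)%:E) ->
  P.-integrable setT (fun w => (G w)%:E) ->
  \int[P]_w (F w + G w)%:E = \int[P]_w (F w)%:E + \int[P]_w (G w)%:E.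
Proof. by move=> iF iG; under eq_integral do rewrite EFinD; exact: integralD. Qed.

Lemma integral_scaleR (k : R) F : P.-integrable setT (fun w => (F w)%:E) ->
  \int[P]_w (k * F w)%:E = k%:E * \int[P]_w (F w)%:E.
Proof. by move=> iF; under eq_integral do rewrite EFinM; exact: integralZl. Qed.

(** Writing the restriction to a fibre as multiplication by an indicator lets conditioning enter the
    product formula for independent variables. *)
Lemma integral_fiberE (A : countType) (X : Om -> A) a F :
  \int[P]_(w in X @^-1` [set a]) (F w)%:E = \int[P]_w ((X w == a)%:R * F w)%:E.
Proof.
rewrite integral_mkcond; apply: eq_integral => w _; rewrite patchE.
have [Xa|/eqP Xa] := eqVneq (X w) a; first by rewrite mem_set// mul1r.
by rewrite memNset// mul0r.
Qed.

Lemma integral_fiber1 (A : countType) (X : Om -> A) a : discrete X ->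
  \int[P]_w ((X w == a)%:R)%:E = P (X @^-1` [set a]).
Proof.
move=> dX; transitivity (\int[P]_(w in X @^-1` [set a]) (cst 1%:E w)); last first.
  by rewrite integral_cst// mul1e.
by rewrite (integral_fiberE X a (cst 1%R)); apply: eq_integral => w _; rewrite mulr1.
Qed.

Lemma integrable_bounded (A : countType) (X : Om -> A) (f : A -> R) (M : R) :
  discrete X -> (forall a, (`|f a| <= M)%R) ->
  P.-integrable setT (fun w => (f (X w))%:E).
Proof.
move=> dX fM; apply: (@measurable_bounded_integrable _ _ _ P (f \o X) setT) => //.
- by rewrite -ge0_fin_numE //; exact: fin_num_measure.
- exact: discrete_measurable.
- exists M; split; first by rewrite num_real.
  by move=> x Mx w _ /=; exact: le_trans (fM _) (ltW Mx).
Qed.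

End real_integral.

(** * The branching property given the first generations *)

Section branching.
Local Open Scope ereal_scope.
Context {R : realType} d (Om : measurableType d) (P : probability Om R).
Variables (Z : {RV P >-> nat}) (nu : seq nat -> {RV P >-> nat}).
Hypothesis nu_iid : iid_offspring Z nu.
Notation T := (gw_tree nu).
Notation E1 k phi := (\int[P]_w (phi (T k [::] w))%:E).

Let dT m u : discrete (T m u). Proof. exact: discrete_gw_tree. Qed.

Definition children u (t : tr 1) : seq (seq nat) :=
  [seq rcons u i | i <- iota 0 (size t)].

Lemma uniq_children u t : uniq (children u t).
Proof. by rewrite map_inj_uniq ?iota_uniq//; exact: rcons_injr. Qed.

Lemma size_children u t v : v \in children u t -> size v = (size u + 1)%N.
Proof. by case/mapP => i _ ->; rewrite size_rcons addn1. Qed.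

Lemma measurable_gw_tree k u (phi : tr k -> R) :
  measurable_fun setT (fun w => (phi (T k u w))%:E).
Proof.

exact: (@discrete_measurable _ _ _ (T k u) _ (\bar R) (fun t => (phi t)%:E) (dT u)).
Qed.

Lemma integrable_gw_tree k u (phi : tr k -> R) :
  P.-integrable setT (fun w => (phi (T k [::] w))%:E) ->
  P.-integrable setT (fun w => (phi (T k u w))%:E).
Proof.
move=> /integrableP[_ fi]; apply/integrableP; split.
  exact: measurable_gw_tree.
by rewrite (gw_tree_integral nu_iid u [::] (f := fun t => `|(phi t)%:E|)).
Qed.

Lemma gw_tree_integralR k u (phi : tr k -> R) :
  \int[P]_w (phi (T k u w))%:E = E1 k phi.
Proof.
rewrite integralE [RHS]integralE.
have pos v : (fun w => (phi (T k v w))%:E)^\+ = (fun a => maxe (phi a)%:E 0) \o T k v.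
  by apply/funext => w; rewrite funeposE.
have neg v : (fun w => (phi (T k v w))%:E)^\- = (fun a => maxe (- (phi a)%:E) 0) \o T k v.
  by apply/funext => w; rewrite funenegE.
rewrite (pos u) (pos [::]) (neg u) (neg [::]); congr (_ - _).
  by apply: (gw_tree_integral nu_iid u [::] (f := fun a => maxe (phi a)%:E 0)) => a; rewrite le_max lexx orbT.
by apply: (gw_tree_integral nu_iid u [::] (f := fun a => maxe (- (phi a)%:E) 0)) => a; rewrite le_max lexx orbT.
Qed.

Section levels.
Variables (n k : nat) (u : seq nat).

Let ok_tail v0 vs : same_depth (size u + n) (v0 :: vs) -> same_depth (size u + n) vs.
Proof.
by move=> [/= /andP[_ ?] H]; split => // v vvs; apply: H; rewrite in_cons vvs orbT.
Qed.

Let fiber_ge0 (t : tr n) (f : tr k -> \bar R) v : size v = (size u + n)%N ->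
  (forall s, 0 <= f s) ->
  \int[P]_w (((T n u w == t)%:R)%:E * f (T k v w)) =
  P (T n u @^-1` [set t]) * \int[P]_w f (T k [::] w).
Proof.
move=> sv f0.
have := indep_joint_tree nu_iid (n := n) (k := k) (u := u) (v0 := v) (vs := [::]) isT.
have sv1 v' : v' \in [:: v] -> size v' = (size u + n)%N by rewrite inE => /eqP ->.
move=> /(_ sv1) ind.
rewrite (indep_ge0_integral _ _ ind (f := fun x => ((x.1 == t)%:R)%:E) (g := f))//.
rewrite (integral_fiber1 _ t (dT u)).
by rewrite (gw_tree_integral nu_iid v [::]).
exact: discrete_joint_tree.
Qed.

Lemma branching_sum (t : tr n) vs (phi : tr k -> R) :
  same_depth (size u + n) vs -> (forall s, (0 <= phi s)%R) ->
  \int[P]_w ((T n u w == t)%:R * \sum_(v <- vs) phi (T k v w))%:E =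
  P (T n u @^-1` [set t]) * ((size vs)%:R%:E * E1 k phi).
Proof.
move=> [_ svs] phi0.
have mphi v : measurable_fun setT (fun w => (phi (T k v w))%:E).
  exact: measurable_gw_tree.
have mt : measurable_fun setT (fun w => (((T n u w == t)%:R : R))%:E).
  exact: (measurable_gw_tree u (fun t' => (t' == t)%:R)).
transitivity (\int[P]_w (\sum_(v <- vs) ((T n u w == t)%:R%:E * (phi (T k v w))%:E))).
  by apply: eq_integral => w _; rewrite EFinM -sumEFin ge0_sume_distrr// => v _; rewrite lee_fin.
rewrite ge0_integral_sum//; last 2 first.
- by move=> v; apply: emeasurable_funM.
- by move=> v w _; rewrite mule_ge0 ?lee_fin.
rewrite muleCA.
have -> : (size vs)%:R%:E * (P (T n u @^-1` [set t]) * E1 k phi) =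
    \sum_(v <- vs) (P (T n u @^-1` [set t]) * E1 k phi).
  rewrite muleC; elim: (vs) => [|v vs' IH]; first by rewrite big_nil mule0.
  by rewrite big_cons -IH /= -natr1 EFinD ge0_muleDr ?lee_fin// mule1 addeC.
rewrite !big_seq; apply: eq_bigr => v vvs.
by rewrite -(fiber_ge0 t (f := fun s => (phi s)%:E) (svs _ vvs)).
Qed.


Lemma branching_prod (t : tr n) vs (f : tr k -> R) (a : R) :
  same_depth (size u + n) vs -> (forall s, (0 <= f s)%R) -> E1 k f = a%:E ->
  \int[P]_w ((T n u w == t)%:R * \prod_(v <- vs) f (T k v w))%:E =
  P (T n u @^-1` [set t]) * (a ^+ size vs)%:E.
Proof.
move=> ok f0 fa; elim: vs ok => [|v0 vs IHvs] ok.
  rewrite mule1 -(integral_fiber1 P t (dT u)).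
  by apply: eq_integral => w _; rewrite big_nil mulr1.
have [uvs svs] := ok; have ind := indep_joint_tree nu_iid (k := k) uvs svs.
transitivity (\int[P]_w (((T n u w == t)%:R * \prod_(v <- vs) f (T k v w))%:E *
    (f (T k v0 w))%:E)).
  by apply: eq_integral => w _; rewrite big_cons -EFinM; congr EFin; ring.
pose F (x : tr n * seq (tr k)) : \bar R :=
  ((x.1 == t)%:R * \prod_(s <- x.2) f s)%:E.
have FE w : ((T n u w == t)%:R * \prod_(v <- vs) f (T k v w))%:E =
    F (joint_tree nu n k u vs w) by rewrite /F /= big_map.
under eq_integral do rewrite FE.
rewrite (indep_ge0_integral _ _ ind (f := F) (g := fun s => (f s)%:E))//.
- under eq_integral do rewrite -FE.
  rewrite IHvs; last exact: ok_tail ok.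
  rewrite gw_tree_integralR fa -muleA -EFinM.
  by rewrite /= exprS mulrC.
- exact: discrete_joint_tree.
- by move=> x; rewrite lee_fin mulr_ge0// prodr_ge0.
Qed.

Lemma branching_pair (t : tr n) v v' (f : tr k -> R) (a : R) :
  same_depth (size u + n) [:: v; v'] -> (forall s, (0 <= f s)%R) -> E1 k f = a%:E ->
  \int[P]_w ((T n u w == t)%:R * (f (T k v w) * f (T k v' w)))%:E =
  P (T n u @^-1` [set t]) * (a ^+ 2)%:E.
Proof.
move=> ok f0 fa; rewrite -(branching_prod t ok f0 fa); apply: eq_integral => w _.
by rewrite !big_cons big_nil mulr1.
Qed.

(** Variances of independent centred variables add up; the induction splits off one subtree at a
    time. The first conclusion is carried along for the induction, where it makes the cross term
    integrable. *)
Lemma branching_variance (t : tr n) vs (c : seq nat -> R) (phi : tr k -> R)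
    (a2 : R) : same_depth (size u + n) vs ->
  P.-integrable setT (fun w => (phi (T k [::] w))%:E) ->
  P.-integrable setT (fun w => (phi (T k [::] w) ^+ 2)%:E) ->
  E1 k phi = 0 -> \int[P]_w (phi (T k [::] w) ^+ 2)%:E = a2%:E ->
  [/\ P.-integrable setT (fun w =>
        ((T n u w == t)%:R * \sum_(v <- vs) c v * phi (T k v w))%:E),
      P.-integrable setT (fun w =>
        ((T n u w == t)%:R * (\sum_(v <- vs) c v * phi (T k v w)) ^+ 2)%:E) &
      \int[P]_w ((T n u w == t)%:R * (\sum_(v <- vs) c v * phi (T k v w)) ^+ 2)%:E
      = P (T n u @^-1` [set t]) * (a2 * \sum_(v <- vs) c v ^+ 2)%:E].
Proof.
move=> ok i1 i2 m1 m2; elim: vs ok => [|v0 vs IHvs] ok.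
  split.
  - rewrite [X in P.-integrable _ X](_ : _ = cst 0); first exact: integrable0.
    by apply/funext => w; rewrite big_nil mulr0.
  - rewrite [X in P.-integrable _ X](_ : _ = cst 0); first exact: integrable0.
    by apply/funext => w; rewrite big_nil expr0n mulr0.
  - rewrite big_nil mulr0 mule0 (eq_integral (cst 0)) ?integral0//.
    by move=> w _; rewrite big_nil expr0n mulr0.
have [j1 j2 j3] := IHvs (ok_tail ok).
have [uvs svs] := ok; have ind := indep_joint_tree nu_iid (k := k) uvs svs.
have dJ : discrete (joint_tree nu n k u vs) by exact: discrete_joint_tree.
pose I (x : tr n * seq (tr k)) : R := (x.1 == t)%:R.
pose S (x : tr n * seq (tr k)) : R := (\sum_(y <- zip vs x.2) c y.1 * phi y.2)%R.
have SE w : (\sum_(v <- vs) c v * phi (T k v w))%R = S (joint_tree nu n k u vs w).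
  rewrite /S /=; elim: (vs) => [|v vs' IH] /=; first by rewrite !big_nil.
  by rewrite !big_cons IH.
have iI : P.-integrable setT (fun w => (I (joint_tree nu n k u vs w))%:E).
  apply: (integrable_bounded P (M := 1) dJ) => x.
  by rewrite /I; case: eqP; rewrite ?normr1 ?normr0.
have iX := integrable_gw_tree v0 i1.
have iX2 : P.-integrable setT (fun w => (phi (T k v0 w) ^+ 2)%:E).
  exact: (integrable_gw_tree v0 (phi := fun s => (phi s ^+ 2)%R) i2).
have iIS : P.-integrable setT (fun w => (I (joint_tree nu n k u vs w) *
    S (joint_tree nu n k u vs w))%:E).
  by move: j1; apply: eq_integrable => // w _; rewrite SE.
have iIX := indep_integrable dJ (dT v0) ind iI iX.
have iIX2 := indep_integrable dJ (dT v0) ind (g := fun s => (phi s ^+ 2)%R) iI iX2.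
have iISX := indep_integrable dJ (dT v0) ind (f := fun x => (I x * S x)%R) iIS iX.
have eq2 w : ((T n u w == t)%:R * (\sum_(v <- v0 :: vs) c v * phi (T k v w)) ^+ 2 =
    (T n u w == t)%:R * (\sum_(v <- vs) c v * phi (T k v w)) ^+ 2 +
    ((2 * c v0) * ((I (joint_tree nu n k u vs w) * S (joint_tree nu n k u vs w)) *
       phi (T k v0 w)) +
    c v0 ^+ 2 * (I (joint_tree nu n k u vs w) * phi (T k v0 w) ^+ 2)))%R.
  by rewrite big_cons SE /I /=; ring.
have iB := integrable_scaleR (2 * c v0) iISX.
have iC := integrable_scaleR (c v0 ^+ 2) iIX2.
split.
- have := integrable_addR (integrable_scaleR (c v0) iIX) j1.
  by apply: eq_integrable => // w _; rewrite big_cons /I /=; congr EFin; ring.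
- have := integrable_addR j2 (integrable_addR iB iC).
  by apply: eq_integrable => // w _; rewrite eq2.
under eq_integral do rewrite eq2.
rewrite (integral_addR j2 (integrable_addR iB iC)) (integral_addR iB iC).
rewrite (integral_scaleR _ iISX) (integral_scaleR _ iIX2) j3.
rewrite (indep_integral dJ (dT v0) ind (f := fun x => (I x * S x)%R) iIS iX).
rewrite (indep_integral dJ (dT v0) ind (g := fun s => (phi s ^+ 2)%R) iI iX2).
(* The cross term carries the factor E phi = 0. *)
rewrite gw_tree_integralR m1 mule0 mule0 add0e.
rewrite (gw_tree_integralR v0 (fun s => (phi s ^+ 2)%R)) m2.
rewrite (integral_fiber1 P t (dT u)) big_cons.
have /fineK <- : P (T n u @^-1` [set t]) \is a fin_num by rewrite fin_num_measure//; exact: dT.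
by rewrite -!EFinM -EFinD; congr EFin; ring.
Qed.

End levels.
End branching.

Section branching_step.
Local Open Scope ereal_scope.
Context {R : realType} d (Om : measurableType d) (P : probability Om R).
Variables (Z : {RV P >-> nat}) (nu : seq nat -> {RV P >-> nat}).
Hypothesis nu_iid : iid_offspring Z nu.
Notation T := (gw_tree nu).
Notation E1 k phi := (\int[P]_w (phi (T k [::] w))%:E).

Let dT m u : discrete (T m u). Proof. exact: discrete_gw_tree. Qed.

Lemma gw_treeS k u w :
  T k.+1 u w = [seq T k v w | v <- children u (T 1 u w)].
Proof. by rewrite /children -map_comp /= size_map size_iota; exact: eq_map. Qed.

Lemma size_gw_tree1 u w : size (T 1 u w) = nu u w.
Proof. by rewrite /= size_map size_iota. Qed.

Lemma same_depth_children u t : same_depth (size u + 1) (children u t).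
Proof. by split; [exact: uniq_children|exact: size_children]. Qed.

Lemma size_childrenE u (t : tr 1) : size (children u t) = size t.
Proof. by rewrite size_map size_iota. Qed.

(** Wald's identity, obtained by conditioning on the first generation. *)
Lemma offspring_sum k u (phi : tr k -> R) (a : R) : (forall s, (0 <= phi s)%R) ->
  E1 k phi = a%:E ->
  \int[P]_w (\sum_(t <- T k.+1 u w) phi t)%:E = \int[P]_w ((Z w)%:R * a)%:E.
Proof.
move=> phi0 ma; have a0 : (0 <= a)%R by rewrite -lee_fin -ma integral_ge0// => w _; rewrite lee_fin.
rewrite -(nu_integral nu_iid u (f := fun j => (j%:R * a)%:E)); last first.
  by move=> j; rewrite lee_fin mulr_ge0.
apply: (ge0_eq_integral_fibers (dT (m := 1) u)).
- exact: (measurable_gw_tree _ u (fun s : tr k.+1 => (\sum_(t <- s) phi t)%R)).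
- under eq_fun do rewrite -size_gw_tree1.
  exact: (measurable_gw_tree _ u (fun s : tr 1 => ((size s)%:R * a)%R)).
- by move=> w; rewrite lee_fin sumr_ge0.
- by move=> w; rewrite lee_fin mulr_ge0.
move=> t; rewrite !integral_fiberE.
transitivity (\int[P]_w ((T 1 u w == t)%:R * \sum_(v <- children u t) phi (T k v w))%:E).
  apply: eq_integral => w _; case: eqP => [tE|_]; last by rewrite !mul0r.
  by rewrite gw_treeS big_map tE.
rewrite (branching_sum nu_iid _ (same_depth_children u t))// ma size_childrenE.
transitivity (\int[P]_(w in T 1 u @^-1` [set t]) (cst (((size t)%:R * a)%:E) w)).
  by rewrite integral_cst; [rewrite muleC|exact: dT].
rewrite (integral_fiberE P _ _ (cst ((size t)%:R * a)%R)).
apply: eq_integral => w _; case: eqP => [tE|_]; last by rewrite !mul0r.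
by rewrite -size_gw_tree1 tE.
Qed.

(** Given the first generation the factors are independent with mean [a]; this is the recursion of
    generating functions. *)
Lemma offspring_prod k u (f : tr k -> R) (a : R) : (forall s, (0 <= f s)%R) ->
  E1 k f = a%:E ->
  \int[P]_w (\prod_(t <- T k.+1 u w) f t)%:E = \int[P]_w (a ^+ Z w)%:E.
Proof.
move=> f0 fa; have a0 : (0 <= a)%R by rewrite -lee_fin -fa integral_ge0// => w _; rewrite lee_fin.
rewrite -(nu_integral nu_iid u (f := fun j => (a ^+ j)%:E)); last first.
  by move=> j; rewrite lee_fin exprn_ge0.
apply: (ge0_eq_integral_fibers (dT (m := 1) u)).
- exact: (measurable_gw_tree _ u (fun s : tr k.+1 => (\prod_(t <- s) f t)%R)).
- under eq_fun do rewrite -size_gw_tree1.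
  exact: (measurable_gw_tree _ u (fun s : tr 1 => (a ^+ (size s))%R)).
- by move=> w; rewrite lee_fin prodr_ge0.
- by move=> w; rewrite lee_fin exprn_ge0.
move=> t; rewrite !integral_fiberE.
transitivity (\int[P]_w ((T 1 u w == t)%:R * \prod_(v <- children u t) f (T k v w))%:E).
  apply: eq_integral => w _; case: eqP => [tE|_]; last by rewrite !mul0r.
  by rewrite gw_treeS big_map tE.
rewrite (branching_prod nu_iid _ (same_depth_children u t) f0 fa) size_childrenE.
transitivity (\int[P]_(w in T 1 u @^-1` [set t]) (cst ((a ^+ size t)%:E) w)).
  by rewrite integral_cst; [rewrite muleC|exact: dT].
rewrite (integral_fiberE P _ _ (cst (a ^+ size t)%R)).
apply: eq_integral => w _; case: eqP => [tE|_]; last by rewrite !mul0r.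
by rewrite -size_gw_tree1 tE.
Qed.

(** The list and the coefficients may depend on the first [n] generations, because these are frozen
    on each fibre. *)
Lemma level_variance n k u (L : tr n -> seq (seq nat)) (c : tr n -> seq nat -> R)
    (phi : tr k -> R) (a2 : R) :
  (forall t, same_depth (size u + n) (L t)) ->
  P.-integrable setT (fun w => (phi (T k [::] w))%:E) ->
  P.-integrable setT (fun w => (phi (T k [::] w) ^+ 2)%:E) ->
  E1 k phi = 0 -> \int[P]_w (phi (T k [::] w) ^+ 2)%:E = a2%:E ->
  \int[P]_w ((\sum_(v <- L (T n u w)) c (T n u w) v * phi (T k v w)) ^+ 2)%:E =
  \int[P]_w (a2 * \sum_(v <- L (T n u w)) c (T n u w) v ^+ 2)%:E.
Proof.
move=> okL i1 i2 m1 m2.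
have a0 : (0 <= a2)%R by rewrite -lee_fin -m2 integral_ge0// => w _; rewrite lee_fin sqr_ge0.
apply: (ge0_eq_integral_fibers (dT (m := n) u)).
- apply: (measurable_fun_glue
    (F := fun t w => ((\sum_(v <- L t) c t v * phi (T k v w)) ^+ 2)%:E) (dT (m := n) u)).
  move=> t; apply/measurable_EFinP; apply: measurable_funX.
  apply: measurable_sum => v; apply: measurable_funM; first exact: measurable_cst.
  by apply/measurable_EFinP; exact: measurable_gw_tree.
- exact: (measurable_gw_tree _ u (fun t => (a2 * \sum_(v <- L t) c t v ^+ 2)%R)).
- by move=> w; rewrite lee_fin sqr_ge0.
- by move=> w; rewrite lee_fin mulr_ge0// sumr_ge0// => v _; rewrite sqr_ge0.
move=> t; rewrite !integral_fiberE.
transitivity (\int[P]_w ((T n u w == t)%:R * (\sum_(v <- L t) c t v * phi (T k v w)) ^+ 2)%:E).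
  by apply: eq_integral => w _; case: eqP => [->|_]//; rewrite !mul0r.
have [_ _ ->] := branching_variance nu_iid t (c t) (okL t) i1 i2 m1 m2.
transitivity (\int[P]_(w in T n u @^-1` [set t]) (cst ((a2 * \sum_(v <- L t) c t v ^+ 2)%:E) w)).
  by rewrite integral_cst; [rewrite muleC|exact: dT].
rewrite (integral_fiberE P _ _ (cst (a2 * \sum_(v <- L t) c t v ^+ 2)%R)).
by apply: eq_integral => w _; case: eqP => [->|_]//; rewrite !mul0r.
Qed.

Lemma offspring_variance k u (phi : tr k -> R) (a2 : R) :
  P.-integrable setT (fun w => (phi (T k [::] w))%:E) ->
  P.-integrable setT (fun w => (phi (T k [::] w) ^+ 2)%:E) ->
  E1 k phi = 0 -> \int[P]_w (phi (T k [::] w) ^+ 2)%:E = a2%:E ->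
  \int[P]_w ((\sum_(t <- T k.+1 u w) phi t) ^+ 2)%:E = \int[P]_w ((Z w)%:R * a2)%:E.
Proof.
move=> i1 i2 m1 m2.
have a0 : (0 <= a2)%R by rewrite -lee_fin -m2 integral_ge0// => w _; rewrite lee_fin sqr_ge0.
have H := level_variance (fun _ _ => 1%R) (same_depth_children u) i1 i2 m1 m2.
transitivity (\int[P]_w ((\sum_(v <- children u (T 1 u w)) 1 * phi (T k v w)) ^+ 2)%:E).
  apply: eq_integral => w _; rewrite gw_treeS big_map; congr ((_ ^+ 2)%:E).
  by apply: eq_bigr => v _; rewrite mul1r.
rewrite H -(nu_integral nu_iid u (f := fun j => (j%:R * a2)%:E)); last first.
  by move=> j; rewrite lee_fin mulr_ge0.
apply: eq_integral => w _; rewrite big_const_seq count_predT size_childrenE.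
by rewrite size_gw_tree1 -Monoid.iteropE/= expr1n mulrC; congr (_ * _)%:E.
Qed.

(** There are at most Z^2 pairs: Cauchy-Schwarz costs one factor Z^2, and the sum of squares has at
    most Z^2 terms, each of mean [a ^+ 2] because the two subtrees of a pair are independent. This
    is where the fourth moment of Z comes from. *)
Lemma offspring_pairs k u (phi : tr k -> R) (a : R) : (forall s, (0 <= phi s)%R) ->
  \int[P]_w (phi (T k [::] w) ^+ 2)%:E = a%:E ->
  \int[P]_w ((\sum_(z <- pairs (T k.+1 u w)) phi z.1 * phi z.2) ^+ 2)%:E <=
  \int[P]_w ((Z w)%:R ^+ 4 * a ^+ 2)%:E.
Proof.
move=> phi0 ma.
rewrite -(nu_integral nu_iid u (f := fun j => (j%:R ^+ 4 * a ^+ 2)%:E)); last first.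
  by move=> j; rewrite lee_fin mulr_ge0// ?sqr_ge0// exprn_ge0.
apply: (ge0_le_integral_fibers (dT (m := 1) u)).
- exact: (measurable_gw_tree _ u (fun s : tr k.+1 => ((\sum_(z <- pairs s) phi z.1 * phi z.2) ^+ 2)%R)).
- under eq_fun do rewrite -size_gw_tree1.
  exact: (measurable_gw_tree _ u (fun s : tr 1 => ((size s)%:R ^+ 4 * a ^+ 2)%R)).
- by move=> w; rewrite lee_fin sqr_ge0.
- by move=> w; rewrite lee_fin mulr_ge0 ?sqr_ge0// exprn_ge0.
move=> t; rewrite !integral_fiberE.
pose ch := children u t.
have mT v : measurable_fun setT (fun w => phi (T k v w)).
  by apply/measurable_EFinP; exact: measurable_gw_tree.
have mt : measurable_fun setT (fun w => ((T 1 u w == t)%:R : R)).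
  by apply/measurable_EFinP; exact: (measurable_gw_tree _ u (fun t' => (t' == t)%:R)).
pose h (z : seq nat * seq nat) w : R :=
  ((T 1 u w == t)%:R * (phi (T k z.1 w) ^+ 2 * phi (T k z.2 w) ^+ 2))%R.
have mh z : measurable_fun setT (h z).
  apply: measurable_funM; first exact: mt.
  by apply: measurable_funM; apply: measurable_funX; exact: mT.
have h0 z w : (0 <= h z w)%R by rewrite !mulr_ge0// ?sqr_ge0.
apply: (@le_trans _ _ (\int[P]_w ((size t)%:R ^+ 2 * \sum_(z <- pairs ch) h z w)%:E)).
  apply: ge0_le_integral => //.
  - by move=> w _; rewrite lee_fin mulr_ge0 ?sqr_ge0.
  - apply/measurable_EFinP; apply: measurable_funM; first exact: mt.
    apply/measurable_EFinP.
    exact: (measurable_gw_tree _ u (fun s : tr k.+1 => ((\sum_(z <- pairs s) phi z.1 * phi z.2) ^+ 2)%R)).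
  - apply/measurable_EFinP; apply: measurable_funM; first exact: measurable_cst.
    exact: measurable_sum.
  move=> w _; rewrite lee_fin /h -mulr_sumr.
  case: eqP => [tE|_]; last by rewrite !mul0r mulr0.
  rewrite !mul1r gw_treeS tE -/ch pairs_map big_map /=.
  apply: le_trans (sqr_sum_le _ _) _ => /=.
  under [X in (_ <= _ * X)%R]eq_bigr do rewrite -exprMn.
  apply: ler_wpM2r; first by rewrite sumr_ge0// => z _; rewrite sqr_ge0.
  by rewrite -natrX ler_nat (leq_trans (size_pairs _))// size_childrenE.
under eq_integral do rewrite EFinM.
rewrite ge0_integralZl//; last 2 first.
- by apply/measurable_EFinP; exact: measurable_sum.
- by move=> w _; rewrite lee_fin; apply: sumr_ge0 => z _; exact: h0.
under eq_integral do rewrite -sumEFin.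
rewrite (@ge0_integral_sum _ _ _ P _ measurableT _ (fun z w => (h z w)%:E)); last 2 first.
- by move=> z; apply/measurable_EFinP; exact: mh.
- by move=> z w _; rewrite lee_fin; exact: h0.
have hE z : z \in pairs ch -> \int[P]_w (h z w)%:E =
    P (T 1 u @^-1` [set t]) * (a ^+ 2)%:E.
  case: z => v v' /mem_pairs -/(_ (uniq_children u t))[vc v'c vv'].
  rewrite /h /= (branching_pair nu_iid t _ (f := fun s => (phi s ^+ 2)%R) _ ma)//.
    split; first by rewrite /= inE vv'.
    by move=> x; rewrite !inE => /orP[] /eqP ->; apply: size_children; eassumption.
  by move=> s; exact: sqr_ge0.
rewrite big_seq (eq_bigr (fun=> P (T 1 u @^-1` [set t]) * (a ^+ 2)%:E)) => [|z /hE//].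
rewrite -big_seq.
have /fineK Pt : P (T 1 u @^-1` [set t]) \is a fin_num by rewrite fin_num_measure//; exact: dT.
rewrite -Pt -EFinM sumEFin big_const_seq count_predT.
have -> (x : R) j : iter j (+%R x) 0%R = (j%:R * x)%R.
  by elim: j => [|j IH] /=; rewrite ?mul0r// IH -natr1 mulrDl mul1r addrC.
have -> : \int[P]_w ((T 1 u w == t)%:R * ((nu u w)%:R ^+ 4 * a ^+ 2))%:E =
    ((size t)%:R ^+ 4 * a ^+ 2 * fine (P (T 1 u @^-1` [set t])))%:E.
  rewrite EFinM Pt -integral_cst; last exact: dT.
  rewrite (integral_fiberE P _ _ (cst ((size t)%:R ^+ 4 * a ^+ 2)%R)).
  apply: eq_integral => w _; case: eqP => [tE|_]; last by rewrite !mul0r.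
  by rewrite -size_gw_tree1 tE.
rewrite -!EFinM lee_fin.
have -> : ((size t)%:R ^+ 4 * a ^+ 2 * fine (P (T 1 u @^-1` [set t])) =
  (size t)%:R ^+ 2 * ((size t)%:R ^+ 2 * (fine (P (T 1 u @^-1` [set t])) * a ^+ 2)))%R by ring.
apply: ler_wpM2l; first exact: sqr_ge0.
apply: ler_wpM2r.
  by rewrite mulr_ge0 ?sqr_ge0// fine_ge0.
by rewrite -natrX ler_nat (leq_trans (size_pairs _))// size_childrenE.
Qed.

End branching_step.

(** * Survival probabilities and the martingale *)

Lemma one_sub_expn_le (R : realFieldType) (x : R) k : 0 <= x <= 1 ->
  (1 - x) ^+ k <= 1 - k%:R * x + (k%:R ^+ 2 - k%:R) / 2 * x ^+ 2.
Proof.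
move=> /andP[x0 x1]; elim: k => [|k IHk]; first by rewrite expr0; lra.
have H1 : 0 <= 1 - x by lra.
rewrite [(1 - x) ^+ _]exprS; apply: le_trans (ler_wpM2l H1 IHk) _.
have k0 : 0 <= (k%:R : R) ^+ 2 - k%:R.
  by rewrite subr_ge0 -natrX ler_nat; case: k {IHk} => // k; rewrite leq_pmulr.
rewrite -natr1; set y : R := k%:R in k0 *.
have x3 : 0 <= (y ^+ 2 - y) / 2 * x ^+ 3 by rewrite mulr_ge0 ?exprn_ge0// divr_ge0.
rewrite -subr_ge0 (_ : _ - _ = (y ^+ 2 - y) / 2 * x ^+ 3)//.
by field.
Qed.

(** The coefficient k^3 is not sharp, but the induction reproduces it: the defect of a step is a
    polynomial in k and x with nonnegative coefficients. *)
Lemma one_sub_expn_ge (R : realFieldType) (x : R) k : 0 <= x <= 1 ->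
  1 - k%:R * x + (k%:R ^+ 2 - k%:R) / 2 * x ^+ 2 - k%:R ^+ 3 * x ^+ 3
    <= (1 - x) ^+ k.
Proof.
move=> /andP[x0 x1]; elim: k => [|k IHk]; first by rewrite expr0; lra.
have H1 : 0 <= 1 - x by lra.
rewrite [(1 - x) ^+ _]exprS; apply: le_trans _ (ler_wpM2l H1 IHk).
have k0 : 0 <= (k%:R : R) by [].
rewrite -natr1; set y : R := k%:R in k0 *.
have x3 : 0 <= x ^+ 3 by rewrite exprn_ge0.
have x4 : 0 <= y ^+ 3 * x ^+ 4 by rewrite mulr_ge0 ?exprn_ge0.
have x5 : 0 <= (5 / 2 * y ^+ 2 + 7 / 2 * y + 1) * x ^+ 3.
  by rewrite mulr_ge0// ?addr_ge0 ?mulr_ge0 ?sqr_ge0 //; lra.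
rewrite -subr_ge0 (_ : _ - _ = (5 / 2 * y ^+ 2 + 7 / 2 * y + 1) * x ^+ 3 + y ^+ 3 * x ^+ 4).
  exact: addr_ge0.
by field.
Qed.

(** Without a negative cubic remainder, the bound stays useful when x is of order one. It gives the
    decrease of survival probabilities from any starting point. *)
Lemma one_sub_expn_ge2 (R : realFieldType) (x : R) k : 0 <= x <= 1 ->
  1 - k%:R * x + (2 <= k)%:R * x ^+ 2 <= (1 - x) ^+ k.
Proof.
move=> /andP[x0 x1]; case: k => [|[|k]]; rewrite ?expr0 ?expr1; try by rewrite /=; lra.
rewrite /= mul1r; elim: k => [|k IHk]; first by rewrite -subr_ge0 expr2; lra.
have H1 : 0 <= 1 - x by lra.
rewrite [(1 - x) ^+ _]exprS; apply: le_trans _ (ler_wpM2l H1 IHk).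
have k0 : 0 <= (k%:R : R) by [].
have x3 : 0 <= x ^+ 2 - x ^+ 3.
  by rewrite subr_ge0 -{2}[2%N]/(2%N) (exprS x 2) ler_piMl ?sqr_ge0.
have x2 : 0 <= (k%:R + 1) * x ^+ 2 by rewrite mulr_ge0 ?sqr_ge0//; lra.
rewrite -!natr1 -subr_ge0; set y : R := k%:R in k0 x2 *.
rewrite (_ : _ - _ = (y + 1) * x ^+ 2 + (x ^+ 2 - x ^+ 3)); last by ring.
exact: addr_ge0.
Qed.

(** * Second-moment inequalities *)

Section square_integrable.
Local Open Scope ereal_scope.
Context d (Om : measurableType d) (R : realType) (P : probability Om R).
Implicit Types X Y : Om -> R.

Lemma integral_prob_cst (r : \bar R) : \int[P]_w (cst r w) = r.
Proof. by rewrite -[RHS]mule1 -(probability_setT P) integral_cst. Qed.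

Lemma ge0_integral_scaleR (k : R) X : (0 <= k)%R -> measurable_fun setT X ->
  (forall w, (0 <= X w)%R) ->
  \int[P]_w (k * X w)%:E = k%:E * \int[P]_w (X w)%:E.
Proof.
move=> k0 mX X0; under eq_integral do rewrite EFinM.
apply: ge0_integralZl => //; first exact/measurable_EFinP.
by move=> w _; rewrite lee_fin.
Qed.

Lemma square_integrable X : measurable_fun setT X ->
  \int[P]_w (X w ^+ 2)%:E < +oo ->
  P.-integrable setT (fun w => (X w ^+ 2)%:E) /\
  P.-integrable setT (fun w => (X w)%:E).
Proof.
move=> mX X2.
have i2 : P.-integrable setT (fun w => (X w ^+ 2)%:E).
  apply/integrableP; split; first by apply/measurable_EFinP; exact: measurable_funX.
  apply: le_lt_trans X2; rewrite le_eqVlt; apply/orP; left; apply/eqP.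
  by apply: eq_integral => w _; rewrite gee0_abs// lee_fin sqr_ge0.
split => //; have i1 : P.-integrable setT (fun w => (1 + X w ^+ 2)%:E).
  apply: integrable_addR => //; exact: finite_measure_integrable_cst.
apply: le_integrable i1 => //; first exact/measurable_EFinP.
move=> w _; rewrite !abse_EFin lee_fin [X in (_ <= X)%R]ger0_norm ?addr_ge0 ?sqr_ge0//.
rewrite -real_normK ?num_real//; have := normr_ge0 (X w).
by set y := `|X w|%R => y0; have := sqr_ge0 (y - 1)%R; rewrite sqrrB1; lra.
Qed.

Lemma integral_centered_sqr X (a : R) :
  P.-integrable setT (fun w => (X w ^+ 2)%:E) ->
  P.-integrable setT (fun w => (X w)%:E) ->
  \int[P]_w (X w)%:E = a%:E ->
  \int[P]_w ((X w - a) ^+ 2)%:E <= \int[P]_w (X w ^+ 2)%:E.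
Proof.
move=> i2 i1 m1.
have E w : ((X w - a) ^+ 2 = X w ^+ 2 + ((- (2 * a)) * X w + a ^+ 2))%R by ring.
under eq_integral do rewrite E.
have ia : P.-integrable setT (fun w : Om => (a ^+ 2)%:E).
  exact: finite_measure_integrable_cst.
have ib := integrable_scaleR (- (2 * a)) i1.
rewrite (integral_addR i2 (integrable_addR ib ia)) (integral_addR ib ia).
rewrite (integral_scaleR _ i1) m1 (integral_prob_cst (a ^+ 2)%:E).
rewrite -EFinM -EFinD geeDl// lee_fin.
by have := sqr_ge0 a; lra.
Qed.

(** AM-GM with a free weight, 2xy <= h x^2 + y^2 / h. A small [h] lets a contraction remain one
    after noise is added. *)
Lemma integral_sqr_addM X Y (h : R) : (0 < h)%R ->
  measurable_fun setT X -> measurable_fun setT Y ->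
  \int[P]_w ((X w + Y w) ^+ 2)%:E <=
  (1 + h)%:E * \int[P]_w (X w ^+ 2)%:E + (1 + h^-1)%:E * \int[P]_w (Y w ^+ 2)%:E.
Proof.
move=> h0 mX mY; have hi : (0 < h^-1)%R by rewrite invr_gt0.
have mX2 : measurable_fun setT (fun w => (X w ^+ 2)%:E).
  by apply/measurable_EFinP; exact: measurable_funX.
have mY2 : measurable_fun setT (fun w => (Y w ^+ 2)%:E).
  by apply/measurable_EFinP; exact: measurable_funX.
rewrite -ge0_integralZl//; last 2 first.
  by move=> w _; rewrite lee_fin sqr_ge0.
  by rewrite lee_fin addr_ge0// ltW.
rewrite -ge0_integralZl//; last 2 first.
  by move=> w _; rewrite lee_fin sqr_ge0.
  by rewrite lee_fin addr_ge0// ltW.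
rewrite -ge0_integralD//; last 4 first.
- by move=> w _; rewrite mule_ge0 ?lee_fin ?sqr_ge0// addr_ge0// ltW.
- by apply: emeasurable_funM.
- by move=> w _; rewrite mule_ge0 ?lee_fin ?sqr_ge0// addr_ge0// ltW.
- by apply: emeasurable_funM.
apply: ge0_le_integral => //.
- by move=> w _; rewrite lee_fin sqr_ge0.
- by apply/measurable_EFinP; apply: measurable_funX; exact: measurable_funD.
- by apply: emeasurable_funD; apply: emeasurable_funM.
move=> w _; rewrite -!EFinM -EFinD lee_fin.
have hh : (h * h^-1 = 1)%R by rewrite mulfV// gt_eqF.
have : (0 <= h * (X w - h^-1 * Y w) ^+ 2)%R by rewrite mulr_ge0 ?sqr_ge0// ltW.
have -> : (h * (X w - h^-1 * Y w) ^+ 2 = h * X w ^+ 2 - 2 * (h * h^-1) * X w * Y w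
  + (h * h^-1) * h^-1 * Y w ^+ 2)%R by ring.
by rewrite hh; lra.
Qed.

End square_integrable.

(* For percolation with parameter p on a tree of height m, Gf p b is the
   probability that the cluster of the root meets a random set containing each
   vertex of depth m with probability b: survival for b = 1, and 1 - E s^|Y_m|
   for b = 1 - s. With p = 1/mu, Wf p is the martingale W_m. *)
Fixpoint Gf (R : realType) (p b : R) (m : nat) : tr m -> R :=
  match m with
  | 0 => fun=> b
  | m'.+1 => fun s => 1 - \prod_(t <- (s : seq (tr m'))) (1 - p * Gf p b t)
  end.

Fixpoint Wf (R : realType) (p : R) (m : nat) : tr m -> R :=
  match m with
  | 0 => fun=> 1
  | m'.+1 => fun s => p * \sum_(t <- (s : seq (tr m'))) Wf p t
  end.

(* The increment of Wf between heights m and m.+1. *)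
Fixpoint Vf (R : realType) (p : R) (m : nat) : tr m.+1 -> R :=
  match m with
  | 0 => fun s => p * (size (s : seq (tr 0)))%:R - 1
  | m'.+1 => fun s => p * \sum_(t <- (s : seq (tr m'.+1))) Vf p t
  end.

Lemma Gf_itv (R : realType) (p b : R) m (t : tr m) :
  0 <= p <= 1 -> 0 <= b <= 1 -> 0 <= Gf p b t <= 1.
Proof.
move=> /andP[p0 p1] /andP[b0 b1]; elim: m t => [|m IHm] t /=; first by rewrite b0 b1.
have H s : 0 <= 1 - p * Gf p b (s : tr m) <= 1.
  by have /andP[? ?] := IHm s; apply/andP; split; nra.
suff /andP[? ?] : 0 <= \prod_(s <- (t : seq (tr m))) (1 - p * Gf p b s) <= 1.
  by apply/andP; split; lra.
elim/big_ind : _ => [|x y /andP[x0 x1] /andP[y0 y1]|s _]; last exact: H.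
  by rewrite ler01 lexx.
by rewrite mulr_ge0//= mulr_ile1.
Qed.

Lemma Wf_ge0 (R : realType) (p : R) m (t : tr m) : 0 <= p -> 0 <= Wf p t.
Proof.
by move=> p0; elim: m t => [|m IHm] t //=; rewrite mulr_ge0// sumr_ge0.
Qed.

(** The Bonferroni inequalities of orders one and two in algebraic form. They serve for
    probabilities, in the recursion of [Gf], and again for indicators, pointwise in the
    configuration. *)
Lemma prod_one_sub (R : realFieldType) (I : Type) (s : seq I) (x : I -> R) :
  (forall i, 0 <= x i <= 1) ->
  0 <= \sum_(i <- s) x i - (1 - \prod_(i <- s) (1 - x i)) <=
  \sum_(z <- pairs s) x z.1 * x z.2.
Proof.
move=> x01; have P01 s' : 1 - \sum_(i <- s') x i <= \prod_(i <- s') (1 - x i) <= 1.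
  elim: s' => [|i s' /andP[IH1 IH2]]; first by rewrite !big_nil subr0 lexx.
  rewrite !big_cons; have /andP[xi0 xi1] := x01 i.
  have S0 : 0 <= \sum_(j <- s') x j by apply: sumr_ge0 => j _; case/andP: (x01 j).
  have P0 : 0 <= \prod_(j <- s') (1 - x j).
    by apply: prodr_ge0 => j _; case/andP: (x01 j) => _; rewrite subr_ge0.
  by apply/andP; split; nra.
elim: s => [|i s /andP[IH1 IH2]]; first by rewrite !big_nil; lra.
rewrite !big_cons /= big_cat big_map /= -mulr_sumr.
have /andP[xi0 xi1] := x01 i; have /andP[Q1 Q2] := P01 s.
by apply/andP; split; nra.
Qed.

(** * The offspring law and its generating function *)

Section offspring_law.
Local Open Scope ereal_scope.
Context {R : realType} d (Om : measurableType d) (P : probability Om R).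
Variable Z : {RV P >-> nat}.
Hypothesis Z_ge1 : forall w, (1 <= Z w)%N.
Hypothesis EZ_gt1 : 1 < 'E_P[fun w => (Z w)%:R].
Hypothesis Z_moments : forall q : R, (1 <= q)%R ->
  'E_P[fun w => ((Z w)%:R `^ q)%R] < +oo.

Notation mu := (progeny_mean Z).
Notation p := (mu^-1)%R.

Definition zmom (j : nat) : R := fine (\int[P]_w ((Z w)%:R ^+ j)%:E).
Definition zge2 : R := fine (\int[P]_w ((2 <= Z w)%:R)%:E).
Definition zgen (s : R) : R := fine (\int[P]_w (s ^+ Z w)%:E).

Let dZ : discrete Z. Proof. exact: discrete_nat. Qed.

Lemma measurable_offspring (f : nat -> R) : measurable_fun setT (fun w => (f (Z w))%:E).
Proof. exact: (@discrete_measurable _ _ _ Z _ (\bar R) (fun k => (f k)%:E) dZ). Qed.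

Lemma integrable_zmom j : P.-integrable setT (fun w => ((Z w)%:R ^+ j)%:E).
Proof.
case: j => [|j].
  apply: (integrable_bounded P (M := 1) (f := fun k => k%:R ^+ 0)%R dZ) => k.
  by rewrite expr0 normr1.
apply/integrableP; split; first exact: (measurable_offspring (fun k => k%:R ^+ j.+1)%R).
have := Z_moments (q := j.+1%:R); rewrite ler1n => /(_ isT); rewrite unlock; apply: le_lt_trans.
rewrite le_eqVlt; apply/orP; left; apply/eqP; apply: eq_integral => w _.
by rewrite /= powR_mulrn// ger0_norm// exprn_ge0.
Qed.

Lemma zmomE j : \int[P]_w ((Z w)%:R ^+ j)%:E = (zmom j)%:E.
Proof. by rewrite fineK//; exact: integrable_fin_num (integrable_zmom j). Qed.

Lemma zmom_ge0 j : (0 <= zmom j)%R.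
Proof. by rewrite -lee_fin -zmomE integral_ge0// => w _; rewrite lee_fin exprn_ge0. Qed.

Lemma zmom1 : zmom 1 = mu.
Proof. by rewrite /zmom /progeny_mean unlock; congr fine. Qed.

Lemma mu_gt1 : (1 < mu)%R.
Proof.
rewrite -zmom1 -lte_fin -zmomE; move: EZ_gt1; rewrite unlock.
by congr (_ < _); apply: eq_integral => w _; rewrite expr1.
Qed.

Lemma p_gt0 : (0 < p)%R. Proof. by rewrite invr_gt0 (lt_trans ltr01 mu_gt1). Qed.
Lemma p_lt1 : (p < 1)%R. Proof. by rewrite invf_lt1 ?mu_gt1// (lt_trans ltr01 mu_gt1). Qed.
Lemma pmu : (p * mu = 1)%R.
Proof. by rewrite mulVf// gt_eqF// (lt_trans ltr01 mu_gt1). Qed.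

Lemma integral_zmomM j (a : R) : \int[P]_w ((Z w)%:R ^+ j * a)%:E = (zmom j * a)%:E.
Proof.
under eq_integral do rewrite mulrC.
by rewrite (integral_scaleR a (integrable_zmom j)) zmomE mulrC EFinM.
Qed.

Lemma integrable_zge2 : P.-integrable setT (fun w => ((2 <= Z w)%:R)%:E).
Proof.
apply: (integrable_bounded P (M := 1) (f := fun k => (2 <= k)%:R)%R dZ) => k.
by case: (2 <= k)%N; rewrite ?normr1 ?normr0.
Qed.

Lemma zge2E : \int[P]_w ((2 <= Z w)%:R)%:E = zge2%:E.
Proof. by rewrite fineK//; exact: integrable_fin_num integrable_zge2. Qed.

Lemma integrable_zgen (s : R) : (0 <= s <= 1)%R ->
  P.-integrable setT (fun w => (s ^+ Z w)%:E).
Proof.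
move=> /andP[s0 s1]; apply: (integrable_bounded P (M := 1) (f := fun k => s ^+ k)%R dZ) => k.
by rewrite ger0_norm ?exprn_ge0// exprn_ile1.
Qed.

Lemma zgenE (s : R) : (0 <= s <= 1)%R -> \int[P]_w (s ^+ Z w)%:E = (zgen s)%:E.
Proof. by move=> s01; rewrite fineK//; exact: integrable_fin_num (integrable_zgen s01). Qed.

Lemma zge2_ge0 : (0 <= zge2)%R.
Proof. by rewrite -lee_fin -zge2E integral_ge0// => w _; rewrite lee_fin. Qed.

(** Otherwise Z = 1 almost surely, as Z >= 1, against mu > 1. *)
Lemma zge2_gt0 : (0 < zge2)%R.
Proof.
rewrite lt_neqAle zge2_ge0 andbT eq_sym; apply/eqP => z0.
have : (mu <= 1)%R; last by rewrite leNgt mu_gt1.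
rewrite -zmom1 -lee_fin -zmomE -[leRHS](integral_prob_cst P).
have H : \int[P]_w ((2 <= Z w)%:R)%:E = 0 by rewrite zge2E z0.
have := (ae_eq_integral_abs P measurableT
  (measurable_offspring (fun k => (2 <= k)%:R)%R)).1.
have -> : \int[P]_(x in setT) `|((2 <= Z x)%:R : R)%:E| = 0.
  by rewrite -[RHS]H; apply: eq_integral => w _; rewrite gee0_abs// lee_fin.
move=> /(_ erefl) ae0.
rewrite le_eqVlt; apply/orP; left; apply/eqP; apply: ae_eq_integral => //.
  exact: (measurable_offspring (fun k => k%:R ^+ 1)%R).
move: ae0; apply: filterS => w /(_ I) [] H1 _ /=; congr EFin.
have := Z_ge1 w; move: H1; case: (Z w) => [|[|k]]//=.
by move=> /eqP; rewrite oner_eq0.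
Qed.

(** One formula for the means of all the polynomial bounds on s^Z. *)
Lemma zpolyE (a0 a1 a2 a3 a4 : R) (f : nat -> R) :
  (forall k, f k = a0 + (a1 * k%:R ^+ 1 + (a2 * k%:R ^+ 2 + (a3 * k%:R ^+ 3 +
     a4 * (2 <= k)%:R))))%R ->
  P.-integrable setT (fun w => (f (Z w))%:E) /\
  \int[P]_w (f (Z w))%:E =
    (a0 + a1 * mu + a2 * zmom 2 + a3 * zmom 3 + a4 * zge2)%:E.
Proof.
move=> fE; under eq_fun do rewrite fE.
have i0 : P.-integrable setT (fun w : Om => a0%:E) by exact: finite_measure_integrable_cst.
have i1 := integrable_scaleR a1 (integrable_zmom 1).
have i2 := integrable_scaleR a2 (integrable_zmom 2).
have i3 := integrable_scaleR a3 (integrable_zmom 3).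
have i4 := integrable_scaleR a4 integrable_zge2.
have i34 := integrable_addR i3 i4; have i24 := integrable_addR i2 i34.
have i14 := integrable_addR i1 i24.
split; first exact: integrable_addR.
rewrite (integral_addR i0 i14) (integral_addR i1 i24) (integral_addR i2 i34).
rewrite (integral_addR i3 i4) (integral_prob_cst P a0%:E).
rewrite (integral_scaleR _ (integrable_zmom 1)) (integral_scaleR _ (integrable_zmom 2)).
rewrite (integral_scaleR _ (integrable_zmom 3)) (integral_scaleR _ integrable_zge2).
by rewrite !zmomE zge2E zmom1 -!EFinM -!EFinD; congr EFin; ring.
Qed.

Lemma le_integral_offspring (f g : nat -> R) :
  P.-integrable setT (fun w => (f (Z w))%:E) ->
  P.-integrable setT (fun w => (g (Z w))%:E) ->
  (forall k, (1 <= k)%N -> (f k <= g k)%R) ->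
  \int[P]_w (f (Z w))%:E <= \int[P]_w (g (Z w))%:E.
Proof.
move=> fi gi fg; apply: le_integral => // w _; rewrite lee_fin; exact: fg.
Qed.

Lemma zgen_itv (s : R) : (0 <= s <= 1)%R -> (0 <= zgen s <= 1)%R.
Proof.
move=> s01; have /andP[s0 s1] := s01; rewrite -!lee_fin -zgenE// integral_ge0/=; last first.
  by move=> w _; rewrite lee_fin exprn_ge0.
rewrite -(integral_prob_cst P 1%:E); apply: le_integral => //.
- exact: integrable_zgen.
- exact: finite_measure_integrable_cst.
- by move=> w _; rewrite lee_fin exprn_ile1.
Qed.

(** As Z >= 1, s^Z is s when Z = 1 and at most s^2 = s - s (1 - s) otherwise. *)
Lemma zgen_le (s : R) : (0 <= s <= 1)%R -> (zgen s <= s - zge2 * (s * (1 - s)))%R.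
Proof.
move=> s01; have /andP[s0 s1] := s01; rewrite -lee_fin -zgenE//.
pose poly k : R := (s - (2 <= k)%:R * (s * (1 - s)))%R.
have [gi gE] := @zpolyE s 0 0 0 (- (s * (1 - s))) poly
  ltac:(by move=> k; rewrite /poly; ring).
have -> : (s - zge2 * (s * (1 - s)) = s + 0 * mu + 0 * zmom 2 + 0 * zmom 3 +
  (- (s * (1 - s))) * zge2)%R by ring.
rewrite -gE; apply: (@le_integral_offspring (fun k => s ^+ k)%R poly (integrable_zgen s01) gi).
case=> [//|[|k]] _; first by rewrite /poly expr1 mul0r subr0.
rewrite /poly mul1r exprS exprS; have := exprn_ile1 k s0 s1; have := exprn_ge0 k s0.
by set y := (s ^+ k)%R; nra.
Qed.

(** The recursion satisfied by the mean of [Gf] when the height grows by one. *)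
Definition surv_step (r : R) : R := (1 - zgen (1 - p * r))%R.

Lemma pr_itv (r : R) : (0 <= r <= 1)%R -> (0 <= p * r <= 1)%R.
Proof.
by move=> /andP[r0 r1]; have := p_gt0; have := p_lt1 => *; apply/andP; split; nra.
Qed.

Lemma onemr_itv (r : R) : (0 <= r <= 1)%R -> (0 <= 1 - p * r <= 1)%R.
Proof. by move=> /pr_itv/andP[? ?]; apply/andP; split; lra. Qed.

Lemma surv_step_itv r : (0 <= r <= 1)%R -> (0 <= surv_step r <= 1)%R.
Proof.
move=> /onemr_itv/zgen_itv/andP[? ?]; rewrite /surv_step; apply/andP; split; lra.
Qed.

Lemma surv_step_ge_p r : (0 <= r <= 1)%R -> (p * r <= surv_step r)%R.
Proof.
move=> r01; have s01 := onemr_itv r01; have := zgen_le s01.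
have /andP[s0 s1] := s01; rewrite /surv_step.
have : (0 <= zge2 * ((1 - p * r) * (1 - (1 - p * r))))%R.
  by rewrite !mulr_ge0 ?zge2_ge0// subr_ge0.
by lra.
Qed.

(** Minus the second-order coefficient of [surv_step] at 0; it is the inverse of lambda. *)
Definition kolmo : R := (p ^+ 2 * (zmom 2 - mu) / 2)%R.

Lemma surv_step_ge r : (0 <= r <= 1)%R -> (r - kolmo * r ^+ 2 <= surv_step r)%R.
Proof.
move=> r01; have s01 := onemr_itv r01; have x01 := pr_itv r01.
pose poly k : R := (1 - k%:R * (p * r) + (k%:R ^+ 2 - k%:R) / 2 * (p * r) ^+ 2)%R.
have [gi gE] := @zpolyE 1 (- (p * r) - (p * r) ^+ 2 / 2) ((p * r) ^+ 2 / 2) 0 0 poly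
  ltac:(by move=> k; rewrite /poly expr1; move: (progeny_mean Z)^-1%R => q; field).
have : (zgen (1 - p * r) <= 1 - (p * mu) * r + (zmom 2 - mu) / 2 * (p * r) ^+ 2)%R.
  rewrite -lee_fin -zgenE//.
  rewrite (_ : (1 - (p * mu) * r + _)%R = (1 + (- (p * r) - (p * r) ^+ 2 / 2) * mu +
    (p * r) ^+ 2 / 2 * zmom 2 + 0 * zmom 3 + 0 * zge2)%R); last by move: (progeny_mean Z)^-1%R => q; field.
  rewrite -gE; apply: (@le_integral_offspring (fun k => (1 - p * r) ^+ k)%R poly (integrable_zgen s01) gi).
  by move=> k _; exact: one_sub_expn_le.
by rewrite pmu mul1r /surv_step /kolmo exprMn; lra.
Qed.

Lemma surv_step_le r : (0 <= r <= 1)%R ->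
  (surv_step r <= r - kolmo * r ^+ 2 + p ^+ 3 * zmom 3 * r ^+ 3)%R.
Proof.
move=> r01; have s01 := onemr_itv r01; have x01 := pr_itv r01.
pose poly k : R := (1 - k%:R * (p * r) + (k%:R ^+ 2 - k%:R) / 2 * (p * r) ^+ 2
     - k%:R ^+ 3 * (p * r) ^+ 3)%R.
have [gi gE] := @zpolyE 1 (- (p * r) - (p * r) ^+ 2 / 2) ((p * r) ^+ 2 / 2) (- (p * r) ^+ 3) 0 poly
  ltac:(by move=> k; rewrite /poly expr1; move: (progeny_mean Z)^-1%R => q; field).
have : (1 - (p * mu) * r + (zmom 2 - mu) / 2 * (p * r) ^+ 2 - zmom 3 * (p * r) ^+ 3
    <= zgen (1 - p * r))%R.
  rewrite -lee_fin -zgenE//.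
  rewrite (_ : (1 - (p * mu) * r + _ - _)%R = (1 + (- (p * r) - (p * r) ^+ 2 / 2) * mu +
    (p * r) ^+ 2 / 2 * zmom 2 + (- (p * r) ^+ 3) * zmom 3 + 0 * zge2)%R); last by move: (progeny_mean Z)^-1%R => q; field.
  rewrite -gE; apply: (@le_integral_offspring poly (fun k => (1 - p * r) ^+ k)%R gi (integrable_zgen s01)).
  by move=> k _; exact: one_sub_expn_ge.
by rewrite pmu mul1r /surv_step /kolmo !exprMn; lra.
Qed.

Lemma surv_step_le2 r : (0 <= r <= 1)%R ->
  (surv_step r <= r - p ^+ 2 * zge2 * r ^+ 2)%R.
Proof.
move=> r01; have s01 := onemr_itv r01; have x01 := pr_itv r01.
pose poly k : R := (1 - k%:R * (p * r) + (2 <= k)%:R * (p * r) ^+ 2)%R.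
have [gi gE] := @zpolyE 1 (- (p * r)) 0 0 ((p * r) ^+ 2) poly
  ltac:(by move=> k; rewrite /poly expr1; ring).
have : (1 - (p * mu) * r + zge2 * (p * r) ^+ 2 <= zgen (1 - p * r))%R.
  rewrite -lee_fin -zgenE//.
  rewrite (_ : (1 - (p * mu) * r + _)%R = (1 + (- (p * r)) * mu +
    0 * zmom 2 + 0 * zmom 3 + (p * r) ^+ 2 * zge2)%R); last by ring.
  rewrite -gE; apply: (@le_integral_offspring poly (fun k => (1 - p * r) ^+ k)%R gi (integrable_zgen s01)).
  by move=> k _; exact: one_sub_expn_ge2.
by rewrite pmu mul1r /surv_step !exprMn; lra.
Qed.

Lemma GW_lambdaE : (GW_lambda Z = kolmo^-1)%R.
Proof.
rewrite /GW_lambda /kolmo unlock.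
have -> : \int[P]_w ((Z w)%:R * ((Z w)%:R - 1))%:E = (zmom 2 - mu)%:E.
  have [_ gE] := @zpolyE 0 (- 1) 1 0 0 (fun k => k%:R * (k%:R - 1))%R
    ltac:(by move=> k; rewrite expr1; ring).
  by rewrite gE; congr EFin; ring.
by rewrite /= invf_div invfM exprVn invrK -mulrA.
Qed.

Lemma kolmo_gt0 : (0 < kolmo)%R.
Proof.
have r01 : (0 <= (1 : R) <= 1)%R by rewrite ler01 lexx.
rewrite lt_neqAle; have p0 := p_gt0; have q0 := zge2_gt0.
have pq : (0 < p ^+ 2 * zge2)%R by rewrite mulr_gt0// exprn_gt0.
have := surv_step_ge r01; have := surv_step_le2 r01; rewrite !expr1n !mulr1 => h1 h2.
by apply/andP; split; [apply/eqP => k0; move: h1 h2; rewrite -k0; lra|lra].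
Qed.

End offspring_law.

(** For large N the powers of 1/(m + N) shrink at each step by a factor close to 1, so polynomial
    noise decays more slowly than any geometric sequence of ratio below [q]. *)
Lemma inv_shift_decay (R : realType) (q : R) : q < 1 ->
  exists2 N : nat, (0 < N)%N & forall m j : nat, (j <= 4)%N ->
    q * ((m + N)%:R^-1) ^+ j <= ((m.+1 + N)%:R^-1) ^+ j.
Proof.
move=> q1; pose N := (Num.truncn (4 / (1 - q))).+1.
exists N => // m j j4; have q1' : 0 < 1 - q by lra.
have NE : 4 / (1 - q) < N%:R by rewrite /N; exact: truncnS_gt.
have xN : N%:R <= ((m + N)%:R : R) by rewrite ler_nat leq_addl.
rewrite addSn -natr1; set x : R := (m + N)%:R in xN *.
have x0 : 0 < x by apply: lt_le_trans xN; rewrite ltr0n.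
have x10 : 0 < x + 1 by lra.
have xq : 4 <= (1 - q) * (x + 1).
  by rewrite mulrC -ler_pdivrMr//; lra.
pose y := (x + 1)^-1; have y0 : 0 < y by rewrite invr_gt0.
have yx : y * (x + 1) = 1 by rewrite mulVf// gt_eqF.
have y1 : y <= 1 by rewrite invf_le1//; lra.
have xy : x^-1 * (1 - y) = y.
  have -> : 1 - y = y * x by lra.
  by rewrite mulrCA mulVf ?mulr1// gt_eqF.
have qy : q <= (1 - y) ^+ j.
  have : (1 - y) ^+ 4 <= (1 - y) ^+ j by apply: ler_wiXn2l => //; lra.
  apply: le_trans; have : 1 - 4%:R * y + (2 <= 4)%:R * y ^+ 2 <= (1 - y) ^+ 4.
    by apply: one_sub_expn_ge2; lra.
  apply: le_trans; have := sqr_ge0 y; rewrite mul1r.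
  suff : 4%:R * y <= 1 - q by lra.
  have : (1 - q) * (x + 1) * y = 1 - q by rewrite -mulrA (mulrC _ y) yx mulr1.
  by have := ler_wpM2r (ltW y0) xq; lra.
rewrite -/y -[X in _ <= X ^+ j]xy exprMn mulrC; apply: ler_wpM2l => //.
by rewrite exprn_ge0// invr_ge0 ltW.
Qed.

(** The constant is chosen before the sequence, which yields bounds uniform in [b]. It must dominate
    the start, C >= A0 N^j, and absorb the noise, rho C + B <= q C. *)
Lemma contraction_decay (R : realType) (rho q B A0 : R) (N j : nat) :
  0 <= rho -> rho < q -> 0 <= B -> 0 <= A0 -> (0 < N)%N ->
  (forall m, q * ((m + N)%:R^-1) ^+ j <= ((m.+1 + N)%:R^-1) ^+ j) ->
  exists2 C : R, 0 <= C & forall a : nat -> R, a 0%N <= A0 ->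
    (forall m, a m.+1 <= rho * a m + B * ((m + N)%:R^-1) ^+ j) ->
    forall m, a m <= C * ((m + N)%:R^-1) ^+ j.
Proof.
move=> rho0 rhoq B0 A00 N0 Hq; pose C := A0 * N%:R ^+ j + B / (q - rho).
have qr : 0 < q - rho by rewrite subr_gt0.
have C0 : 0 <= C.
  by apply: addr_ge0; [rewrite mulr_ge0 ?exprn_ge0|rewrite divr_ge0// ltW].
exists C => // a a0 aS; elim => [|m IHm].
  rewrite add0n exprVn; apply: le_trans a0 _.
  rewrite -ler_pdivrMr ?invr_gt0 ?exprn_gt0 ?ltr0n// invrK /C lerDl.
  by rewrite divr_ge0// ltW.
set h := _ ^+ j in IHm; have h0 : 0 <= h by rewrite exprn_ge0// invr_ge0.
apply: le_trans (aS m) _; rewrite -/h.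
apply: le_trans (ler_wpM2l C0 (Hq m)); rewrite -/h.
have BC : B <= C * (q - rho).
  by rewrite -ler_pdivrMr// /C lerDr mulr_ge0// exprn_ge0.
have := ler_wpM2l rho0 IHm; have := ler_wpM2r h0 BC.
by lra.
Qed.

(** * Annealed moments: contraction over the children of the root *)

Section annealed.
Local Open Scope ereal_scope.
Context {R : realType} d (Om : measurableType d) (P : probability Om R).
Variables (Z : {RV P >-> nat}) (nu : seq nat -> {RV P >-> nat}).
Hypothesis Z_ge1 : forall w, (1 <= Z w)%N.
Hypothesis EZ_gt1 : 1 < 'E_P[fun w => (Z w)%:R].
Hypothesis Z_moments : forall q : R, (1 <= q)%R ->
  'E_P[fun w => ((Z w)%:R `^ q)%R] < +oo.
Hypothesis nu_iid : iid_offspring Z nu.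
Notation T := (gw_tree nu).
Notation mu := (progeny_mean Z).
Notation p := (mu^-1)%R.
Notation zm := (zmom Z).
Notation E1 k phi := (\int[P]_w (phi (T k [::] w))%:E).
Notation E2 k phi := (\int[P]_w (phi (T k [::] w) ^+ 2)%:E).

Let p0 : (0 < p)%R. Proof. exact: (p_gt0 EZ_gt1 Z_moments). Qed.
Let p1 : (p < 1)%R. Proof. exact: (p_lt1 EZ_gt1 Z_moments). Qed.
Let pm : (p * mu = 1)%R. Proof. exact: (pmu EZ_gt1 Z_moments). Qed.
Let zE j a : \int[P]_w ((Z w)%:R ^+ j * a)%:E = (zm j * a)%:E.
Proof. exact: integral_zmomM. Qed.
Let z1 : zm 1 = mu. Proof. exact: zmom1. Qed.
Let mT k u (phi : tr k -> R) : measurable_fun setT (fun w => phi (T k u w)).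
Proof. by apply/measurable_EFinP; exact: measurable_gw_tree. Qed.
Let p01 : (0 <= p <= 1)%R. Proof. by rewrite !ltW. Qed.

(* (x + y)^2 <= (rho / p) x^2 + kap y^2 by AM-GM: a sum of p times independent
   copies then contracts second moments by rho < 1, up to kap times the noise. *)
Definition rho : R := ((1 + p) / 2)%R.
Definition kap : R := ((1 + p) / (1 - p))%R.

Lemma rho_itv : (0 <= rho < 1)%R.
Proof. by rewrite /rho; apply/andP; split; have := p0; have := p1; lra. Qed.

Lemma kap_ge0 : (0 <= kap)%R.
Proof. by rewrite /kap divr_ge0//; have := p0; have := p1; lra. Qed.

Lemma tree_contraction k (phi : tr k -> R) (psi : tr k.+1 -> R) (a b : R) :
  E1 k phi = 0 -> E2 k phi <= a%:E -> E2 k.+1 psi <= b%:E ->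
  \int[P]_w ((p * (\sum_(t <- T k.+1 [::] w) phi t) + psi (T k.+1 [::] w)) ^+ 2)%:E
    <= (rho * a + kap * b)%:E.
Proof.
move=> m1 m2 mpsi; have p1' : (0 < 1 - p)%R by rewrite subr_gt0.
have pn0 : p != 0%R by rewrite gt_eqF.
(* Chosen so that (1 + h) p = rho, while 1 + 1/h = kap. *)
pose h := ((1 - p) / (2 * p))%R; have h0 : (0 < h)%R by rewrite divr_gt0// mulr_gt0.
have [i2 i1] := square_integrable (mT _ phi) (le_lt_trans m2 (ltry _)).
have a2E : E2 k phi = (fine (E2 k phi))%:E by rewrite fineK//; exact: integrable_fin_num i2.
have a2a : (fine (E2 k phi) <= a)%R by rewrite -lee_fin -a2E.
have V := offspring_variance nu_iid [::] i1 i2 m1 a2E.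
have V1 : \int[P]_w ((\sum_(t <- T k.+1 [::] w) phi t) ^+ 2)%:E =
    (mu * fine (E2 k phi))%:E.
  by rewrite V -z1 -zE; apply: eq_integral => w _; rewrite expr1.
have mS : measurable_fun setT (fun w => \sum_(t <- T k.+1 [::] w) phi t)%R.
  exact: (mT [::] (fun s : tr k.+1 => \sum_(t <- s) phi t)%R).
apply: (le_trans (integral_sqr_addM P h0
   (measurable_funM (measurable_cst p) mS) (mT _ psi))).
(* The variance of the sum has a factor mu, so scaling by p leaves p^2 mu = p. *)
have -> : \int[P]_w ((p * \sum_(t <- T k.+1 [::] w) phi t) ^+ 2)%:E =
    (p * fine (E2 k phi))%:E.
  under eq_integral do rewrite exprMn.
  rewrite ge0_integral_scaleR ?sqr_ge0//; last 2 first.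
  - exact: measurable_funX.
  - by move=> w; rewrite sqr_ge0.
  by rewrite V1 -EFinM expr2 -!mulrA (mulrA p mu) pm mul1r.
rewrite [leRHS]EFinD; apply: leeD.
  rewrite -EFinM lee_fin; apply: le_trans (ler_wpM2l _ (ler_wpM2l (ltW p0) a2a)) _.
    by rewrite addr_ge0// ltW.
  rewrite le_eqVlt; apply/orP; left; apply/eqP; rewrite /h /rho.
  by move: pn0; move: (progeny_mean Z)^-1%R => q q0; field.
apply: le_trans (lee_wpmul2l _ mpsi) _.
  by rewrite lee_fin addr_ge0// invr_ge0 ltW.
rewrite -EFinM lee_fin le_eqVlt; apply/orP; left; apply/eqP; rewrite /h /kap.
have : (1 - p != 0)%R by rewrite gt_eqF.
by move: pn0; move: (progeny_mean Z)^-1%R => q q0 q1; field; rewrite q0 q1.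
Qed.

Lemma Wf_mean m : E1 m (@Wf R p m) = 1.
Proof.
elim: m => [|m IHm]; first exact: (integral_prob_cst P 1).
have W0 (s : tr m) : (0 <= p * Wf p s)%R by rewrite mulr_ge0 ?Wf_ge0// ltW.
have := @offspring_sum _ _ _ _ _ _ nu_iid m [::] (fun s : tr m => p * Wf p s)%R p W0.
have -> : E1 m (fun s : tr m => p * Wf p s)%R = p%:E.
  rewrite ge0_integral_scaleR ?IHm ?mule1 ?(ltW p0)//.
  by move=> w; rewrite Wf_ge0// ltW.
move=> /(_ erefl); under eq_integral do rewrite -mulr_sumr.
rewrite [X in X = _](_ : _ = E1 m.+1 (@Wf R p m.+1)) // => ->.
rewrite -[RHS](_ : (zm 1 * p)%:E = 1); last by rewrite z1 mulrC pm.
by rewrite -zE; apply: eq_integral => w _; rewrite expr1.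
Qed.

Lemma size_sqr m (a : R) :
  E2 m.+1 (fun s : tr m.+1 => p * (size s)%:R * a)%R = (p ^+ 2 * zm 2 * a ^+ 2)%:E.
Proof.
have := nu_integral nu_iid [::] (f := fun j => ((p * j%:R * a) ^+ 2)%:E).
move=> H; transitivity (\int[P]_w ((p * (Z w)%:R * a) ^+ 2)%:E).
  rewrite -H; last by move=> j; rewrite lee_fin sqr_ge0.
  by apply: eq_integral => w _; rewrite /= size_map size_iota.
rewrite (_ : p ^+ 2 * zm 2 * a ^+ 2 = zm 2 * (p ^+ 2 * a ^+ 2))%R; last by ring.
by rewrite -zE; apply: eq_integral => w _; congr EFin; ring.
Qed.

(** The fixed point of a -> rho a + kap v, where v = p^2 E Z^2 is the second moment of the noise,
    plus 1 to cover the initial value. *)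
Definition Wbound : R := (1 + kap * (p ^+ 2 * zm 2) / (1 - rho))%R.

Lemma Wbound_ge1 : (1 <= Wbound)%R.
Proof.
have /andP[r0 r1] := rho_itv.
rewrite /Wbound lerDl divr_ge0 ?subr_ge0 ?(ltW r1)// mulr_ge0 ?kap_ge0//.
by rewrite mulr_ge0 ?sqr_ge0 ?zmom_ge0.
Qed.

(** W_(m+1) is p times a sum of copies of the centred variable W_m - 1, plus p Z; the latter is the
    noise. *)
Lemma Wf_sqr m : E2 m (@Wf R p m) <= Wbound%:E.
Proof.
elim: m => [|m IHm].
  rewrite /= (eq_integral (cst 1)).
    by rewrite integral_prob_cst lee_fin Wbound_ge1.
  by move=> w _; rewrite expr1n.
have [i2 i1] := square_integrable (mT _ (@Wf R p m)) (le_lt_trans IHm (ltry _)).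
have c2 := integral_centered_sqr i2 i1 (Wf_mean m).
pose phi (s : tr m) := (Wf p s - 1)%R.
have m1 : E1 m phi = 0.
  have ic : P.-integrable setT (fun w : Om => (- 1)%R%:E) by exact: finite_measure_integrable_cst.
  by rewrite (integral_addR i1 ic) Wf_mean (integral_prob_cst P (- 1)%R%:E) -EFinD subrr.
have psi2 : E2 m.+1 (fun s : tr m.+1 => p * (size s)%:R * 1)%R <= (p ^+ 2 * zm 2)%:E.
  by rewrite size_sqr expr1n mulr1.
have := @tree_contraction m phi (fun s : tr m.+1 => p * (size s)%:R * 1)%R _ _
  m1 (le_trans c2 IHm) psi2.
have -> : \int[P]_w ((p * (\sum_(t <- T m.+1 [::] w) phi t) +
    p * (size (T m.+1 [::] w))%:R * 1) ^+ 2)%:E = E2 m.+1 (@Wf R p m.+1).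
  apply: eq_integral => w _; congr ((_ ^+ 2)%:E).
  rewrite /phi; set s := gw_tree _ _ _ _.
  rewrite [LHS](_ : _ = p * (\sum_(t <- (s : seq (tr m))) Wf p t))%R//.
  elim: (s : seq (tr m)) => [|t s' IH]; first by rewrite !big_nil !mulr0 mul0r addr0.
  by rewrite !big_cons /= -natr1 [RHS]mulrDr -IH; ring.
move/le_trans; apply; rewrite lee_fin.
have /andP[r0 r1] := rho_itv; have r1' : (1 - rho != 0)%R by rewrite gt_eqF// subr_gt0.
have -> : (rho * Wbound + kap * (p ^+ 2 * zm 2) = rho + (Wbound - 1))%R.
  by rewrite /Wbound; move: r1'; move: rho kap (progeny_mean Z)^-1%R => r k q r1'; field.
by lra.
Qed.

Lemma Wf_integrable m : P.-integrable setT (fun w => (Wf p (T m [::] w) ^+ 2)%:E) /\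
  P.-integrable setT (fun w => (Wf p (T m [::] w))%:E).
Proof.
exact: (square_integrable (mT [::] (@Wf R p m)) (le_lt_trans (Wf_sqr m) (ltry _))).
Qed.

Lemma Wf_centered m :
  [/\ P.-integrable setT (fun w => ((Wf p (T m [::] w) - 1) ^+ 2)%:E),
      P.-integrable setT (fun w => (Wf p (T m [::] w) - 1)%:E),
      E1 m (fun s => Wf p s - 1)%R = 0 & E2 m (fun s => Wf p s - 1)%R <= Wbound%:E].
Proof.
have [i2 i1] := Wf_integrable m.
have c2 := le_trans (integral_centered_sqr i2 i1 (Wf_mean m)) (Wf_sqr m).
have [j2 j1] := square_integrable (mT [::] (fun s : tr m => Wf p s - 1)%R)
  (le_lt_trans c2 (ltry _)).
split => //.
have ic : P.-integrable setT (fun w : Om => (- 1)%R%:E) by exact: finite_measure_integrable_cst.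
by rewrite (integral_addR i1 ic) Wf_mean (integral_prob_cst P (- 1)%R%:E) -EFinD subrr.
Qed.

Lemma VfE m u w : Vf p (T m.+1 u w) = (Wf p (T m.+1 u w) - Wf p (T m u w))%R.
Proof.
elim: m u => [|m IHm] u.
  rewrite /= size_map size_iota; congr (p * _ - _)%R.
  by rewrite big_map big_const_seq count_predT size_iota; elim: (nu u w) => //= j <-; rewrite -natr1 addrC.
have E (f : tr m.+1 -> R) : (\sum_(t <- gw_tree nu m.+2 u w) f t =
    \sum_(i <- iota 0 (nu u w)) f (T m.+1 (rcons u i) w))%R by rewrite /= big_map.
have E' (f : tr m -> R) : (\sum_(t <- gw_tree nu m.+1 u w) f t =
    \sum_(i <- iota 0 (nu u w)) f (T m (rcons u i) w))%R by rewrite /= big_map.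
transitivity (p * \sum_(t <- gw_tree nu m.+2 u w) @Vf R p m t)%R; first by [].
transitivity (p * (\sum_(t <- gw_tree nu m.+2 u w) @Wf R p m.+1 t) -
  p * (\sum_(t <- gw_tree nu m.+1 u w) @Wf R p m t))%R; last by [].
rewrite !E E' -mulrBr -sumrB; congr (_ * _)%R; apply: eq_bigr => i _; exact: IHm.
Qed.

Lemma Vf_mean m : E1 m.+1 (@Vf R p m) = 0.
Proof.
have [_ i1] := Wf_integrable m; have [_ i1'] := Wf_integrable m.+1.
under eq_integral do rewrite VfE -mulN1r.
rewrite (integral_addR i1' (integrable_scaleR (-1) i1)) (integral_scaleR _ i1).
by rewrite !Wf_mean mule1 -EFinD subrr.
Qed.

Definition Vbound : R := (2 * (p ^+ 2 * zm 2 + 1))%R.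

(** An increment is exactly p times a sum of copies of the previous one. Without noise, the
    contraction gives geometric decay. *)
Lemma Vf_sqr m : E2 m.+1 (@Vf R p m) <= (Vbound * rho ^+ m)%:E.
Proof.
elim: m => [|m IHm].
  rewrite expr0 mulr1; have := size_sqr 0 1; rewrite expr1n mulr1 => H.
  have := integral_sqr_addM P ltr01 (mT [::] (fun s : tr 1 => p * (size s)%:R * 1)%R)
    (mT [::] (fun s : tr 1 => (- 1)%R)).
  have -> : \int[P]_w ((- 1) ^+ 2)%:E = 1.
    by rewrite -[RHS](integral_prob_cst P 1); apply: eq_integral => w _; rewrite sqrrN expr1n.
  rewrite H invr1 -!EFinM -EFinD.
  have -> : ((1 + 1) * (p ^+ 2 * zm 2) + (1 + 1) * 1 = Vbound)%R by rewrite /Vbound; ring.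
  apply: le_trans; rewrite le_eqVlt; apply/orP; left; apply/eqP.
  by apply: eq_integral => w _; rewrite mulr1.
have psi2 : E2 m.+2 (fun s : tr m.+2 => 0)%R <= 0%:E.
  by rewrite (eq_integral (cst 0)) ?integral0// => w _; rewrite expr0n.
have := @tree_contraction m.+1 _ (fun s : tr m.+2 => 0)%R _ _ (Vf_mean m) IHm psi2.
rewrite mulr0 addr0 exprS mulrCA; apply: le_trans.
rewrite le_eqVlt; apply/orP; left; apply/eqP.
by apply: eq_integral => w _; rewrite addr0.
Qed.

Definition surv_iter (b : R) (m : nat) : R := iter m (surv_step Z) b.

Lemma surv_iter_itv b m : (0 <= b <= 1)%R -> (0 <= surv_iter b m <= 1)%R.
Proof.
move=> b01; elim: m => [//|m IHm].
exact: (surv_step_itv EZ_gt1 Z_moments).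
Qed.

Lemma Gf_mean b m : (0 <= b <= 1)%R -> E1 m (@Gf R p b m) = (surv_iter b m)%:E.
Proof.
move=> b01; elim: m => [|m IHm]; first exact: (integral_prob_cst P b%:E).
have G01 k (s : tr k) := Gf_itv s p01 b01.
have iG k : P.-integrable setT (fun w => (Gf p b (T k [::] w))%:E).
  apply: (integrable_bounded P (M := 1) (f := @Gf R p b k) (discrete_gw_tree nu _)) => s.
  by have /andP[? ?] := G01 _ s; rewrite ger0_norm.
have f0 (s : tr m) : (0 <= 1 - p * Gf p b s)%R.
  by have /andP[? ?] := G01 _ s; have := p0; have := p1; nra.
have ic (k : R) : P.-integrable setT (fun w : Om => k%:E) by exact: finite_measure_integrable_cst.
have fm : E1 m (fun s => 1 - p * Gf p b s)%R = (1 - p * surv_iter b m)%:E.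
  under eq_integral do rewrite -mulNr.
  rewrite (integral_addR (ic 1%R) (integrable_scaleR (- p) (iG m))).
  by rewrite (integral_scaleR _ (iG m)) IHm (integral_prob_cst P 1%:E) -EFinM -EFinD mulNr.
have F := offspring_prod nu_iid [::] f0 fm.
transitivity (\int[P]_w (1 + (- 1) * \prod_(t <- T m.+1 [::] w) (1 - p * Gf p b t))%:E).
  by apply: eq_integral => w _; rewrite mulN1r.
have iP : P.-integrable setT (fun w => (\prod_(t <- T m.+1 [::] w) (1 - p * Gf p b t))%:E).
  have := integrable_addR (ic 1%R) (integrable_scaleR (-1) (iG m.+1)).
  by apply: eq_integrable => // w _; congr EFin; rewrite /=; lra.
rewrite (integral_addR (ic 1%R) (integrable_scaleR (-1) iP)) (integral_scaleR _ iP) F.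
have r01 := onemr_itv EZ_gt1 Z_moments (surv_iter_itv m b01).
by rewrite (zgenE _ r01) (integral_prob_cst P 1%:E) -EFinM -EFinD mulN1r.
Qed.

End annealed.

(** * Decay rates of second moments, uniform in b *)

Section decay.
Local Open Scope ereal_scope.
Context {R : realType} d (Om : measurableType d) (P : probability Om R).
Variables (Z : {RV P >-> nat}) (nu : seq nat -> {RV P >-> nat}).
Hypothesis Z_ge1 : forall w, (1 <= Z w)%N.
Hypothesis EZ_gt1 : 1 < 'E_P[fun w => (Z w)%:R].
Hypothesis Z_moments : forall q : R, (1 <= q)%R ->
  'E_P[fun w => ((Z w)%:R `^ q)%R] < +oo.
Hypothesis nu_iid : iid_offspring Z nu.
Notation T := (gw_tree nu).
Notation mu := (progeny_mean Z).
Notation p := (mu^-1)%R.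
Notation zm := (zmom Z).
Notation E1 k phi := (\int[P]_w (phi (T k [::] w))%:E).
Notation E2 k phi := (\int[P]_w (phi (T k [::] w) ^+ 2)%:E).
Notation rs := (surv_iter Z).

Let p0 : (0 < p)%R. Proof. exact: (p_gt0 EZ_gt1 Z_moments). Qed.
Let p1 : (p < 1)%R. Proof. exact: (p_lt1 EZ_gt1 Z_moments). Qed.
Let pm : (p * mu = 1)%R. Proof. exact: (pmu EZ_gt1 Z_moments). Qed.
Let zE j a : \int[P]_w ((Z w)%:R ^+ j * a)%:E = (zm j * a)%:E.
Proof. exact: integral_zmomM. Qed.
Let mT k u (phi : tr k -> R) : measurable_fun setT (fun w => phi (T k u w)).
Proof. by apply/measurable_EFinP; exact: measurable_gw_tree. Qed.
Let p01 : (0 <= p <= 1)%R. Proof. by rewrite !ltW. Qed.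
Let rs01 b m : (0 <= b <= 1)%R -> (0 <= rs b m <= 1)%R.
Proof. exact: (surv_iter_itv EZ_gt1 Z_moments). Qed.

Definition kolmo_low : R := (p ^+ 2 * zge2 Z)%R.

Lemma kolmo_low_gt0 : (0 < kolmo_low)%R.
Proof. by rewrite mulr_gt0 ?exprn_gt0// zge2_gt0. Qed.

(** A discrete form of the bound r <= 1/(1 + c m) for solutions of r' = - c r^2 with r(0) <= 1. *)
Lemma surv_iter_le b m : (0 <= b <= 1)%R -> (rs b m * (1 + kolmo_low * m%:R) <= 1)%R.
Proof.
move=> b01; elim: m => [|m IHm]; first by rewrite mulr0 addr0 mulr1; case/andP: b01.
have c0 := kolmo_low_gt0; set c := kolmo_low in c0 IHm *.
have /andP[r0 r1] := rs01 m b01; have /andP[r0' r1'] := rs01 m.+1 b01.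
have := surv_step_le2 Z_ge1 EZ_gt1 Z_moments (rs01 m b01); rewrite -/kolmo_low -/c.
rewrite -[surv_step _ _]/(rs b m.+1); move: IHm r0 r1 r0' r1'.
rewrite -natr1; set r := rs b m; set r' := rs b m.+1 => IHm r0 r1 r0' r1' rr.
set y := (1 + c * m%:R)%R in IHm; have y1 : (1 <= y)%R by rewrite /y lerDl mulr_ge0// ltW.
have -> : (1 + c * (m%:R + 1) = y + c)%R by rewrite /y; ring.
apply: (@le_trans _ _ ((r - c * r ^+ 2) * (y + c))%R).
  by apply: ler_wpM2r => //; lra.
have [->|rn0] := eqVneq r 0%R; first by rewrite expr0n mulr0 subr0 mul0r.
have rpos : (0 < r)%R by rewrite lt_neqAle eq_sym rn0.
(* Forced by nonnegativity of the next iterate, which is at most r - c r^2. *)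
have cr : (c * r <= 1)%R.
  have : (0 <= r * (1 - c * r))%R by apply: le_trans r0' (le_trans rr _); rewrite expr2; lra.
  by rewrite pmulr_rge0// subr_ge0.
have : (0 <= (1 - c * r) * (1 - r * y))%R by rewrite mulr_ge0 ?subr_ge0.
have : (0 <= (c * r) ^+ 2)%R by rewrite sqr_ge0.
by rewrite exprMn; lra.
Qed.

Lemma surv_iter_decay N : (0 < N)%N -> exists2 K : R, (0 <= K)%R &
  forall b m, (0 <= b <= 1)%R -> (rs b m <= K * (m + N)%:R^-1)%R.
Proof.
move=> N0; have c0 := kolmo_low_gt0; exists (N%:R + kolmo_low^-1)%R.
  by rewrite addr_ge0// invr_ge0 ltW.
move=> b m b01; have := surv_iter_le m b01; have /andP[r0 r1] := rs01 m b01.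
have x0 : (0 < (m + N)%:R :> R)%R by rewrite ltr0n addn_gt0 N0 orbT.
rewrite -ler_pdivrMr ?invr_gt0// invrK => H.
have y0 : (0 < 1 + kolmo_low * m%:R)%R by rewrite ltr_pwDl// mulr_ge0// ltW.
apply: (@le_trans _ _ (rs b m * ((N%:R + kolmo_low^-1) * (1 + kolmo_low * m%:R))))%R.
  apply: ler_wpM2l => //; rewrite mulrDl mulrDr (mulrDr _ 1%R) !mulr1 mulKf ?gt_eqF//.
  rewrite natrD addrC lerD//; first by rewrite lerDl mulr_ge0// mulr_ge0// ltW.
  by rewrite lerDr invr_ge0 ltW.
rewrite mulrCA -[leRHS]mulr1; apply: ler_wpM2l => //.
by rewrite addr_ge0// invr_ge0 ltW.
Qed.

(** By the union bound, G_(m+1) is at most p sum G_m, that is a centred sum plus p Z r_m; the noise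
    is thus of order r_m. *)
Lemma Gf_sqr_step b m (a : R) : (0 <= b <= 1)%R ->
  E2 m (@Gf R p b m) <= a%:E ->
  E2 m.+1 (@Gf R p b m.+1) <=
    (rho Z * a + kap Z * (p ^+ 2 * zm 2 * rs b m ^+ 2))%:E.
Proof.
move=> b01 IH.
have G01 k (s : tr k) := Gf_itv s p01 b01.
have mean := Gf_mean EZ_gt1 Z_moments nu_iid m b01.
have [i2 i1] := square_integrable (mT [::] (@Gf R p b m)) (le_lt_trans IH (ltry _)).
have c2 := le_trans (integral_centered_sqr i2 i1 mean) IH.
have m1 : E1 m (fun s => Gf p b s - rs b m)%R = 0.
  have ic : P.-integrable setT (fun w : Om => (- rs b m)%R%:E) by exact: finite_measure_integrable_cst.
  by rewrite (integral_addR i1 ic) mean (integral_prob_cst P (- rs b m)%R%:E) -EFinD subrr.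
have psi2 : E2 m.+1 (fun s : tr m.+1 => p * (size s)%:R * rs b m)%R <=
    (p ^+ 2 * zm 2 * rs b m ^+ 2)%:E.
  by rewrite (size_sqr Z_moments nu_iid).
have := @tree_contraction _ _ _ _ _ _ EZ_gt1 Z_moments nu_iid m
  (fun s => Gf p b s - rs b m)%R (fun s : tr m.+1 => p * (size s)%:R * rs b m)%R _ _ m1 c2 psi2.
apply: le_trans; apply: ge0_le_integral => //.
- by move=> w _; rewrite lee_fin sqr_ge0.
- by apply/measurable_EFinP; apply: measurable_funX; exact: (mT [::] (@Gf R p b m.+1)).
- apply/measurable_EFinP; apply: measurable_funX.
  exact: (mT [::] (fun s : tr m.+1 => p * (\sum_(t <- s) (Gf p b t - rs b m)) +
    p * (size s)%:R * rs b m)%R).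
move=> w _; rewrite lee_fin; set s := gw_tree _ _ _ _.
have -> : (p * (\sum_(t <- s) (Gf p b t - rs b m)) + p * (size s)%:R * rs b m =
    \sum_(t <- (s : seq (tr m))) p * Gf p b t)%R.
  elim: (s : seq (tr m)) => [|t s' IHs]; first by rewrite !big_nil !mulr0 !mul0r addr0.
  by rewrite !big_cons /= -natr1 -IHs; ring.
have x01 (t : tr m) : (0 <= p * Gf p b t <= 1)%R.
  by have /andP[? ?] := G01 _ t; have := p0; have := p1 => *; apply/andP; split; nra.
have /andP[H _] := prod_one_sub (s : seq (tr m)) x01.
have /andP[g0 _] := G01 m.+1 s.
have H' : (Gf p b s <= \sum_(t <- (s : seq (tr m))) p * Gf p b t)%R.
  by rewrite -subr_ge0.
by rewrite ler_sqr ?nnegrE// (le_trans g0).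
Qed.

(** The defect of the union bound is at most p^2 times the sum over pairs of children, so its second
    moment is quadratic in that of G_m. *)
Lemma correction_sqr b m (a : R) : (0 <= b <= 1)%R ->
  E2 m (@Gf R p b m) <= a%:E ->
  E2 m.+1 (fun s : tr m.+1 => p * (\sum_(t <- (s : seq (tr m))) Gf p b t) - Gf p b s)%R <=
    (p ^+ 4 * zm 4 * a ^+ 2)%:E.
Proof.
move=> b01 IH.
have G01 k (s : tr k) := Gf_itv s p01 b01.
have a0 : (0 <= a)%R by rewrite -lee_fin; apply: le_trans IH; apply: integral_ge0 => w _; rewrite lee_fin sqr_ge0.
have [i2 i1] := square_integrable (mT [::] (@Gf R p b m)) (le_lt_trans IH (ltry _)).
have a2E : E2 m (@Gf R p b m) = (fine (E2 m (@Gf R p b m)))%:E by rewrite fineK//; exact: integrable_fin_num i2.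
have a2a : (fine (E2 m (@Gf R p b m)) <= a)%R by rewrite -lee_fin -a2E.
have a20 : (0 <= fine (E2 m (@Gf R p b m)))%R by rewrite -lee_fin -a2E; apply: integral_ge0 => w _; rewrite lee_fin sqr_ge0.
have := @offspring_pairs _ _ _ _ _ _ nu_iid m [::] (@Gf R p b m) _ (fun s => proj1 (andP (G01 _ s))) a2E.
rewrite zE => H.
apply: (@le_trans _ _ (\int[P]_w (p ^+ 4 *
   (\sum_(z <- pairs (T m.+1 [::] w)) Gf p b z.1 * Gf p b z.2) ^+ 2)%:E)).
  apply: ge0_le_integral => //.
  - by move=> w _; rewrite lee_fin sqr_ge0.
  - apply/measurable_EFinP; apply: measurable_funX.
    exact: (mT [::] (fun s : tr m.+1 => p * (\sum_(t <- (s : seq (tr m))) Gf p b t) - Gf p b s)%R).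
  - apply/measurable_EFinP.
    exact: (mT [::] (fun s : tr m.+1 => p ^+ 4 *
      (\sum_(z <- pairs (s : seq (tr m))) Gf p b z.1 * Gf p b z.2) ^+ 2)%R).
  move=> w _; rewrite lee_fin; set s := gw_tree _ _ _ _.
  have x01 (t : tr m) : (0 <= p * Gf p b t <= 1)%R.
    by have /andP[? ?] := G01 _ t; have := p0; have := p1 => *; apply/andP; split; nra.
  have /andP[H1 H2] := prod_one_sub (s : seq (tr m)) x01.
  have -> : (p * (\sum_(t <- (s : seq (tr m))) Gf p b t) - Gf p b s =
    \sum_(i <- (s : seq (tr m))) p * Gf p b i - (1 - \prod_(i <- (s : seq (tr m))) (1 - p * Gf p b i)))%R.
    by rewrite mulr_sumr.
  rewrite (_ : 4%N = (2 * 2)%N)// exprM -exprMn ler_sqr ?nnegrE//; last first.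
    rewrite mulr_ge0 ?sqr_ge0//; apply: sumr_ge0 => z _.
    by rewrite mulr_ge0//; [case/andP: (G01 _ z.1)|case/andP: (G01 _ z.2)].
  apply: le_trans H2 _; rewrite mulr_sumr le_eqVlt; apply/orP; left; apply/eqP.
  by apply: eq_bigr => z _; ring.
rewrite ge0_integral_scaleR ?exprn_ge0 ?(ltW p0)//; last 2 first.
- apply: measurable_funX.
  exact: (mT [::] (fun s : tr m.+1 => \sum_(z <- pairs (s : seq (tr m))) Gf p b z.1 * Gf p b z.2)%R).
- by move=> w; rewrite sqr_ge0.
have p40 : 0 <= (p ^+ 4)%:E by rewrite lee_fin exprn_ge0// ltW.
apply: (le_trans (lee_wpmul2l p40 H)).
rewrite -EFinM lee_fin mulrA; apply: ler_wpM2l.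
  by rewrite mulr_ge0 ?zmom_ge0// exprn_ge0// ltW.
by rewrite ler_sqr.
Qed.

(** The noise has two sources: the increment r_m - r_(m+1), of order r_m^2, multiplied by W_(m+1),
    and the defect of the union bound. *)
Lemma deviation_step b m (a D : R) : (0 <= b <= 1)%R ->
  E2 m (@Gf R p b m) <= a%:E ->
  E2 m (fun s => Gf p b s - rs b m * Wf p s)%R <= D%:E ->
  E2 m.+1 (fun s => Gf p b s - rs b m.+1 * Wf p s)%R <=
   (rho Z * D + kap Z * (2 * ((kolmo Z * rs b m ^+ 2) ^+ 2 * Wbound Z) +
      2 * (p ^+ 4 * zm 4 * a ^+ 2)))%:E.
Proof.
move=> b01 Ga IH; have G01 k (s : tr k) := Gf_itv s p01 b01.
have meanG := Gf_mean EZ_gt1 Z_moments nu_iid m b01.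
have meanW := Wf_mean EZ_gt1 Z_moments nu_iid m.
have [i2 i1] := square_integrable (mT [::] (@Gf R p b m)) (le_lt_trans Ga (ltry _)).
have [j2 j1] := Wf_integrable EZ_gt1 Z_moments nu_iid m.
have m1 : E1 m (fun s => Gf p b s - rs b m * Wf p s)%R = 0.
  under eq_integral do rewrite -mulNr.
  rewrite (integral_addR i1 (integrable_scaleR (- rs b m) j1)).
  by rewrite (integral_scaleR _ j1) meanG meanW mule1 -EFinD subrr.
pose e (s : tr m.+1) : R := (p * (\sum_(t <- (s : seq (tr m))) Gf p b t) - Gf p b s)%R.
pose dr : R := (rs b m - rs b m.+1)%R.
pose psi (s : tr m.+1) : R := (dr * Wf p s + - e s)%R.
have psi2 : E2 m.+1 psi <= (2 * ((kolmo Z * rs b m ^+ 2) ^+ 2 * Wbound Z) +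
      2 * (p ^+ 4 * zm 4 * a ^+ 2))%:E.
  apply: (le_trans (integral_sqr_addM P ltr01
    (mT [::] (fun s : tr m.+1 => dr * Wf p s)%R) (mT [::] (fun s => - e s)%R))).
  rewrite invr1 [leRHS]EFinD; apply: leeD.
    rewrite [leRHS]EFinM; apply: lee_wpmul2l => //.
    under eq_integral do rewrite exprMn.
    rewrite ge0_integral_scaleR ?sqr_ge0//; last 2 first.
    - by apply: measurable_funX; exact: (mT [::] (@Wf R p m.+1)).
    - by move=> w; rewrite sqr_ge0.
    apply: (@le_trans _ _ ((dr ^+ 2)%:E * (Wbound Z)%:E)).
      by apply: lee_wpmul2l; [rewrite lee_fin sqr_ge0|exact: Wf_sqr].
    rewrite -EFinM lee_fin; apply: ler_wpM2r.
      by apply: le_trans (Wbound_ge1 EZ_gt1 Z_moments).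
    have r01 := rs01 m b01.
    have H1 := surv_step_ge Z_ge1 EZ_gt1 Z_moments r01.
    have H2 := surv_step_le2 Z_ge1 EZ_gt1 Z_moments r01.
    have c0 := kolmo_low_gt0; rewrite /kolmo_low in c0.
    have dr0 : (0 <= dr)%R.
      rewrite subr_ge0; apply: le_trans H2 _; rewrite gerBl mulr_ge0 ?sqr_ge0//.
      exact: ltW.
    have drk : (dr <= kolmo Z * rs b m ^+ 2)%R by rewrite /dr /=; lra.
    by rewrite ler_sqr ?nnegrE// (le_trans dr0).
  rewrite [leRHS]EFinM; apply: lee_wpmul2l => //.
  under eq_integral do rewrite sqrrN.
  exact: correction_sqr.
have := @tree_contraction _ _ _ _ _ _ EZ_gt1 Z_moments nu_iid m
  (fun s => Gf p b s - rs b m * Wf p s)%R psi _ _ m1 IH psi2.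
apply: le_trans; rewrite le_eqVlt; apply/orP; left; apply/eqP.
apply: eq_integral => w _; congr ((_ ^+ 2)%:E).
rewrite /psi /e /dr; set s := gw_tree _ _ _ _.
have -> : (\sum_(t <- s) (Gf p b t - rs b m * Wf p t) =
   \sum_(t <- (s : seq (tr m))) Gf p b t - rs b m * \sum_(t <- (s : seq (tr m))) Wf p t)%R.
  by rewrite mulr_sumr -sumrB.
have -> : (Wf p s = p * \sum_(t <- (s : seq (tr m))) Wf p t)%R by [].
by set x := (\sum_(t <- (s : seq (tr m))) Wf p t)%R; set y := (\sum_(t <- (s : seq (tr m))) Gf p b t)%R; ring.
Qed.

Lemma deviation_decay : exists C N, [/\ (0 <= C)%R, (0 < N)%N &
  forall b m, (0 <= b <= 1)%R ->
    E2 m (fun s => Gf p b s - rs b m * Wf p s)%R <= (C * ((m + N)%:R^-1) ^+ 4)%:E].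
Proof.
have /andP[r0 r1] := rho_itv EZ_gt1 Z_moments; have k0 := kap_ge0 EZ_gt1 Z_moments.
pose q : R := ((1 + rho Z) / 2)%R.
have rq : (rho Z < q)%R by rewrite /q; lra.
have [N N0 HN] : exists2 N : nat, (0 < N)%N & forall m j : nat, (j <= 4)%N ->
    (q * ((m + N)%:R^-1) ^+ j <= ((m.+1 + N)%:R^-1) ^+ j)%R.
  by apply: inv_shift_decay; rewrite /q; lra.
have [K K0 HK] := surv_iter_decay N0.
have B20 : (0 <= kap Z * (p ^+ 2 * zm 2 * K ^+ 2))%R.
  apply: mulr_ge0 => //; apply: mulr_ge0; last exact: sqr_ge0.
  by apply: mulr_ge0; [exact: sqr_ge0|exact: zmom_ge0].
(* First run, with exponent 2: the second moments of G_m. *)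
have [C2 C20 HC2] := contraction_decay r0 rq B20 (@ler01 R) N0 (HN^~ 2%N ^~ isT).
pose B4 : R := (kap Z * (2 * ((kolmo Z * K ^+ 2) ^+ 2 * Wbound Z) +
      2 * (p ^+ 4 * zm 4 * C2 ^+ 2)))%R.
have W0 : (0 <= Wbound Z)%R by apply: le_trans (Wbound_ge1 EZ_gt1 Z_moments).
have B40 : (0 <= B4)%R.
  apply: mulr_ge0 => //; apply: addr_ge0; apply: mulr_ge0 => //.
    by apply: mulr_ge0 => //; exact: sqr_ge0.
  apply: mulr_ge0; last exact: sqr_ge0.
  by apply: mulr_ge0; [rewrite exprn_ge0// ltW|exact: zmom_ge0].
(* Second run, with exponent 4. It starts from 0 because D_0 = b - b * 1. *)
have [C4 C40 HC4] := contraction_decay r0 rq B40 (lexx (0 : R)%R) N0 (HN^~ 4%N ^~ isT).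
exists C4, N; split => // b m b01.
pose h m : R := ((m + N)%:R^-1)%R.
(* The sequences [a] and, below, [D] solve the recursions with equality; the constants fixed before
   [b] apply to them. *)
pose a := fix a m : R := if m is m'.+1 then
  (rho Z * a m' + kap Z * (p ^+ 2 * zm 2 * K ^+ 2) * h m' ^+ 2)%R else 1%R.
have rK k : (rs b k ^+ 2 <= K ^+ 2 * h k ^+ 2)%R.
  by rewrite -exprMn ler_sqr ?nnegrE ?HK//; [case/andP: (rs01 k b01)|rewrite mulr_ge0// invr_ge0].
have aE k : E2 k (@Gf R p b k) <= (a k)%:E.
  elim: k => [|k IHk].
    change (\int[P]_w (cst (b ^+ 2)%:E w) <= 1%:E).
    by rewrite integral_prob_cst lee_fin; case/andP: b01 => *; rewrite expr_le1.
  apply: le_trans (Gf_sqr_step b01 IHk) _; rewrite lee_fin /= lerD2l.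
  rewrite -[leRHS]mulrA ler_wpM2l// -[leRHS]mulrA ler_wpM2l//.
  by rewrite mulr_ge0 ?zmom_ge0// exprn_ge0// ltW.
have a2 : forall k, (a k <= C2 * h k ^+ 2)%R by apply: HC2.
have a0 k : (0 <= a k)%R.
  by rewrite -lee_fin; apply: le_trans (aE k); apply: integral_ge0 => w _; rewrite lee_fin sqr_ge0.
pose D := fix D m : R := if m is m'.+1 then
  (rho Z * D m' + B4 * h m' ^+ 4)%R else 0%R.
have DE k : E2 k (fun s => Gf p b s - rs b k * Wf p s)%R <= (D k)%:E.
  elim: k => [|k IHk].
    rewrite (eq_integral (cst 0)) ?integral0// => w _.
    by rewrite /= mulr1 subrr expr0n.
  apply: le_trans (deviation_step b01 (aE k) IHk) _; rewrite lee_fin /= lerD2l.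
  have M0 : (0 <= p ^+ 4 * zm 4)%R by rewrite mulr_ge0 ?zmom_ge0// exprn_ge0// ltW.
  have c0 : (0 <= kolmo Z)%R by rewrite ltW// (kolmo_gt0 Z_ge1 EZ_gt1 Z_moments).
  have e1 : ((kolmo Z * rs b k ^+ 2) ^+ 2 <= (kolmo Z * K ^+ 2) ^+ 2 * h k ^+ 4)%R.
    rewrite (_ : 4%N = (2 * 2)%N)// exprM -exprMn ler_sqr ?nnegrE.
    - by rewrite -[leRHS]mulrA ler_wpM2l.
    - by rewrite mulr_ge0 ?sqr_ge0.
    - by apply: mulr_ge0; [apply: mulr_ge0 => //|]; exact: sqr_ge0.
  have e2 : (a k ^+ 2 <= C2 ^+ 2 * h k ^+ 4)%R.
    rewrite (_ : 4%N = (2 * 2)%N)// exprM -exprMn ler_sqr ?nnegrE//.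
    by rewrite mulr_ge0 ?sqr_ge0.
  rewrite /B4 -[leRHS]mulrA ler_wpM2l//.
  have f1 := ler_wpM2r W0 e1; have f2 := ler_wpM2l M0 e2.
  by lra.
apply: le_trans (DE m) _; rewrite lee_fin.
exact: HC4.
Qed.

End decay.

(** * Almost sure limits *)

Section borel_cantelli.
Local Open Scope ereal_scope.
Context d (Om : measurableType d) (R : realType) (P : probability Om R).

(* A Fatou form of the first Borel-Cantelli lemma: the nth term is only known
   as a pointwise limit in k. *)
Lemma ae_summable_lim (Y : nat -> nat -> Om -> R) (a : nat -> R) (K : R) :
  (forall n k, measurable_fun setT (Y n k)) ->
  (forall n k w, (0 <= Y n k w)%R) ->
  (forall n k, \int[P]_w (Y n k w)%:E <= (a n)%:E) ->
  (forall M, (\sum_(n < M) a n <= K)%R) ->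
  {ae P, forall w, forall y : nat -> R,
    (forall n, Y n k w @[k --> \oo] --> y n) -> cvgn (series y)}.
Proof.
move=> mY Y0 aY aK.
(* The lower limit is defined and measurable everywhere, whereas the limits [y] may exist at some
   outcomes only. The two are identified at the end, one outcome at a time. *)
pose L n w : \bar R := limn_einf (fun k => (Y n k w)%:E).
have mL n : measurable_fun setT (L n).
  have -> : L n = (fun w => - limn_esup (fun k => - (Y n k w)%:E)).
    by apply/funext => w; rewrite /L /limn_einf; congr (- limn_esup _).
  apply: measurableT_comp => //; apply: measurable_fun_limn_esup => k.
  by apply: measurableT_comp => //; exact/measurable_EFinP.
have L0 n w : 0 <= L n w.
  rewrite /L limn_einf_lim; apply: lime_ge; first exact: is_cvg_einfs.
  apply: nearW => m; apply: le_ereal_inf_tmp.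
  by move=> _ [k _ <-]; rewrite lee_fin.
have IL n : \int[P]_w L n w <= (a n)%:E.
  apply: le_trans (fatou P measurableT _ _) _ => //.
  - by move=> k; exact/measurable_EFinP.
  - by move=> k w _; rewrite lee_fin.
  rewrite limn_einf_lim; apply: lime_le; first exact: is_cvg_einfs.
  apply: nearW => m; apply: le_trans (aY n m).
  by apply: ereal_inf_lbound; exists m => //=.
have IS : \int[P]_w (\sum_(n <oo) L n w) <= K%:E.
  rewrite integral_nneseries//; apply: lime_le.
    by apply: is_cvg_nneseries => n _ _; exact: integral_ge0.
  apply: nearW => M; apply: (@le_trans _ _ (\sum_(0 <= n < M) (a n)%:E)).
    by apply: lee_sum => n _.
  by rewrite sumEFin lee_fin big_mkord.
have iS : P.-integrable setT (fun w => \sum_(n <oo) L n w).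
  apply/integrableP; split; first exact: ge0_emeasurable_sum.
  apply: le_lt_trans (ltry K); apply: le_trans IS.
  rewrite le_eqVlt; apply/orP; left; apply/eqP; apply: eq_integral => w _.
  by rewrite gee0_abs// nneseries_ge0.
have := integrable_ae measurableT iS; apply: filterS => w /(_ I) Lfin y Yy.
have Ly n : L n w = (y n)%:E.
  have Yl : (Y n k w)%:E @[k --> \oo] --> (y n)%:E.
    by apply/fine_cvgP; split; [exact: nearW|exact: Yy].
  by have [] := cvg_limn_einf_sup Yl.
have y0 n : (0 <= y n)%R by rewrite -lee_fin -Ly.
apply: nondecreasing_is_cvgn.
  by apply: nondecreasing_series => n _ _; exact: y0.
exists (fine (\sum_(n <oo) L n w)) => _ [M _ <-].
rewrite -lee_fin fineK// /series/= -sumEFin.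
under eq_bigr do rewrite -Ly.
exact: nneseries_lim_ge.
Qed.

Lemma ae_summable (Y : nat -> Om -> R) (a : nat -> R) (K : R) :
  (forall n, measurable_fun setT (Y n)) -> (forall n w, (0 <= Y n w)%R) ->
  (forall n, \int[P]_w (Y n w)%:E <= (a n)%:E) ->
  (forall M, (\sum_(n < M) a n <= K)%R) ->
  {ae P, forall w, cvgn (series (Y ^~ w))}.
Proof.
move=> mY Y0 aY aK.
have := @ae_summable_lim (fun n _ => Y n) a K (fun n _ => mY n)
  (fun n _ => Y0 n) (fun n _ => aY n) aK.
by apply: filterS => w; apply => n; exact: cvg_cst.
Qed.

Lemma cvg_sqr0 (x : nat -> R) : (x n ^+ 2)%R @[n --> \oo] --> (0%R : R) ->
  x n @[n --> \oo] --> (0%R : R).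
Proof.
move=> /cvgrPdist_lt x2; apply/cvgrPdist_lt => e e0.
have := x2 _ (exprn_gt0 2 e0); apply: filterS => n.
rewrite !sub0r !normrN ger0_norm ?sqr_ge0// -[(x n ^+ 2)%R]real_normK ?num_real//.
by rewrite ltr_sqr ?nnegrE ?(ltW e0).
Qed.

(** Summable second moments make the series of squares converge almost surely, so its terms
    vanish. *)
Lemma ae_cvg0 (X : nat -> Om -> R) (a : nat -> R) (K : R) :
  (forall n, measurable_fun setT (X n)) ->
  (forall n, \int[P]_w (X n w ^+ 2)%:E <= (a n)%:E) ->
  (forall M, (\sum_(n < M) a n <= K)%R) ->
  {ae P, forall w, X n w @[n --> \oo] --> (0%R : R)}.
Proof.
move=> mX aX aK.
have := @ae_summable (fun n w => (X n w ^+ 2)%R) a K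
  (fun n => measurable_funX 2 (mX n)) (fun n w => sqr_ge0 _) aX aK.
apply: filterS => w cX; apply: cvg_sqr0.
exact: (@cvg_series_cvg_0 _ _ (fun n => (X n w ^+ 2)%R)).
Qed.

End borel_cantelli.

(** Telescoping: 1/x^2 <= 2 (1/x - 1/(x + 1)) for x >= 1. *)
Lemma sum_inv_sqr (R : realFieldType) (N M : nat) : (0 < N)%N ->
  \sum_(n < M) ((n + N)%:R^-1 : R) ^+ 2 <= 2.
Proof.
move=> N0; suff : \sum_(n < M) ((n + N)%:R^-1 : R) ^+ 2 <= 2 - 2 * (M + N)%:R^-1.
  by move/le_trans; apply; rewrite gerBl.
elim: M => [|M IHM].
  rewrite big_ord0 subr_ge0 add0n ler_piMr// invf_le1 ?ltr0n//.
  by rewrite (ler_nat R 1).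
rewrite big_ord_recr /=; apply: le_trans (lerD IHM (lexx _)) _.
rewrite addSn -[(M + N).+1%:R]natr1; have x0 : 0 < (M + N)%:R :> R by rewrite ltr0n addn_gt0 N0 orbT.
have x1 : 1 <= (M + N)%:R :> R by rewrite (ler_nat R 1) addn_gt0 N0 orbT.
move: x0 x1; set x : R := (M + N)%:R => x0 x1.
have y0 : 0 < x^-1 by rewrite invr_gt0.
have z0 : 0 < (x + 1)^-1 by rewrite invr_gt0; lra.
have xy : x * x^-1 = 1 by rewrite mulfV// gt_eqF.
have xz : (x + 1) * (x + 1)^-1 = 1 by rewrite mulfV// gt_eqF//; lra.
move: y0 z0 xy xz; set y := x^-1; set z := (x + 1)^-1 => y0 z0 xy xz.
have yz : y - z = y * z.
  have -> : y - z = y * ((x + 1) * z) - z * (x * y) by rewrite xy xz !mulr1.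
  by ring.
have zy : y <= 2 * z.
  rewrite -(ler_pM2l x0) xy; have : x * z = 1 - z by lra.
  move=> xzE; rewrite mulrCA xzE; have : z <= 2^-1; last by lra.
  by rewrite lef_pV2 ?posrE//; lra.
have : 0 <= y * (2 * z - y) by rewrite mulr_ge0// ?subr_ge0// ltW.
by rewrite expr2; lra.
Qed.

Lemma cvg_inv_nat (R : archiRealFieldType) : (n%:R^-1 : R) @[n --> \oo] --> (0 : R).
Proof.
pose f (n : nat) : R := n%:R^-1; rewrite -[X in X @ _ --> _]/f -cvg_shiftS.
exact: cvg_harmonic.
Qed.

(** * Asymptotics of the annealed survival probability *)

Section survival_asymptotics.
Context {R : realType} d (Om : measurableType d) (P : probability Om R).
Variable Z : {RV P >-> nat}.
Hypothesis Z_ge1 : forall w, (1 <= Z w)%N.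
Hypothesis EZ_gt1 : (1 < 'E_P[fun w => (Z w)%:R])%E.
Hypothesis Z_moments : forall q : R, 1 <= q ->
  ('E_P[fun w => ((Z w)%:R `^ q)%R] < +oo)%E.
Notation mu := (progeny_mean Z).
Notation p := (mu^-1).
Notation rs := (surv_iter Z).
Notation kol := (kolmo Z).

Let p0 : 0 < p. Proof. exact: (p_gt0 EZ_gt1 Z_moments). Qed.
Let k0 : 0 < kol. Proof. exact: (kolmo_gt0 Z_ge1 EZ_gt1 Z_moments). Qed.

Let Kk : R := (kol ^+ 2 + p ^+ 3 * zmom Z 3) / p.

Let Kk_ge0 : 0 <= Kk.
Proof.
apply: divr_ge0; last exact: ltW.
apply: addr_ge0; first exact: sqr_ge0.
by apply: mulr_ge0; [rewrite exprn_ge0// ltW|exact: zmom_ge0].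
Qed.

(** Inversion linearizes the recursion. With f the image of r and k = [kolmo], the error is (r - f -
    k r f) / (r f); the numerator is O(r^3) and f >= p r, whence the division by p in [Kk]. *)
Lemma surv_step_inv r : 0 < r <= 1 ->
  `|(surv_step Z r)^-1 - r^-1 - kol| <= Kk * r.
Proof.
move=> /andP[r0 r1]; have r01 : 0 <= r <= 1 by rewrite ltW.
have H1 := surv_step_ge Z_ge1 EZ_gt1 Z_moments r01.
have H2 := surv_step_le Z_ge1 EZ_gt1 Z_moments r01.
have H3 := surv_step_le2 Z_ge1 EZ_gt1 Z_moments r01.
have H4 := surv_step_ge_p Z_ge1 EZ_gt1 Z_moments r01.
have c0 := zge2_ge0 Z.
have c1 : 0 <= p ^+ 2 * zge2 Z * r ^+ 2.
  by apply: mulr_ge0; [apply: mulr_ge0 => //|]; exact: sqr_ge0.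
have c3 : 0 <= p ^+ 3 * zmom Z 3.
  by apply: mulr_ge0; [rewrite exprn_ge0// ltW|exact: zmom_ge0].
rewrite /Kk; move: H1 H2 H3 H4 c1 c3 p0 k0; set f := surv_step Z r; set k := kol.
set c := p ^+ 3 * _; set q := p => H1 H2 H3 H4 c1 c3 q0 kp.
have f0 : 0 < f by apply: lt_le_trans H4; rewrite mulr_gt0.
have rf : 0 < r * f by rewrite mulr_gt0.
have -> : f^-1 - r^-1 - k = (r - f - k * (r * f)) / (r * f).
  by field; rewrite !gt_eqF.
rewrite normrM (ger0_norm (x := (r * f)^-1)) ?invr_ge0 ?(ltW rf)//.
rewrite ler_pdivrMr//.
apply: (@le_trans _ _ ((k ^+ 2 + c) * r ^+ 3)).
  have fr : f <= r by lra.
  have rfr : r * f <= r ^+ 2 by rewrite expr2 ler_pM2l.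
  have rfl : r ^+ 2 - k * r ^+ 3 <= r * f.
    by have := ler_wpM2l (ltW r0) H1; rewrite mulrBr -expr2 mulrCA -exprS.
  have e1 := ler_wpM2l (ltW kp) rfr; have e2 := ler_wpM2l (ltW kp) rfl.
  have r3 : 0 <= r ^+ 3 by rewrite exprn_ge0// ltW.
  have cr3 := mulr_ge0 c3 r3; have kr3 := mulr_ge0 (sqr_ge0 k) r3.
  by rewrite ler_norml; apply/andP; split; rewrite ?mulrDl; lra.
have -> : (k ^+ 2 + c) / q * r * (r * f) = (k ^+ 2 + c) * (q^-1 * (r * (r * f))) by ring.
rewrite ler_wpM2l ?addr_ge0 ?sqr_ge0// ler_pdivlMl// exprS mulrCA ler_pM2l//.
by rewrite expr2 mulrCA ler_pM2l.
Qed.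

Lemma surv_iter_inv b n : 0 < b <= 1 ->
  0 < rs b n /\ `|(rs b n)^-1 - b^-1 - n%:R * kol| <= Kk * \sum_(m < n) rs b m.
Proof.
move=> /andP[b0 b1]; have b01 : 0 <= b <= 1 by rewrite ltW.
elim: n => [|n [IH0 IHn]].
  by rewrite big_ord0 mulr0 subrr mul0r subrr normr0.
have r01 := surv_iter_itv EZ_gt1 Z_moments n b01; have /andP[_ r1] := r01.
split.
  apply: lt_le_trans (surv_step_ge_p Z_ge1 EZ_gt1 Z_moments r01).
  by rewrite mulr_gt0.
have r01' : 0 < rs b n <= 1 by rewrite IH0.
have H := surv_step_inv r01'; rewrite big_ord_recr/= mulrDr.
have -> : (surv_step Z (rs b n))^-1 - b^-1 - n.+1%:R * kol =
  ((rs b n)^-1 - b^-1 - n%:R * kol) + ((surv_step Z (rs b n))^-1 - (rs b n)^-1 - kol).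
  by rewrite -natr1; ring.
exact: le_trans (ler_normD _ _) (lerD IHn H).
Qed.

(** The accumulated error is a multiple of the sum of the r_m, which is O(log n) and hence o(n). The
    start may vary with n because the constants do not depend on it. *)
Lemma surv_iter_cvg (b : nat -> R) (l : R) : 0 <= l ->
  (forall n, (0 < n)%N -> 0 < b n <= 1) ->
  (n%:R * b n)^-1 @[n --> \oo] --> l ->
  n%:R * rs (b n) n @[n --> \oo] --> (kol + l)^-1.
Proof.
move=> l0 b01 bl; have [K K0 HK] := surv_iter_decay Z_ge1 EZ_gt1 Z_moments (isT : (0 < 1)%N).
pose e n : R := n%:R^-1 * series harmonic n.
(* Cesaro means of the harmonic sequence. *)
have e0 : e n @[n --> \oo] --> 0.
  by rewrite -cvg_shiftS; exact: (@cesaro R harmonic 0 cvg_harmonic).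
have H n : (0 < n)%N -> `|(n%:R * rs (b n) n)^-1 - (n%:R * b n)^-1 - kol| <= Kk * K * e n.
  move=> n0; have [r0 Hn] := surv_iter_inv n (b01 n n0).
  have /andP[bn0 bn1] := b01 n n0; have nn0 : 0 < n%:R :> R by rewrite ltr0n.
  have -> : (n%:R * rs (b n) n)^-1 - (n%:R * b n)^-1 - kol =
     n%:R^-1 * ((rs (b n) n)^-1 - (b n)^-1 - n%:R * kol).
    by field; rewrite !gt_eqF.
  rewrite normrM (ger0_norm (x := n%:R^-1)) ?invr_ge0// /e (mulrCA (Kk * K)).
  rewrite ler_pM2l ?invr_gt0//.
  apply: le_trans Hn _; rewrite -[leRHS]mulrA ler_wpM2l//.
  rewrite /series/= big_mkord mulr_sumr; apply: ler_sum => m _.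
  by have := HK (b n) m; rewrite addn1 /harmonic /=; apply; rewrite ltW.
rewrite -[X in X @ _ --> _](_ : (fun n => ((n%:R * rs (b n) n)^-1)^-1) = _); last first.
  by apply/funext => n; rewrite invrK.
apply: cvgV; first by rewrite gt_eqF// ltr_wpDr.
have c0 : Kk * K * e n @[n --> \oo] --> Kk * K * 0 by apply: cvgMr.
rewrite mulr0 in c0.
have d0 : (n%:R * rs (b n) n)^-1 - (n%:R * b n)^-1 - kol @[n --> \oo] --> 0.
  apply: norm_cvg0; apply: squeeze_cvgr (cvg_cst 0) c0.
  by near=> n; rewrite normr_ge0 H//; near: n; exists 1%N.
rewrite -[X in X @ _ --> _](_ : (fun n => ((n%:R * rs (b n) n)^-1 - (n%:R * b n)^-1 - kol) +
  (kol + (n%:R * b n)^-1)) = _); last by apply/funext => n; ring.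
rewrite -[kol + l]add0r; apply: cvgD d0 _; apply: cvgD => //.
exact: cvg_cst.
Unshelve. all: by end_near. Qed.

Lemma surv_iter1_cvg : n%:R * rs 1 n @[n --> \oo] --> kol^-1.
Proof.
rewrite -[kol]addr0; apply: surv_iter_cvg => //.
  by move=> n _; rewrite ltr01 lexx.
by under eq_fun do rewrite mulr1; exact: cvg_inv_nat.
Qed.

Definition laplace_arg (j n : nat) : R := 1 - expR (- (j%:R / n%:R)).

Lemma laplace_arg_itv j n : 0 <= laplace_arg j n <= 1.
Proof.
rewrite /laplace_arg subr_ge0 gerBl expR_ge0 andbT.
by rewrite -expR0 ler_expR oppr_le0 divr_ge0.
Qed.

(** For x = j/n, the bounds x / (1 + x) <= 1 - e^-x <= x give 1/j <= 1/(n b_n) <= 1/j + 1/n. *)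
Lemma surv_iter_laplace_cvg j : (0 < j)%N ->
  n%:R * rs (laplace_arg j n) n @[n --> \oo] --> (kol + j%:R^-1)^-1.
Proof.
move=> j0; have jR : 0 < j%:R :> R by rewrite ltr0n.
have bounds n : (0 < n)%N -> 0 < laplace_arg j n /\
   j%:R^-1 <= (n%:R * laplace_arg j n)^-1 <= j%:R^-1 + n%:R^-1.
  move=> n0; have nR : 0 < n%:R :> R by rewrite ltr0n.
  pose x : R := j%:R / n%:R; have x0 : 0 < x by rewrite divr_gt0.
  have E : laplace_arg j n = 1 - expR (- x) by [].
  have b0 : 0 < laplace_arg j n by rewrite E subr_gt0 -expR0 ltr_expR oppr_lt0.
  split => //; have nb : 0 < n%:R * laplace_arg j n by rewrite mulr_gt0.
  have up : laplace_arg j n <= x.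
    by have := expR_ge1Dx (- x); rewrite E; lra.
  have lo : x / (1 + x) <= laplace_arg j n.
    have x1 : 0 < 1 + x by lra.
    rewrite E expRN lerBrDr -lerBrDl.
    have -> : 1 - x / (1 + x) = (1 + x)^-1 by field; rewrite gt_eqF.
    by rewrite lef_pV2 ?posrE ?expR_gt0// expR_ge1Dx.
  apply/andP; split.
    rewrite lef_pV2 ?posrE//; apply: le_trans (ler_wpM2l (ltW nR) up) _.
    by rewrite /x mulrCA mulfV ?mulr1// gt_eqF.
  have -> : j%:R^-1 + n%:R^-1 = (n%:R * (x / (1 + x)))^-1.
    rewrite /x; field; rewrite !gt_eqF//=.
    by rewrite addr_gt0.
  rewrite lef_pV2 ?posrE//; last first.
    by rewrite mulr_gt0// divr_gt0//; lra.
  by rewrite ler_pM2l.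
apply: surv_iter_cvg; first by rewrite invr_ge0.
  by move=> n /bounds[-> _] /=; case/andP: (laplace_arg_itv j n).
have u : j%:R^-1 + n%:R^-1 @[n --> \oo] --> (j%:R^-1 + 0 : R).
  apply: cvgD; first exact: cvg_cst.
  exact: cvg_inv_nat.
rewrite addr0 in u; apply: squeeze_cvgr (cvg_cst _) u.
by near=> n; have [] := bounds n; first by near: n; exists 1%N.
Unshelve. all: by end_near. Qed.

End survival_asymptotics.

Lemma sum_geometric_le (R : realFieldType) (x : R) M : 0 <= x < 1 ->
  \sum_(n < M) x ^+ n <= (1 - x)^-1.
Proof.
move=> /andP[x0 x1]; have x1' : 0 < 1 - x by rewrite subr_gt0.
rewrite -[leRHS]mul1r ler_pdivlMr//.
suff -> : (\sum_(n < M) x ^+ n) * (1 - x) = 1 - x ^+ M by rewrite gerBl exprn_ge0.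
elim: M => [|M IHM]; first by rewrite big_ord0 mul0r expr0 subrr.
by rewrite big_ord_recr /= mulrDl IHM exprS; ring.
Qed.

(** * Convergence and positivity of W, and almost sure smallness of deviations *)

Section almost_sure.
Local Open Scope ereal_scope.
Context {R : realType} d (Om : measurableType d) (P : probability Om R).
Variables (Z : {RV P >-> nat}) (nu : seq nat -> {RV P >-> nat}).
Hypothesis Z_ge1 : forall w, (1 <= Z w)%N.
Hypothesis EZ_gt1 : 1 < 'E_P[fun w => (Z w)%:R].
Hypothesis Z_moments : forall q : R, (1 <= q)%R ->
  'E_P[fun w => ((Z w)%:R `^ q)%R] < +oo.
Hypothesis nu_iid : iid_offspring Z nu.
Notation T := (gw_tree nu).
Notation mu := (progeny_mean Z).
Notation p := (mu^-1)%R.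
Notation rs := (surv_iter Z).
Notation E1 k phi := (\int[P]_w (phi (T k [::] w))%:E).
Notation E2 k phi := (\int[P]_w (phi (T k [::] w) ^+ 2)%:E).

Let p0 : (0 < p)%R. Proof. exact: (p_gt0 EZ_gt1 Z_moments). Qed.
Let p1 : (p < 1)%R. Proof. exact: (p_lt1 EZ_gt1 Z_moments). Qed.
Let pm : (p * mu = 1)%R. Proof. exact: (pmu EZ_gt1 Z_moments). Qed.
Let mT k u (phi : tr k -> R) : measurable_fun setT (fun w => phi (T k u w)).
Proof. by apply/measurable_EFinP; exact: measurable_gw_tree. Qed.

Let E2u k u (phi : tr k -> R) : \int[P]_w (phi (T k u w) ^+ 2)%:E = E2 k phi.
Proof. exact: (gw_tree_integralR nu_iid u (fun s => phi s ^+ 2)%R). Qed.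

(** The factor n costs n^2 in the second moment, and n^2 (n + N)^-4 <= (n + N)^-2 is summable. *)
Lemma ae_Gf (b : nat -> R) u : (forall n, (0 <= b n <= 1)%R) ->
  {ae P, forall w, (n%:R * (Gf p (b n) (T n u w) - rs (b n) n * Wf p (T n u w)))%R
    @[n --> \oo] --> (0%R : R)}.
Proof.
move=> b01; have [C [N [C0 N0 HC]]] := deviation_decay Z_ge1 EZ_gt1 Z_moments nu_iid.
apply: (@ae_cvg0 _ _ _ P _ (fun n => C * ((n + N)%:R^-1) ^+ 2)%R (C * 2)%R).
- move=> n; exact: (mT u (fun t => n%:R * (Gf p (b n) t - rs (b n) n * Wf p t))%R).
- move=> n; under eq_integral do rewrite exprMn.
  rewrite ge0_integral_scaleR ?sqr_ge0//; last 2 first.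
  + apply: measurable_funX; exact: (mT u (fun t => Gf p (b n) t - rs (b n) n * Wf p t)%R).
  + by move=> w; rewrite sqr_ge0.
  rewrite (E2u u (fun t => Gf p (b n) t - rs (b n) n * Wf p t)%R).
  have n20 : 0 <= ((n%:R : R) ^+ 2)%:E by rewrite lee_fin sqr_ge0.
  apply: (le_trans (lee_wpmul2l n20 (HC _ n (b01 n)))); rewrite -EFinM lee_fin.
  rewrite mulrCA ler_wpM2l// (_ : 4%N = (2 + 2)%N)// exprD mulrA -exprMn.
  rewrite -[leRHS]mul1r ler_wpM2r ?sqr_ge0// expr_le1//.
  rewrite ler_pdivrMr ?mul1r ?ler_nat ?leq_addr//.
  by rewrite ltr0n addn_gt0 N0 orbT.
- move=> M; rewrite -mulr_sumr ler_wpM2l//.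
  by have := sum_inv_sqr R M N0.
Qed.

(** The increments of W_n are absolutely summable almost surely. Their geometric second moments are
    first weakened to O(n^-4), to fit the same majorant as above. *)
Lemma ae_Wf_cvg u : {ae P, forall w, cvgn (fun n => Wf p (T n u w))}.
Proof.
have /andP[r0 r1] := rho_itv EZ_gt1 Z_moments.
pose q : R := ((1 + rho Z) / 2)%R; have rq : (rho Z < q)%R by rewrite /q; lra.
have [N N0 HN] : exists2 N : nat, (0 < N)%N & forall m j : nat, (j <= 4)%N ->
    (q * ((m + N)%:R^-1) ^+ j <= ((m.+1 + N)%:R^-1) ^+ j)%R.
  by apply: inv_shift_decay; rewrite /q; lra.
have V0 : (0 <= Vbound Z)%R.
  rewrite /Vbound; apply: mulr_ge0 => //; apply: addr_ge0 => //.
  by apply: mulr_ge0; [exact: sqr_ge0|exact: zmom_ge0].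
have [C C0 HC] := contraction_decay r0 rq (lexx (0 : R)%R) V0 N0 (HN^~ 4%N ^~ isT).
have VC n : (Vbound Z * rho Z ^+ n <= C * ((n + N)%:R^-1) ^+ 4)%R.
  apply: (HC (fun n => Vbound Z * rho Z ^+ n)%R); first by rewrite expr0 mulr1.
  by move=> m; rewrite mul0r addr0 exprS mulrCA.
have H : {ae P, forall w, cvgn (series (fun n => `|Vf p (T n.+1 u w)|%R))}.
  apply: (@ae_summable _ _ _ P _ (fun n => (C + 1) * ((n + N)%:R^-1) ^+ 2)%R ((C + 1) * 2)%R).
  - move=> n; exact: (mT u (fun t => `|Vf p t|)%R).
  - by move=> n w; exact: normr_ge0.
  - move=> n; set x : R := ((n + N)%:R)%R.
    have x0 : (0 < x)%R by rewrite ltr0n addn_gt0 N0 orbT.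
    have [i2 i1] := square_integrable (mT u (@Vf R p n))
      (le_lt_trans (eq_ind_r (fun z => z <= _) (Vf_sqr EZ_gt1 Z_moments nu_iid n) (E2u u (@Vf R p n))) (ltry _)).
    have ic : P.-integrable setT (fun w : Om => (x^-1 ^+ 2)%:E) by exact: finite_measure_integrable_cst.
    have iV := integrable_scaleR (x ^+ 2) i2.
    (* From (x v - 1/x)^2 >= 0; with x = n + N both terms of the majorant have mean O(n^-2). *)
    apply: (@le_trans _ _ (\int[P]_w (x ^+ 2 * Vf p (T n.+1 u w) ^+ 2 + x^-1 ^+ 2)%:E)).
      apply: ge0_le_integral => //.
      + by apply/measurable_EFinP; exact: (mT u (fun t => `|Vf p t|)%R).
      + apply/measurable_EFinP; exact: (mT u (fun t => x ^+ 2 * Vf p t ^+ 2 + x^-1 ^+ 2)%R).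
      move=> w _; rewrite lee_fin -[(Vf p _ ^+ 2)%R]real_normK ?num_real//.
      have := normr_ge0 (Vf p (T n.+1 u w)); set v := `|_|%R => v0.
      have xx : (x * x^-1 = 1)%R by rewrite mulfV// gt_eqF.
      have := sqr_ge0 (x * v - x^-1)%R.
      have -> : ((x * v - x^-1) ^+ 2 = x ^+ 2 * v ^+ 2 - 2 * (x * x^-1) * v + x^-1 ^+ 2)%R by ring.
      by rewrite xx; lra.
    rewrite (integral_addR iV ic) (integral_scaleR _ i2) (E2u u (@Vf R p n)).
    rewrite (integral_prob_cst P (x^-1 ^+ 2)%:E).
    rewrite mulrDl mul1r [leRHS]EFinD; apply: leeD => //.
    have x20 : 0 <= (x ^+ 2)%:E by rewrite lee_fin sqr_ge0.
    apply: (le_trans (lee_wpmul2l x20 (Vf_sqr EZ_gt1 Z_moments nu_iid n))).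
    rewrite -EFinM lee_fin; apply: le_trans (ler_wpM2l (sqr_ge0 x) (VC n)) _.
    rewrite -/x mulrCA ler_wpM2l// (_ : 4%N = (2 + 2)%N)// exprD mulrA -exprMn.
    by rewrite mulfV ?gt_eqF// expr1n mul1r.
  - move=> M; rewrite -mulr_sumr ler_wpM2l ?addr_ge0//.
    by have := sum_inv_sqr R M N0.
move: H; apply: filterS => w H.
have H' : cvgn (series (fun n => Vf p (T n.+1 u w) : R^o)).
  by apply: normed_cvg; rewrite /= in H.
have E n : Wf p (T n u w) = (1 + series (fun n => Vf p (T n.+1 u w)) n)%R.
  elim: n => [|n IHn]; first by rewrite /series/= big_geq// addr0.
  by rewrite seriesSr /= addrA -IHn VfE addrC subrK.
rewrite (_ : (fun n => _) = (fun n => 1 + series (fun n => Vf p (T n.+1 u w)) n)%R).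
  by apply: is_cvgD; [exact: is_cvg_cst|exact: H'].
by apply/funext => n; exact: E.
Qed.

(** [L] stands for level n, of size p^-n W_n. As the coefficients are at most p^n, the variance is
    at most [Wbound Z] times p^n E W_n = p^n for every k, which is summable in n. The heights k stay
    finite because W(v) is available only as a limit. *)
Lemma ae_level (L : forall n, tr n -> seq (seq nat))
    (c : forall n, tr n -> seq nat -> R) :
  (forall n t, same_depth n (L n t)) ->
  (forall n t, (p ^+ n * (size (L n t))%:R = Wf p t)%R) ->
  (forall n t v, (`|c n t v| <= p ^+ n)%R) ->
  {ae P, forall w, forall y : nat -> R,
    (forall n, (\sum_(v <- L n (T n [::] w)) c n (T n [::] w) v *
       (Wf p (T k v w) - 1))%R @[k --> \oo] --> y n) ->
    y n @[n --> \oo] --> (0%R : R)}.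
Proof.
move=> okL sL cp.
have W0 : (0 <= Wbound Z)%R by apply: le_trans (Wbound_ge1 EZ_gt1 Z_moments).
pose S n k w : R := (\sum_(v <- L n (T n [::] w)) c n (T n [::] w) v *
       (Wf p (T k v w) - 1))%R.
have dT m u : discrete (T m u) by exact: discrete_gw_tree.
have mS n k : measurable_fun setT (S n k).
  apply: (measurable_fun_glue (F := fun t w =>
    (\sum_(v <- L n t) c n t v * (Wf p (T k v w) - 1))%R) (dT n [::])).
  move=> t; apply: measurable_sum => v; apply: measurable_funM; first exact: measurable_cst.
  exact: (mT v (fun t => Wf p t - 1)%R).
have IS n k : \int[P]_w (S n k w ^+ 2)%:E <= (Wbound Z * p ^+ n)%:E.
  have [i2 i1 m1 m2] := Wf_centered EZ_gt1 Z_moments nu_iid k.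
  have a2E : E2 k (fun s => Wf p s - 1)%R = (fine (E2 k (fun s => Wf p s - 1)%R))%:E.
    by rewrite fineK//; exact: integrable_fin_num i2.
  have a2W : (fine (E2 k (fun s => Wf p s - 1)%R) <= Wbound Z)%R by rewrite -lee_fin -a2E.
  have a20 : (0 <= fine (E2 k (fun s => Wf p s - 1)%R))%R.
    by rewrite -lee_fin -a2E; apply: integral_ge0 => w _; rewrite lee_fin sqr_ge0.
  have -> := @level_variance _ _ _ _ _ _ nu_iid n k [::] (L n) (c n)
    (fun s => Wf p s - 1)%R _ (okL n) i1 i2 m1 a2E.
  set a2 := fine _ in a2W a20 *.
  apply: (@le_trans _ _ (\int[P]_w ((Wbound Z * p ^+ n) * Wf p (T n [::] w))%:E)).
    apply: ge0_le_integral => //.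
    - by move=> w _; rewrite lee_fin mulr_ge0// sumr_ge0// => v _; rewrite sqr_ge0.
    - by apply/measurable_EFinP; exact: (mT [::] (fun t => a2 * \sum_(v <- L n t) c n t v ^+ 2)%R).
    - by apply/measurable_EFinP; exact: (mT [::] (fun t => (Wbound Z * p ^+ n) * Wf p t)%R).
    move=> w _; rewrite lee_fin -sL -mulrA; apply: ler_pM => //.
      by apply: sumr_ge0 => v _; rewrite sqr_ge0.
    apply: (@le_trans _ _ (\sum_(v <- L n (T n [::] w)) (p ^+ n * p ^+ n))%R).
      apply: ler_sum => v _; rewrite -[(c n _ v ^+ 2)%R]real_normK ?num_real// -expr2.
      by rewrite ler_sqr ?nnegrE// exprn_ge0// ltW.
    rewrite big_const_seq count_predT iter_addr_0 -mulr_natr.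
    by rewrite le_eqVlt; apply/orP; left; apply/eqP; ring.
  rewrite ge0_integral_scaleR; last 3 first.
  - by rewrite mulr_ge0// exprn_ge0// ltW.
  - exact: (mT [::] (@Wf R p n)).
  - by move=> w; rewrite Wf_ge0// ltW.
  by rewrite (Wf_mean EZ_gt1 Z_moments nu_iid) mule1.
have := @ae_summable_lim _ _ _ P (fun n k w => S n k w ^+ 2)%R
  (fun n => Wbound Z * p ^+ n)%R (Wbound Z * (1 - p)^-1)%R
  (fun n k => measurable_funX 2 (mS n k)) (fun n k w => sqr_ge0 _) IS.
have HS M : (\sum_(n < M) Wbound Z * p ^+ n <= Wbound Z * (1 - p)^-1)%R.
  by rewrite -mulr_sumr ler_wpM2l// sum_geometric_le// ltW.
move=> /(_ HS); apply: filterS => w H y Sy; apply: cvg_sqr0.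
apply: (@cvg_series_cvg_0 _ _ (fun n => (y n ^+ 2)%R : R^o)).
by apply: H => n; rewrite expr2; apply: cvgM; exact: Sy.
Qed.

Lemma Wf_laplace m (x : R) : (0 <= x)%R ->
  exists2 q : R, (0 <= q <= 1)%R &
   E1 m (fun t => expR (- (x * Wf p t)))%R = q%:E.
Proof.
move=> x0; have e01 (t : tr m) : (0 <= expR (- (x * Wf p t)) <= 1)%R.
  by rewrite expR_ge0/= -expR0 ler_expR oppr_le0 mulr_ge0// Wf_ge0// ltW.
have i1 : P.-integrable setT (fun w => (expR (- (x * Wf p (T m [::] w))))%:E).
  apply: (integrable_bounded P (M := 1) (f := fun t => expR (- (x * Wf p t)))%R
    (discrete_gw_tree nu [::])) => t.
  by have /andP[? ?] := e01 t; rewrite ger0_norm.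
exists (fine (E1 m (fun t => expR (- (x * Wf p t)))%R)); last first.
  by rewrite fineK//; exact: integrable_fin_num i1.
rewrite -!lee_fin fineK//; last exact: integrable_fin_num i1.
apply/andP; split.
  by apply: integral_ge0 => w _; rewrite lee_fin expR_ge0.
rewrite -[leRHS](integral_prob_cst P 1); apply: le_integral => //.
  exact: finite_measure_integrable_cst.
by move=> w _; rewrite lee_fin; case/andP: (e01 (T m [::] w)).
Qed.

(** The functional equation of the Laplace transform of W at finite height: phi_(m+1)(mu x) =
    f(phi_m(x)), with f the generating function of Z. *)
Lemma Wf_laplaceS m (x q : R) :
  E1 m (fun t => expR (- (x * Wf p t)))%R = q%:E -> (0 <= q <= 1)%R ->
  E1 m.+1 (fun t => expR (- ((x * mu) * Wf p t)))%R = (zgen Z q)%:E.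
Proof.
move=> Eq q01; rewrite -zgenE//.
rewrite -(@offspring_prod _ _ _ _ _ _ nu_iid m [::]
  (fun t : tr m => expR (- (x * Wf p t)))%R q (fun t => expR_ge0 _) Eq).
apply: eq_integral => w _; congr EFin; set s := gw_tree _ _ _ _.
have -> : ((x * mu) * Wf p s = x * \sum_(t <- (s : seq (tr m))) Wf p t)%R.
  by rewrite /= -mulrA (mulrA mu) (mulrC mu p) pm mul1r.
by rewrite mulr_sumr -sumrN expR_sum.
Qed.

(** As e^-y <= 1/(1 + y) <= 1 - y + y^2 for y >= 0, the transform at x is at most 1 - x + B x^2 with
    B = [Wbound Z]. The minimum is 1 - 1/(4B), at x = 1/(2B). *)
Lemma Wf_laplace_base : exists x s0 : R, [/\ (0 < x)%R, (0 <= s0 < 1)%R &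
  forall m q, E1 m (fun t => expR (- (x * Wf p t)))%R = q%:E -> (q <= s0)%R].
Proof.
have W1 := Wbound_ge1 EZ_gt1 Z_moments; set B := Wbound Z in W1.
have Bi0 : (0 < B^-1)%R by rewrite invr_gt0 (lt_le_trans ltr01).
have Bi : (B * B^-1 = 1)%R by rewrite mulfV// gt_eqF// (lt_le_trans ltr01).
have Bi1 : (B^-1 <= 1)%R by rewrite invf_le1// (lt_le_trans ltr01).
exists (B^-1 / 2)%R, (1 - B^-1 / 4)%R; split.
- by rewrite divr_gt0.
- by apply/andP; split; lra.
move=> m q Eq; rewrite -lee_fin -Eq.
set x := (B^-1 / 2)%R; have x0 : (0 < x)%R by rewrite divr_gt0.
have [i2 i1] := Wf_integrable EZ_gt1 Z_moments nu_iid m.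
have ic : P.-integrable setT (fun w : Om => 1%R%:E) by exact: finite_measure_integrable_cst.
have i1x := integrable_scaleR (- x) i1; have i2x := integrable_scaleR (x ^+ 2) i2.
apply: (@le_trans _ _ (\int[P]_w (1 + (- x * Wf p (T m [::] w) +
   x ^+ 2 * Wf p (T m [::] w) ^+ 2))%:E)).
  apply: ge0_le_integral => //.
  - by apply/measurable_EFinP; exact: (mT [::] (fun t => expR (- (x * Wf p t)))%R).
  - apply/measurable_EFinP.
    exact: (mT [::] (fun t => 1 + (- x * Wf p t + x ^+ 2 * Wf p t ^+ 2))%R).
  move=> w _; rewrite lee_fin; set y := Wf p _.
  have y0 : (0 <= x * y)%R by rewrite mulr_ge0 ?(ltW x0)// Wf_ge0// ltW.
  have z0 : (0 < 1 + x * y)%R by lra.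
  apply: (@le_trans _ _ ((1 + x * y)^-1)%R).
    by rewrite expRN lef_pV2 ?posrE ?expR_gt0// expR_ge1Dx.
  rewrite -[leLHS]mul1r ler_pdivrMr//.
  have -> : ((1 + (- x * y + x ^+ 2 * y ^+ 2)) * (1 + x * y) = 1 + (x * y) ^+ 3)%R by ring.
  by rewrite lerDl exprn_ge0.
rewrite (integral_addR ic (integrable_addR i1x i2x)) (integral_addR i1x i2x).
rewrite (integral_scaleR _ i1) (integral_scaleR _ i2) (Wf_mean EZ_gt1 Z_moments nu_iid).
rewrite (integral_prob_cst P 1%R%:E) mule1.
have x20 : 0 <= (x ^+ 2)%:E by rewrite lee_fin sqr_ge0.
apply: (@le_trans _ _ (1%R%:E + ((- x)%:E + (x ^+ 2)%:E * B%:E))).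
  by rewrite leeD2l// leeD2l// lee_wpmul2l//; exact: Wf_sqr.
rewrite -EFinM -!EFinD lee_fin /x.
have -> : ((B^-1 / 2) ^+ 2 * B = (B * B^-1) * B^-1 / 4)%R by field; rewrite gt_eqF// (lt_le_trans ltr01).
by rewrite Bi; lra.
Qed.

(** On [0, s0] the generating function is at most theta times the identity, so each use of the
    functional equation gains a factor theta while the argument grows by mu. *)
Lemma Wf_laplace_decay : exists x theta : R, [/\ (0 < x)%R, (0 <= theta < 1)%R &
  forall k m, E1 (m + k) (fun t => expR (- ((x * mu ^+ k) * Wf p t)))%R <= (theta ^+ k)%:E].
Proof.
have [x [s0 [x0 /andP[s00 s01] H]]] := Wf_laplace_base.
have q0 := zge2_gt0 Z_ge1 EZ_gt1 Z_moments.
have q1 : (zge2 Z <= 1)%R.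
  rewrite -lee_fin -zge2E -[leRHS](integral_prob_cst P 1); apply: le_integral => //.
  - exact: integrable_zge2.
  - exact: finite_measure_integrable_cst.
  - by move=> w _; rewrite lee_fin; case: (2 <= Z w)%N.
pose theta : R := (1 - zge2 Z * (1 - s0))%R; exists x, theta.
have t01 : (0 <= theta < 1)%R by rewrite /theta; apply/andP; split; nra.
split => // k m; have /andP[t0 t1] := t01.
have m0 : (0 <= mu)%R by apply: ltW; rewrite (lt_trans ltr01)// (mu_gt1 EZ_gt1 Z_moments).
suff [q [q01 Eq qs]] : exists q : R, [/\ (0 <= q <= 1)%R,
   E1 (m + k) (fun t => expR (- ((x * mu ^+ k) * Wf p t)))%R = q%:E &
   (q <= s0 * theta ^+ k)%R].
  rewrite Eq lee_fin; apply: le_trans qs _.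
  by rewrite ler_piMl ?exprn_ge0// ltW.
elim: k => [|k [q [/andP[q0' q1'] Eq qs]]].
  have [q q01 Eq] := Wf_laplace m (ltW x0).
  exists q; rewrite addn0 expr0 !mulr1; split => //; exact: H Eq.
have q01 : (0 <= q <= 1)%R by rewrite q0'.
exists (zgen Z q); split; first exact: zgen_itv.
  by rewrite addnS exprSr mulrA; exact: Wf_laplaceS.
apply: (le_trans (zgen_le Z_ge1 Z_moments q01)).
have qs0 : (q <= s0)%R by apply: le_trans qs _; rewrite ler_piMr// exprn_ile1// ltW.
apply: (@le_trans _ _ (q * theta)%R).
  by rewrite /theta; have : (0 <= zge2 Z * (q * (s0 - q)))%R; [rewrite !mulr_ge0// ?subr_ge0// ltW|lra].
by rewrite exprSr mulrA ler_wpM2r.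
Qed.

(** If W = 0 then e^(- x mu^k W) = 1 for every k, yet these variables have means summable in k and
    hence an almost surely convergent series. The height m + k goes to infinity at fixed k. *)
Lemma ae_Wf_neq0 : {ae P, forall w,
  ~ (Wf p (T n [::] w) @[n --> \oo] --> (0%R : R))}.
Proof.
have [x [theta [x0 t01 H]]] := Wf_laplace_decay.
pose Y k m w : R := expR (- ((x * mu ^+ k) * Wf p (T (m + k) [::] w))).
have mY k m : measurable_fun setT (Y k m).
  exact: (mT [::] (fun t : tr (m + k) => expR (- ((x * mu ^+ k) * Wf p t)))%R).
have := @ae_summable_lim _ _ _ P Y (fun k => theta ^+ k)%R (1 - theta)^-1%R
  mY (fun k m w => expR_ge0 _) H (fun M => sum_geometric_le M t01).
apply: filterS => w HY W0.
have Y1 k : Y k m w @[m --> \oo] --> (1%R : R).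
  rewrite -expR0 -[X in expR X]oppr0 -[X in (- X)%R](mulr0 (x * mu ^+ k)%R).
  apply: (cvg_comp _ expR); last exact: continuous_expR.
  apply: cvgN; apply: cvgMr.
  by have := W0; rewrite -(cvg_shiftn k).
have := @cvg_series_cvg_0 _ _ (fun=> 1%R : R^o) (HY _ Y1).
move=> /(cvg_unique _ (cvg_cst (1%R : R))) => /(_ (@Rhausdorff R))/eqP.
by rewrite oner_eq0.
Qed.

End almost_sure.

(** * Percolation clusters *)

(** With the configuration [fun=> true] this is the whole level [n] below [u]. Absolute words are
    kept so that the edges used below distinct vertices are visibly distinct. *)
Fixpoint cluster (n : nat) (u : seq nat) : tr n -> (seq nat -> bool) -> seq (seq nat) :=
  match n with
  | 0 => fun _ _ => [:: u]
  | n'.+1 => fun s b => flatten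
      [seq if b (rcons u i) then cluster (rcons u i) (nth (tr0 n') s i) b else [::]
      | i <- iota 0 (size (s : seq (tr n')))]
  end.

Fixpoint edges (n : nat) (u : seq nat) : tr n -> seq (seq nat) :=
  match n with
  | 0 => fun _ => [::]
  | n'.+1 => fun s => flatten
      [seq rcons u i :: edges (rcons u i) (nth (tr0 n') s i)
      | i <- iota 0 (size (s : seq (tr n')))]
  end.

Lemma mem_cluster n u (t : tr n) (b : seq nat -> bool) v : v \in cluster u t b ->
  [/\ exists2 x, v = u ++ x & size x = n, v \in cluster u t (fun=> true) &
   forall k, (0 < k <= n)%N -> b (take (size u + k) v)].
Proof.
elim: n u t => [|n IHn] u t /=.
  rewrite inE => /eqP ->; split; first by exists [::]; rewrite ?cats0.
    by rewrite eqxx.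
  by case.
move=> /flattenP[_ /mapP[i it ->]]; case: ifP => // bi.
move=> /[dup] vc /IHn[[x vx sx] vT Hb]; split.
- by exists (i :: x); rewrite /= ?sx// vx cat_rcons.
- apply/flattenP; eexists; last exact: vT.
  by apply/mapP; exists i.
case=> [//|[_|k /andP[_ kn]]].
  rewrite addn1 (_ : take _ v = rcons u i)// vx cat_rcons.
  by rewrite take_cat ltnNge leqnSn /= subSnn /= take0 cats1.
by have := Hb k.+1 kn; rewrite size_rcons addSnnS.
Qed.

(** The bridge between the recursive lists and the path conditions that define vertices and open
    clusters in Ulam-Harris form. *)
Lemma cluster_tree e n u (b : seq nat -> bool) x :
  (u ++ x \in cluster u (tree e n u) b) = (size x == n) &&
    all (fun k => (nth 0%N x k < e (u ++ take k x))%N && b (u ++ take k.+1 x)) (iota 0 n).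
Proof.
elim: n u x => [|n IHn] u x.
  by rewrite /= andbT inE -[X in _ == X]cats0 eqseq_cat// eqxx; case: x.
apply/idP/idP => [/flattenP[_ /mapP[i it ->]]|].
  case: ifP => // bi vc; have [[y] + sy _ _] := mem_cluster vc.
  rewrite cat_rcons => /eqP; rewrite eqseq_cat// eqxx /= => /eqP xE.
  move: vc it; rewrite xE -cat_rcons size_map size_iota mem_iota add0n /= => vc ie.
  move: vc; rewrite (nth_map 0%N) ?size_iota// nth_iota// add0n IHn sy eqxx/=.
  rewrite cats0 ie take0 cats1 bi /= => /allP H.
  rewrite eqxx; apply/allP => k; rewrite mem_iota => /andP[]; case: k => // k _ kn.
  have := H k; rewrite mem_iota add0n /= => /(_ kn).
  by rewrite !cat_rcons.
case: x => [|i x]; first by rewrite andFb.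
rewrite eqSS => /andP[sx /= /andP[/andP[]]].
rewrite cats0 take0 cats1 => ie bi /allP H.
apply/flattenP; eexists.
  by apply/mapP; exists i; last reflexivity; rewrite mem_iota size_map size_iota.
rewrite bi (nth_map 0%N) ?size_iota// nth_iota// add0n -cat_rcons IHn sx.
apply/allP => k; rewrite mem_iota add0n /= => kn.
by have := H k.+1; rewrite mem_iota ltnS /= => /(_ kn); rewrite !cat_rcons.
Qed.

Lemma uniq_cluster n u (t : tr n) (b : seq nat -> bool) : uniq (cluster u t b).
Proof.
elim: n u t => [//|n IHn] u t /=; apply: uniq_flatten_map.
- exact: iota_uniq.
- by move=> i _; case: ifP.
move=> i j x _ _; case: ifP => // _ /mem_cluster[[y xy _] _ _].
case: ifP => // _ /mem_cluster[[z xz _] _ _].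
have : rcons u i ++ y = rcons u j ++ z by rewrite -xy -xz.
by move/catI_size; rewrite !size_rcons => /(_ erefl)/rcons_inj; case.
Qed.

Lemma size_mem_cluster n u (t : tr n) (b : seq nat -> bool) v : v \in cluster u t b ->
  size v = (size u + n)%N.
Proof. by case/mem_cluster => -[x -> sx] _ _; rewrite size_cat sx. Qed.

Lemma same_depth_cluster n u (t : tr n) b : same_depth (size u + n) (cluster u t b).
Proof. by split; [exact: uniq_cluster|exact: size_mem_cluster]. Qed.

Lemma Wf_cluster (R : realType) (p : R) n u (t : tr n) :
  Wf p t = p ^+ n * (size (cluster u t (fun=> true)))%:R.
Proof.
elim: n u t => [|n IHn] u t /=; first by rewrite expr0 mulr1.
rewrite size_flatten /shape -map_comp sumnE big_map natr_sum.
rewrite exprS -mulrA; congr (_ * _).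
rewrite mulr_sumr [LHS](big_nth (tr0 n)) /index_iota subn0.
by apply: eq_bigr => i _ /=; rewrite (IHn (rcons u i)).
Qed.

Lemma cluster_concat e n k (b : seq nat -> bool) u :
  (cluster u (tree e (n + k) u) b != [::]) =
  has (fun v => cluster v (tree e k v) b != [::]) (cluster u (tree e n u) b).
Proof.
have ne (m : nat) (v : seq nat) : (cluster v (tree e m v) b != [::]) <->
    exists x, v ++ x \in cluster v (tree e m v) b.
  split; last by case=> x; case: (cluster _ _ _).
  case E : (cluster v (tree e m v) b) => [//|y s] _.
  have : y \in cluster v (tree e m v) b by rewrite E mem_head.
  by move=> /[dup] yc /mem_cluster[[x yx _] _ _]; exists x; rewrite -yx -E.
apply/idP/hasP => [/ne[x]|[v]].
  rewrite cluster_tree => /andP[/eqP sx /allP H].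
  have sn : size (take n x) = n by rewrite size_takel// sx leq_addr.
  exists (u ++ take n x).
    rewrite cluster_tree sn eqxx/=; apply/allP => j; rewrite mem_iota add0n /= => jn.
    rewrite nth_take// !take_takel//; last exact: ltnW.
    by apply: H; rewrite mem_iota add0n (leq_trans jn)// leq_addr.
  apply/ne; exists (drop n x); rewrite cluster_tree size_drop sx addKn eqxx/=.
  apply/allP => j; rewrite mem_iota add0n /= => jk.
  have tk i : (u ++ take n x) ++ take i (drop n x) = u ++ take (n + i) x.
    by rewrite -catA; congr (_ ++ _); rewrite takeD.
  by rewrite !tk nth_drop addnS; apply: H; rewrite mem_iota add0n ltn_add2l.
move=> /[dup] vc /mem_cluster[[x vx sx] _ _] /ne[y]; rewrite vx in vc *.
move: vc; rewrite !cluster_tree => /andP[_ /allP H1] /andP[/eqP sy /allP H2].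
apply/ne; exists (x ++ y); rewrite cluster_tree size_cat sx sy eqxx/=.
apply/allP => j; rewrite mem_iota add0n /= => jnk.
have [jn|nj] := ltnP j n.
  have := H1 j; rewrite mem_iota add0n => /(_ jn).
  rewrite nth_cat sx jn take_cat sx jn take_cat sx; case: (ltnP j.+1 n) => // nj1.
  have jE : j.+1 = n by apply/eqP; rewrite eqn_leq jn nj1.
  by rewrite jE subnn take0 cats0 -sx take_size.
have jk : (j - n < k)%N by rewrite ltn_subLR.
have := H2 (j - n)%N; rewrite mem_iota add0n => /(_ jk).
have jn' : (j < n)%N = false by rewrite ltnNge nj.
have jn2 : (j.+1 < n)%N = false by rewrite ltnNge (leq_trans nj (leqnSn j)).
by rewrite nth_cat sx jn' take_cat sx jn' take_cat sx jn2 -!catA subSn.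
Qed.

Lemma mem_edges n u (t : tr n) v : v \in edges u t ->
  exists2 x, v = u ++ x & (0 < size x <= n)%N.
Proof.
elim: n u t => [//|n IHn] u t /= /flattenP[_ /mapP[i _ ->]].
rewrite in_cons => /orP[/eqP ->|/IHn[x -> /andP[x0 xn]]].
  by exists [:: i]; rewrite ?cats1.
by exists (i :: x); rewrite ?cat_rcons.
Qed.

Lemma uniq_edges n u (t : tr n) : uniq (edges u t).
Proof.
elim: n u t => [//|n IHn] u t /=; apply: uniq_flatten_map.
- exact: iota_uniq.
- move=> i _ /=; rewrite IHn andbT; apply/negP => /mem_edges[x].
  rewrite -{1}[rcons u i]cats0 => /eqP; rewrite eqseq_cat// => /andP[_ /eqP <-].
  by [].
have pre i x : x \in rcons u i :: edges (rcons u i) (nth (tr0 n) t i) ->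
    exists y, x = rcons u i ++ y.
  rewrite in_cons => /orP[/eqP->|/mem_edges[y -> _]]; last by exists y.
  by exists [::]; rewrite cats0.
move=> i j x _ _ /pre[y xy] /pre[z xz].
have : rcons u i ++ y = rcons u j ++ z by rewrite -xy -xz.
by move/catI_size; rewrite !size_rcons => /(_ erefl)/rcons_inj; case.
Qed.

Lemma cluster_local n u (t : tr n) (b b' : seq nat -> bool) : {in edges u t, b =1 b'} ->
  cluster u t b = cluster u t b'.
Proof.
elim: n u t => [//|n IHn] u t /= bb; congr flatten; apply/eq_in_map => i it.
have sub x : x \in rcons u i :: edges (rcons u i) (nth (tr0 n) t i) -> b x = b' x.
  by move=> xe; apply: bb; apply/flattenP; eexists; [apply/mapP; exists i|exact: xe].
rewrite (sub (rcons u i)) ?mem_head//; case: ifP => // _.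
by apply: IHn => x xe; apply: sub; rewrite in_cons xe orbT.
Qed.

(** * Percolation on a fixed truncated tree *)

Section percolation_probability.
Local Open Scope ereal_scope.
Context {R : realType} d (Om : measurableType d) (Q : probability Om R).
Variables (xi : seq nat -> {RV Q >-> bool}) (p : R).
Hypothesis xi_perc : bernoulli_percolation xi p.

Notation conf w := (fun v : seq nat => xi v w).
Notation EQ F := (\int[Q]_w (F (conf w))%:E).

(** Dependence on finitely many edges makes a function of the configuration a discrete variable, to
    which the product formula for independent variables applies. *)
Definition local_on (E : seq (seq nat)) (F : (seq nat -> bool) -> R) : Prop :=
  forall b b', {in E, b =1 b'} -> F b = F b'.

Lemma local_onM E E' F G : local_on E F -> local_on E' G ->
  local_on (E ++ E') (fun b => F b * G b)%R.
Proof.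
move=> lF lG b b' bb'; rewrite (lF b b') ?(lG b b')// => v vE; apply: bb';
  by rewrite mem_cat vE ?orbT.
Qed.

Let dxi v : discrete (xi v).
Proof.
move=> k; rewrite -[_ @^-1` _]setTI.
exact: (@measurable_funPT _ _ _ _ (xi v) measurableT).
Qed.

Definition decode (E : seq (seq nat)) (s : seq bool) (v : seq nat) : bool :=
  nth false s (index v E).

Let local_decode E F w : local_on E F ->
  F (conf w) = F (decode E [seq xi v w | v <- E]).
Proof.
move=> lF; apply: lF => v vE.
by rewrite /decode (nth_map [::]) ?index_mem// nth_index.
Qed.

Let dmap E : discrete (fun w => [seq xi v w | v <- E]).
Proof. by apply: discrete_map => v; exact: dxi. Qed.

Lemma local_measurable E F : local_on E F ->
  measurable_fun setT (fun w => F (conf w)).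
Proof.
move=> lF; have -> : (fun w => F (conf w)) =
    (fun w => F (decode E [seq xi v w | v <- E])).
  by apply/funext => w; exact: local_decode.
exact: (@discrete_measurable _ _ _ (fun w => [seq xi v w | v <- E]) _ R
  (fun s => F (decode E s)) (dmap E)).
Qed.

Lemma all_open_probability (L : seq (seq nat * bool)) : uniq [seq x.1 | x <- L] ->
  Q [set w | all (fun x => xi x.1 w == x.2) L] =
  \prod_(x <- L) Q (xi x.1 @^-1` [set x.2]).
Proof.
move=> uL; pose L' : seq (seq nat * set bool) := [seq (x.1, [set x.2]) | x <- L].
have := @mutually_independent_list R _ _ Om _ Q _ xi L' xi_perc.1.
rewrite -map_comp => /(_ uL) H.
transitivity (Q [set w | forall x, List.In x L' -> x.2 (xi x.1 w)]).
  congr (Q _); apply/seteqP; split => w /=.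
    move=> + x; rewrite /L'; elim: L {uL L' H} => //= a L IHL /andP[/eqP aw Lw].
    by case=> [<-//|]; exact: IHL.
  rewrite /L'; elim: L {uL L' H} => //= a L IHL Hx; apply/andP; split.
    by apply/eqP; apply: (Hx (a.1, [set a.2])); left.
  by apply: IHL => x xL; apply: Hx; right.
by rewrite H// /L' !big_map.
Qed.

Let map_event E (s : seq bool) : size E = size s ->
  (fun w => [seq xi v w | v <- E]) @^-1` [set s] =
  [set w | all (fun x => xi x.1 w == x.2) (zip E s)].
Proof.
move=> sz; apply/seteqP; split => w /=.
  by move=> <-; elim: E {sz} => //= v E ->; rewrite eqxx.
by elim: E s sz => [|v E IHE] [|a s]//= [sz] /andP[/eqP -> /(IHE _ sz) ->].
Qed.

Let indep_map E E' : uniq (E ++ E') ->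
  indep Q (fun w => [seq xi v w | v <- E]) (fun w => [seq xi v w | v <- E']).
Proof.
move=> uE a b.
have none D (s : seq bool) : size D != size s ->
    (fun w => [seq xi v w | v <- D]) @^-1` [set s] = set0.
  move=> sz; apply/seteqP; split => // w /= ws.
  by move/eqP: sz; apply; rewrite -ws size_map.
have [sa|/none ->] := eqVneq (size E) (size a); last by rewrite set0I measure0 mul0e.
have [sb|/none ->] := eqVneq (size E') (size b); last by rewrite setI0 measure0 mule0.
have z1 D (s : seq bool) : size D = size s -> [seq x.1 | x <- zip D s] = D.
  by move=> sz; apply: unzip1_zip; rewrite sz.
rewrite !map_event//.
have -> : [set w | all (fun x => xi x.1 w == x.2) (zip E a)] `&`
    [set w | all (fun x => xi x.1 w == x.2) (zip E' b)] =
    [set w | all (fun x => xi x.1 w == x.2) (zip E a ++ zip E' b)].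
  by apply/seteqP; split => w /=; rewrite all_cat => /andP.
move: (uE); rewrite cat_uniq => /and3P[u1 _ u2].
rewrite !all_open_probability ?map_cat ?z1// big_cat//.
Qed.

Lemma local_indep E E' F G : uniq (E ++ E') -> local_on E F -> local_on E' G ->
  (forall b, (0 <= F b)%R) -> (forall b, (0 <= G b)%R) ->
  EQ (fun b : seq nat -> bool => F b * G b)%R = EQ F * EQ G.
Proof.
move=> uE lF lG F0 G0.
under eq_integral do rewrite (local_decode _ lF) (local_decode _ lG) EFinM.
rewrite (indep_ge0_integral (dmap E) (dmap E') (indep_map uE)
  (f := fun s => (F (decode E s))%:E) (g := fun s => (G (decode E' s))%:E)).
- by congr (_ * _); apply: eq_integral => w _; rewrite -local_decode.
- by move=> s; rewrite lee_fin.
- by move=> s; rewrite lee_fin.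
Qed.

Lemma local_prod (I : eqType) (s : seq I) (E : I -> seq (seq nat))
    (F : I -> (seq nat -> bool) -> R) (a : I -> R) :
  uniq (flatten [seq E i | i <- s]) ->
  (forall i, local_on (E i) (F i)) -> (forall i b, (0 <= F i b)%R) ->
  (forall i, i \in s -> EQ (F i) = (a i)%:E) ->
  EQ (fun b : seq nat -> bool => \prod_(i <- s) F i b)%R = (\prod_(i <- s) a i)%:E.
Proof.
move=> + lF F0; elim: s => [|i s IHs] /= uE Ea.
  rewrite big_nil -[RHS](integral_prob_cst Q 1).
  by apply: eq_integral => w _; rewrite big_nil.
under eq_integral do rewrite big_cons.
have lP : local_on (flatten [seq E i | i <- s]) (fun b => \prod_(i <- s) F i b)%R.
  elim: (s) => [|j s' IH] /=; first by move=> b b' _; rewrite !big_nil.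
  have := local_onM (lF j) IH => H b b' bb'; rewrite !big_cons; exact: H.
rewrite (local_indep uE (lF i) lP (F0 i)); last by move=> b; exact: prodr_ge0.
rewrite Ea ?mem_head// IHs.
- by rewrite -EFinM big_cons.
- by move: uE; rewrite cat_uniq => /and3P[].
- by move=> j js; apply: Ea; rewrite in_cons js orbT.
Qed.

Let p01 : (0 <= p <= 1)%R.
Proof.
have E := xi_perc.2 [::]; apply/andP; split.
  by rewrite -lee_fin -E; exact: measure_ge0.
by rewrite -lee_fin -E; apply: probability_le1; exact: dxi.
Qed.

Lemma xi_true v : EQ (fun b : seq nat -> bool => (b v)%:R)%R = p%:E.
Proof.
rewrite -(xi_perc.2 v) -(integral_fiber1 Q true (dxi v)).
by apply: eq_integral => w _; case: (xi v w).
Qed.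

Lemma xi_false v : EQ (fun b : seq nat -> bool => (~~ b v)%:R)%R = (1 - p)%:E.
Proof.
have i1 : Q.-integrable setT (fun w => ((xi v w)%:R)%:E).
  apply: (integrable_bounded Q (M := 1) (f := fun c : bool => c%:R)%R (dxi v)) => -[];
  by rewrite ?normr1 ?normr0.
have ic : Q.-integrable setT (fun w : Om => 1%R%:E) by exact: finite_measure_integrable_cst.
transitivity (\int[Q]_w (1 + (-1) * (xi v w)%:R)%:E).
  by apply: eq_integral => w _; congr EFin; case: (xi v w) => /=; ring.
rewrite (integral_addR ic (integrable_scaleR (-1) i1)) (integral_scaleR _ i1).
by rewrite (xi_true v) (integral_prob_cst Q 1%R%:E) -EFinM -EFinD mulN1r.
Qed.

Lemma local_cluster n u (t : tr n) (g : seq (seq nat) -> R) :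
  local_on (edges u t) (fun b => g (cluster u t b)).
Proof. by move=> b b' /cluster_local ->. Qed.

(** Branches below distinct children use disjoint edges, so the expectation is a product. Each
    factor is 1 - p + p E s^|Y|, according to the state of the edge above the child. *)
Lemma cluster_genfun n u (t : tr n) (s : R) : (0 <= s <= 1)%R ->
  EQ (fun b : seq nat -> bool => s ^+ size (cluster u t b))%R = (1 - Gf p (1 - s) t)%:E.
Proof.
move=> /andP[s0 s1]; elim: n u t => [|n IHn] u t.
  rewrite /= opprB addrC subrK -[RHS](integral_prob_cst Q s%:E).
  by apply: eq_integral => w _; rewrite expr1.
pose c i := nth (tr0 n) (t : seq (tr n)) i.
pose F i b : R := if b (rcons u i) then (s ^+ size (cluster (rcons u i) (c i) b))%R else 1%R.
transitivity (EQ (fun b : seq nat -> bool => \prod_(i <- iota 0 (size (t : seq (tr n)))) F i b)%R).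
  apply: eq_integral => w _; congr EFin => /=.
  rewrite size_flatten /shape -map_comp sumnE big_map expr_sum.
  by apply: eq_bigr => i _; rewrite /F /=; case: ifP.
rewrite (@local_prod _ _ (fun i => rcons u i :: edges (rcons u i) (c i)) F
    (fun i => 1 - p * Gf p (1 - s) (c i))%R).
- rewrite /= subKr; congr EFin.
  by rewrite [RHS](big_nth (tr0 n)) /index_iota subn0.
- exact: (uniq_edges u t).
- move=> i b b' bb'; rewrite /F (bb' (rcons u i)) ?mem_head//; case: ifP => // _.
  rewrite (@cluster_local _ _ _ b b')// => v vE; apply: bb'.
  by rewrite in_cons vE orbT.
- by move=> i b; rewrite /F; case: ifP; rewrite ?exprn_ge0.
move=> i it; have G0 b : (0 <= s ^+ size (cluster (rcons u i) (c i) b))%R by rewrite exprn_ge0.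
have l1 (h : bool -> R) : local_on [:: rcons u i] (fun b => h (b (rcons u i))).
  by move=> b b' bb'; rewrite bb'// mem_head.
have lG := @local_cluster _ (rcons u i) (c i) (fun l => s ^+ size l)%R.
have uE : uniq ([:: rcons u i] ++ edges (rcons u i) (c i)).
  rewrite /= uniq_edges andbT; apply/negP => /mem_edges[x].
  rewrite -{1}[rcons u i]cats0 => /eqP; rewrite eqseq_cat// => /andP[_ /eqP <-].
  by [].
transitivity (EQ (fun b : seq nat -> bool => (b (rcons u i))%:R *
    s ^+ size (cluster (rcons u i) (c i) b))%R + EQ (fun b : seq nat -> bool => (~~ b (rcons u i))%:R)%R).
  rewrite -ge0_integralD//.
  - apply: eq_integral => w _; rewrite -EFinD /F; congr EFin.
    by case: (xi (rcons u i) w); rewrite ?mul1r ?addr0 ?mul0r ?add0r.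
  - by move=> w _; rewrite lee_fin mulr_ge0.
  - apply/measurable_EFinP.
    exact: (local_measurable (local_onM (l1 (fun c => c%:R)%R) lG)).
  - apply/measurable_EFinP.
    exact: (local_measurable (l1 (fun c => (~~ c)%:R)%R)).
rewrite (local_indep uE (l1 (fun c => c%:R)%R) lG)//.
rewrite (xi_true (rcons u i)) IHn xi_false -EFinM -EFinD; congr EFin.
by ring.
Qed.

(** The case s = 0, since [0 ^+ size l] is the indicator of the empty list. *)
Lemma cluster_survival n u (t : tr n) :
  EQ (fun b : seq nat -> bool => (cluster u t b != [::])%:R)%R = (Gf p 1 t)%:E.
Proof.
have s0 : (0 <= (0 : R) <= 1)%R by rewrite lexx ler01.
have := cluster_genfun u t s0; rewrite subr0 => H.
have i1 : Q.-integrable setT (fun w => (0 ^+ size (cluster u t (conf w)))%:E).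
  apply/integrableP; split.
    apply/measurable_EFinP.
    exact: (local_measurable (@local_cluster _ u t (fun l => 0 ^+ size l)%R)).
  apply: le_lt_trans (ltry (1 - Gf p 1 t)); rewrite -H.
  rewrite le_eqVlt; apply/orP; left; apply/eqP; apply: eq_integral => w _.
  by rewrite gee0_abs// lee_fin exprn_ge0.
have ic : Q.-integrable setT (fun w : Om => 1%R%:E) by exact: finite_measure_integrable_cst.
transitivity (\int[Q]_w (1 + (-1) * 0 ^+ size (cluster u t (conf w)))%:E).
  apply: eq_integral => w _; congr EFin.
  by case: (cluster u t (conf w)) => [|x l] /=; rewrite ?expr0 ?exprS ?mul0r; ring.
rewrite (integral_addR ic (integrable_scaleR (-1) i1)) (integral_scaleR _ i1).
by rewrite H (integral_prob_cst Q 1%R%:E) -EFinM -EFinD; congr EFin; ring.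
Qed.

(** All [n] edges on the path to [v] have to be open. *)
Lemma mem_cluster_le n (t : tr n) v :
  EQ (fun b : seq nat -> bool => (v \in cluster [::] t b)%:R)%R <= (p ^+ n)%:E.
Proof.
have [sv|sv] := eqVneq (size v) n; last first.
  rewrite (eq_integral (cst 0)) ?integral0 ?lee_fin ?exprn_ge0//; first by case/andP: p01.
  move=> w _; case E : (v \in cluster [::] t (conf w)) => //.
  move: E => /size_mem_cluster sv'.
  by move/eqP: sv; rewrite sv'.
pose L := [seq (take k.+1 v, true) | k <- iota 0 n].
have uL : uniq [seq x.1 | x <- L].
  rewrite -map_comp map_inj_in_uniq ?iota_uniq// => i j /=.
  rewrite !mem_iota add0n => /= i_n j_n /(congr1 size).
  by rewrite !size_takel ?sv// => -[].
have dL : discrete (fun w => all (fun x => xi x.1 w == x.2) L).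
  rewrite (_ : (fun w => _) = (fun s : seq bool => all (fun x => x) s) \o
     (fun w => [seq xi v w | v <- [seq x.1 | x <- L]])).
    by apply: discrete_comp; exact: dmap.
  apply/funext => w /=; rewrite -map_comp all_map; apply: eq_in_all => x.
  by move=> /mapP[k _ ->] /=; case: (xi _ _).
apply: (@le_trans _ _ (\int[Q]_w ((all (fun x => xi x.1 w == x.2) L == true)%:R)%:E)).
  apply: ge0_le_integral => //.
  - apply/measurable_EFinP.
    exact: (local_measurable (@local_cluster _ [::] t (fun l => (v \in l)%:R)%R)).
  - apply/measurable_EFinP.
    exact: (@discrete_measurable _ _ _ _ _ R (fun c : bool => (c == true)%:R)%R dL).
  move=> w _; rewrite lee_fin ler_nat; case E : (v \in cluster [::] t (conf w)) => //.
  move: E => /mem_cluster[_ _ Hb]; rewrite eqb_id (_ : all _ _ = true)//.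
  apply/allP => x /mapP[k + ->]; rewrite mem_iota add0n => /= kn.
  by rewrite /= (Hb k.+1).
rewrite (integral_fiber1 Q true dL).
rewrite (_ : _ @^-1` _ = [set w | all (fun x => xi x.1 w == x.2) L])//.
rewrite all_open_probability// /L big_map.
under eq_bigr do rewrite xi_perc.2.
by rewrite prodEFin big_const_seq count_predT size_iota iter_mulr_1.
Qed.

End percolation_probability.

Lemma has_prod (R : realFieldType) (I : Type) (s : seq I) (c : pred I) :
  1 - \prod_(i <- s) (1 - (c i)%:R) = (has c s)%:R :> R.
Proof.
elim: s => [|i s IHs] /=; first by rewrite big_nil subrr.
rewrite big_cons; case: (c i) => /=; first by rewrite subrr mul0r subr0.
by rewrite subr0 mul1r.
Qed.

Lemma cvg_sum_seq (R : realType) (I : Type) (s : seq I) (F : I -> nat -> R) (a : I -> R) :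
  (forall i, F i k @[k --> \oo] --> a i) ->
  \sum_(i <- s) F i k @[k --> \oo] --> \sum_(i <- s) a i.
Proof.
move=> Fa; elim: s => [|i s IHs].
  rewrite big_nil (_ : (fun k => _) = cst 0); first exact: cvg_cst.
  by apply/funext => k; rewrite big_nil.
rewrite big_cons (_ : (fun k => _) = (fun k => F i k + \sum_(j <- s) F j k)).
  by apply: cvgD; [exact: Fa|exact: IHs].
by apply/funext => k; rewrite big_cons.
Qed.

(** * Survival to a large depth, weighted by an early level *)

Section percolation_coefficients.
Local Open Scope ereal_scope.
Context {R : realType} d (Om : measurableType d) (Q : probability Om R).
Variables (xi : seq nat -> {RV Q >-> bool}) (p : R).
Hypothesis xi_perc : bernoulli_percolation xi p.

Notation conf w := (fun v : seq nat => xi v w).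
Notation EQ F := (\int[Q]_w (F (conf w))%:E).

Definition coef (s : R) n (t : tr n) v : R :=
  fine (EQ (fun b : seq nat -> bool =>
    s ^+ size (cluster [::] t b) * (v \in cluster [::] t b)%:R)%R).

Let lc n u (t : tr n) (g : seq (seq nat) -> R) :
  local_on (edges u t) (fun b => g (cluster u t b)).
Proof. exact: local_cluster. Qed.

Let mlc n u (t : tr n) (g : seq (seq nat) -> R) :
  measurable_fun setT (fun w => g (cluster u t (conf w))).
Proof.
exact: (@local_measurable _ _ _ _ xi (edges u t) (fun b => g (cluster u t b)) (@lc n u t g)).
Qed.

Section fixed_s.
Variable s : R.
Hypothesis s01 : (0 <= s <= 1)%R.

Let s_ge0 k : (0 <= s ^+ k)%R. Proof. by rewrite exprn_ge0//; case/andP: s01. Qed.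
Let s_le1 k : (s ^+ k <= 1)%R. Proof. by case/andP: s01 => *; rewrite exprn_ile1. Qed.

Lemma coef_bound n (t : tr n) v :
  EQ (fun b : seq nat -> bool =>
    s ^+ size (cluster [::] t b) * (v \in cluster [::] t b)%:R)%R <= (p ^+ n)%:E.
Proof.
apply: le_trans (mem_cluster_le xi_perc t v); apply: ge0_le_integral => //.
- by move=> w _; rewrite lee_fin mulr_ge0.
- by apply/measurable_EFinP; exact: (mlc [::] t (fun l => s ^+ size l * (v \in l)%:R)%R).
- by apply/measurable_EFinP; exact: (mlc [::] t (fun l => (v \in l)%:R)%R).
by move=> w _; rewrite lee_fin ler_piMl.
Qed.

Lemma coefE n (t : tr n) v :
  EQ (fun b : seq nat -> bool =>
    s ^+ size (cluster [::] t b) * (v \in cluster [::] t b)%:R)%R = (coef s t v)%:E.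
Proof.
rewrite fineK// ge0_fin_numE; first exact: le_lt_trans (coef_bound t v) (ltry _).
by apply: integral_ge0 => w _; rewrite lee_fin mulr_ge0.
Qed.

Lemma coef_itv n (t : tr n) v : (0 <= coef s t v <= p ^+ n)%R.
Proof.
rewrite -!lee_fin -coefE coef_bound andbT.
by apply: integral_ge0 => w _; rewrite lee_fin mulr_ge0.
Qed.

Lemma coef_sum n (t : tr n) :
  EQ (fun b : seq nat -> bool =>
    (size (cluster [::] t b))%:R * s ^+ size (cluster [::] t b))%R =
  (\sum_(v <- cluster [::] t (fun=> true)) coef s t v)%:E.
Proof.
rewrite -sumEFin; under [RHS]eq_bigr do rewrite -coefE.
rewrite -ge0_integral_sum//.
- apply: eq_integral => w _; rewrite sumEFin; congr EFin.
  rewrite -mulr_sumr mulrC; congr (_ * _)%R.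
  rewrite -natr_sum; congr (_%:R)%R.
  rewrite -big_mkcond /= sum1_count -size_filter; apply: perm_size.
  apply: uniq_perm; [exact: uniq_cluster|by rewrite filter_uniq ?uniq_cluster|].
  move=> v; rewrite mem_filter; apply/idP/andP => [vc|[]//].
  by split => //; case: (mem_cluster vc).
- move=> v; apply/measurable_EFinP.
  exact: (mlc [::] t (fun l => s ^+ size l * (v \in l)%:R)%R).
- by move=> v w _; rewrite lee_fin mulr_ge0.
Qed.

(** Survival to depth n + k is the union over level n of the events that v is reached and that the
    cluster from v has depth k. Bonferroni is applied pointwise and then integrated; the two
    conditions on v concern disjoint sets of edges. *)
Lemma survival_coef_bound (e : seq nat -> nat) n k :
  exists2 a : R, EQ (fun b : seq nat -> bool =>
      s ^+ size (cluster [::] (tree e n [::]) b) *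
      (cluster [::] (tree e (n + k) [::]) b != [::])%:R)%R = a%:E &
  let l := cluster [::] (tree e n [::]) (fun=> true) in
  (0 <= \sum_(v <- l) coef s (tree e n [::]) v * Gf p 1 (tree e k v) - a <=
    \sum_(z <- pairs l) Gf p 1 (tree e k z.1) * Gf p 1 (tree e k z.2))%R.
Proof.
set t := tree e n [::]; set l := cluster _ t _.
pose A (b : seq nat -> bool) : R := (s ^+ size (cluster [::] t b))%R.
pose X v (b : seq nat -> bool) : R := ((v \in cluster [::] t b)%:R)%R.
pose S v (b : seq nat -> bool) := cluster v (tree e k v) b != [::].
pose H (b : seq nat -> bool) : R := ((cluster [::] (tree e (n + k) [::]) b != [::])%:R)%R.
have mA : measurable_fun setT (fun w => A (conf w)) by exact: (mlc [::] t (fun l => s ^+ size l)%R).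
have mX v : measurable_fun setT (fun w => X v (conf w)) by exact: (mlc [::] t (fun l => (v \in l)%:R)%R).
have mS v : measurable_fun setT (fun w => (S v (conf w))%:R : R)%R.
  exact: (mlc v (tree e k v) (fun l => (l != [::])%:R)%R).
have mH : measurable_fun setT (fun w => H (conf w)).
  exact: (mlc [::] (tree e (n + k) [::]) (fun l => (l != [::])%:R)%R).
have A01 b : (0 <= A b <= 1)%R by rewrite /A s_ge0 s_le1.
have A0 b : (0 <= A b)%R by case/andP: (A01 b).
have lsz v : v \in l -> size v = n by move/size_mem_cluster.
pose F b : R := (A b * H b)%R.
pose G b : R := (\sum_(v <- l) A b * X v b * (S v b)%:R)%R.
(* The pair term forgets whether the two vertices are reached, which leaves independent survival
   events in disjoint subtrees. *)
pose D b : R := (\sum_(z <- pairs l) (S z.1 b)%:R * (S z.2 b)%:R)%R.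
have HG b : (0 <= G b - F b <= D b)%R.
  pose c v := (v \in cluster [::] t b) && S v b.
  have HE : H b = ((has c l)%:R)%R.
    rewrite /H cluster_concat -/t; congr ((nat_of_bool _)%:R)%R.
    apply/hasP/hasP => [[v vc Sv]|[v _ /andP[vc Sv]]]; last by exists v.
    by exists v; [case: (mem_cluster vc)|rewrite /c vc].
  have x01 (v : seq nat) : (0 <= ((c v)%:R : R) <= 1)%R by case: (c v); rewrite ?lexx ?ler01.
  have := prod_one_sub l x01; rewrite has_prod -HE => /andP[h1 h2].
  have GE : G b = (A b * \sum_(v <- l) (c v)%:R)%R.
    rewrite mulr_sumr; apply: eq_bigr => v _.
    by rewrite /X /c -mulrA; congr (_ * _)%R; rewrite -natrM mulnb.
  have cD : (\sum_(z <- pairs l) (c z.1)%:R * (c z.2)%:R <= D b)%R.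
    apply: ler_sum => z _; apply: ler_pM => //; rewrite ler_nat /c.
      by case: (_ \in _); case: (S _ _).
    by case: (_ \in _); case: (S _ _).
  have /andP[a0 a1] := A01 b.
  rewrite GE /F -mulrBr; apply/andP; split; first by rewrite mulr_ge0.
  apply: le_trans (le_trans h2 cD).
  by rewrite ler_piMl.
have mF : measurable_fun setT (fun w => F (conf w)) by exact: measurable_funM.
have mG : measurable_fun setT (fun w => G (conf w)).
  apply: measurable_sum => v; apply: measurable_funM => //; exact: measurable_funM.
have mD : measurable_fun setT (fun w => D (conf w)).
  by apply: measurable_sum => z; apply: measurable_funM.
have F0 b : (0 <= F b)%R by rewrite mulr_ge0.
have EF : EQ F = (fine (EQ F))%:E.
  rewrite fineK// ge0_fin_numE; last by apply: integral_ge0 => w _; rewrite lee_fin.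
  apply: (@le_lt_trans _ _ 1); last exact: ltry.
  rewrite -[leRHS](integral_prob_cst Q 1); apply: ge0_le_integral => //.
  - by move=> w _; rewrite lee_fin.
  - exact/measurable_EFinP.
  move=> w _; rewrite lee_fin /F; have /andP[a0 a1] := A01 (conf w).
  by apply: mulr_ile1 => //; rewrite /H lern1 leq_b1.
have EG : EQ G = (\sum_(v <- l) coef s t v * Gf p 1 (tree e k v))%:E.
  under eq_integral do rewrite -sumEFin.
  rewrite ge0_integral_sum//; last 2 first.
  - by move=> v; apply/measurable_EFinP; apply: measurable_funM => //; exact: measurable_funM.
  - by move=> v w _; rewrite lee_fin !mulr_ge0.
  rewrite -sumEFin !big_seq; apply: eq_bigr => v vl.
  have uE : uniq (edges [::] t ++ edges v (tree e k v)).
    rewrite cat_uniq !uniq_edges andbT /=; apply/hasPn => x /mem_edges[y -> /andP[y0 _]].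
    apply/negP => /mem_edges[z /= zE /andP[_ zn]].
    have := congr1 size zE; rewrite size_cat lsz// => nz.
    by move: zn; rewrite -nz leqNgt -[X in (X < _)%N]addn0 ltn_add2l y0.
  rewrite (@local_indep _ _ _ _ _ _ xi_perc _ _ (fun b => A b * X v b)%R
    (fun b => (S v b)%:R)%R uE).
  - by rewrite coefE EFinM (cluster_survival xi_perc).
  - exact: (@lc _ [::] t (fun l => s ^+ size l * (v \in l)%:R)%R).
  - exact: (@lc _ v (tree e k v) (fun l => (l != [::])%:R)%R).
  - by move=> b; rewrite mulr_ge0.
  - by [].
have ED : EQ D = (\sum_(z <- pairs l) Gf p 1 (tree e k z.1) * Gf p 1 (tree e k z.2))%:E.
  under eq_integral do rewrite -sumEFin.
  rewrite ge0_integral_sum//; last first.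
    by move=> v; apply/measurable_EFinP; apply: measurable_funM.
  rewrite -sumEFin !big_seq; apply: eq_bigr => -[v v'] /mem_pairs.
  move=> /(_ (uniq_cluster _ _ _))[vl vl' vv'] /=.
  have uE : uniq (edges v (tree e k v) ++ edges v' (tree e k v')).
    rewrite cat_uniq !uniq_edges andbT /=; apply/hasPn => x /mem_edges[y -> _].
    apply/negP => /mem_edges[z zE _]; move/negP: vv'; apply.
    by apply/eqP; apply/esym; apply: catI_size zE; rewrite (lsz v vl) (lsz v' vl').
  rewrite (@local_indep _ _ _ _ _ _ xi_perc _ _ (fun b => (S v b)%:R)%R
    (fun b => (S v' b)%:R)%R uE)//.
  - by rewrite EFinM !(cluster_survival xi_perc).
  - exact: (@lc _ v (tree e k v) (fun l => (l != [::])%:R)%R).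
  - exact: (@lc _ v' (tree e k v') (fun l => (l != [::])%:R)%R).
exists (fine (EQ F)) => //=.
have G0 b : (0 <= G b)%R by case/andP: (HG b) => h _; have := F0 b; lra.
have D0 b : (0 <= D b)%R by apply: sumr_ge0 => z _; rewrite mulr_ge0.
apply/andP; split.
  rewrite subr_ge0 -lee_fin -EF -EG; apply: ge0_le_integral => //.
  - by move=> w _; rewrite lee_fin.
  - exact/measurable_EFinP.
  - exact/measurable_EFinP.
  by move=> w _; rewrite lee_fin; case/andP: (HG (conf w)); lra.
rewrite lerBlDr -lee_fin EFinD -EF -EG -ED -ge0_integralD//.
- apply: ge0_le_integral => //.
  + by move=> w _; rewrite lee_fin.
  + exact/measurable_EFinP.
  + by apply: emeasurable_funD; exact/measurable_EFinP.
  by move=> w _; rewrite -EFinD lee_fin; case/andP: (HG (conf w)); lra.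
- by move=> w _; rewrite lee_fin.
- exact/measurable_EFinP.
- by move=> w _; rewrite lee_fin.
- exact/measurable_EFinP.
Qed.

(** A pair contributes a product of two probabilities of order 1/M, which vanishes after
    multiplication by M. Level n is finite, so the main term converges summand by summand. *)
Lemma survival_coef_cvg (e : seq nat -> nat) (lam : R) (W : seq nat -> R) n :
  (forall v, (k%:R * Gf p 1 (tree e k v))%R @[k --> \oo] --> (lam * W v)%R) ->
  (M%:R * fine (EQ (fun b : seq nat -> bool =>
      s ^+ size (cluster [::] (tree e n [::]) b) *
      (cluster [::] (tree e M [::]) b != [::])%:R)))%R @[M --> \oo] -->
  (lam * \sum_(v <- cluster [::] (tree e n [::]) (fun=> true)) coef s (tree e n [::]) v * W v)%R.
Proof.
move=> Wcvg.
have g0 v : Gf p 1 (tree e k v) @[k --> \oo] --> (0 : R)%R.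
  have h : ((k%:R * Gf p 1 (tree e k v)) * k%:R^-1)%R @[k --> \oo] --> (lam * W v * 0)%R.
    by apply: cvgM; [exact: Wcvg|exact: cvg_inv_nat].
  rewrite mulr0 in h; apply: cvg_trans h; apply: near_eq_cvg; near=> k.
  by rewrite mulrAC mulfV ?mul1r// pnatr_eq0 -lt0n; near: k; exists 1%N.
(* The factor is the full depth n + k; replacing it by k is harmless because the survival
   probability itself tends to 0. *)
have nk v : ((n + k)%:R * Gf p 1 (tree e k v))%R @[k --> \oo] --> (lam * W v)%R.
  rewrite (_ : (fun k => _) = (fun k => n%:R * Gf p 1 (tree e k v) + k%:R * Gf p 1 (tree e k v)))%R; last first.
    by apply/funext => k; rewrite natrD mulrDl.
  rewrite -[X in _ --> X]add0r -[X in _ --> (X + _)%R](mulr0 n%:R).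
  by apply: cvgD; [apply: cvgM; [exact: cvg_cst|exact: g0]|exact: Wcvg].
set l := cluster _ _ _.
pose u (M : nat) : R := (M%:R * fine (EQ (fun b : seq nat -> bool =>
  s ^+ size (cluster [::] (tree e n [::]) b) *
  (cluster [::] (tree e M [::]) b != [::])%:R)))%R.
suff : u (k + n)%N @[k --> \oo] -->
    (lam * \sum_(v <- l) coef s (tree e n [::]) v * W v)%R.
  by rewrite (cvg_shiftn n u).
have main : ((n + k)%:R * \sum_(v <- l) coef s (tree e n [::]) v * Gf p 1 (tree e k v))%R @[k --> \oo] -->
    (lam * \sum_(v <- l) coef s (tree e n [::]) v * W v)%R.
  rewrite mulr_sumr (_ : (fun k => _) = (fun k => \sum_(v <- l) (coef s (tree e n [::]) v *
      ((n + k)%:R * Gf p 1 (tree e k v))))%R); last first.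
    apply/funext => k; rewrite mulr_sumr; apply: eq_bigr => v _; exact: mulrCA.
  rewrite (eq_bigr (fun v => coef s (tree e n [::]) v * (lam * W v))%R); last first.
    by move=> v _; exact: mulrCA.
  by apply: cvg_sum_seq => v; apply: cvgM; [exact: cvg_cst|exact: nk].
have err : ((n + k)%:R * \sum_(z <- pairs l) Gf p 1 (tree e k z.1) * Gf p 1 (tree e k z.2))%R @[k --> \oo] --> (0 : R)%R.
  rewrite (_ : (fun k => _) = (fun k => \sum_(z <- pairs l)
      ((n + k)%:R * Gf p 1 (tree e k z.1)) * Gf p 1 (tree e k z.2))%R); last first.
    by apply/funext => k; rewrite mulr_sumr; apply: eq_bigr => z _; exact: mulrA.
  rewrite -[X in _ --> X](_ : (\sum_(z <- pairs l) (lam * W z.1) * 0)%R = 0%R).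
    by apply: cvg_sum_seq => z; apply: cvgM; [exact: nk|exact: g0].
  by rewrite big1// => z _; rewrite mulr0.
have low : ((n + k)%:R * (\sum_(v <- l) coef s (tree e n [::]) v * Gf p 1 (tree e k v)) -
    (n + k)%:R * (\sum_(z <- pairs l) Gf p 1 (tree e k z.1) * Gf p 1 (tree e k z.2)))%R
    @[k --> \oo] --> (lam * \sum_(v <- l) coef s (tree e n [::]) v * W v)%R.
  by rewrite -[X in _ --> X]subr0; exact: cvgB main err.
apply: squeeze_cvgr low main; apply: nearW => k; rewrite [(k + n)%N]addnC.
have [a Ea /andP[h1 h2]] := survival_coef_bound e n k; rewrite /= -/l in h1 h2 *.
have -> : u (n + k)%N = ((n + k)%:R * a)%R by rewrite /u Ea.
have nk0 : (0 <= (n + k)%:R :> R)%R by [].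
apply/andP; split; last by rewrite ler_wpM2l//; lra.
by rewrite -mulrBr ler_wpM2l//; lra.
Unshelve. all: by end_near. Qed.

End fixed_s.
End percolation_coefficients.

(** * From Laplace transforms to weak convergence *)

Section bernstein.
Context {R : realType}.
Implicit Types (g : nat -> R) (h : R -> R) (u c : R).

(* The Bernstein operator: the expectation of g at a binomial variable with
   parameters n and u. *)
Fixpoint bernstein n g u : R :=
  if n is m.+1 then u * bernstein m (g \o S) u + (1 - u) * bernstein m g u
  else g 0%N.

Lemma bernstein_poly n g : exists q : {poly R}, forall u, bernstein n g u = q.[u].
Proof.
elim: n g => [|n IHn] g; first by exists (g 0%N)%:P => u; rewrite hornerC.
have [q1 q1E] := IHn (g \o S); have [q2 q2E] := IHn g.
exists ('X * q1 + (1 - 'X) * q2) => u /=.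
by rewrite !hornerE q1E q2E.
Qed.

Lemma bernsteinB n g c u : bernstein n (fun k => g k - c) u = bernstein n g u - c.
Proof. by elim: n g => [//|n IHn] g /=; rewrite (IHn (g \o S)) IHn; ring. Qed.

Lemma bernstein_le n g1 g2 u : 0 <= u <= 1 -> (forall k, `|g1 k| <= g2 k) ->
  `|bernstein n g1 u| <= bernstein n g2 u.
Proof.
move=> /andP[u0 u1]; elim: n g1 g2 => [|n IHn] g1 g2 le12 /=; first exact: le12.
have v0 : 0 <= 1 - u by lra.
apply: le_trans (ler_normD _ _) _; rewrite !normrM (ger0_norm u0) (ger0_norm v0).
by apply: lerD; apply: ler_wpM2l => //; apply: IHn => k /=.
Qed.

(** The centre [c] is left free because the recursion shifts it by 1; at c = n u what remains is the
    binomial variance. *)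
Lemma bernstein_sqr n (a b : R) c u :
  bernstein n (fun k => a + b * (k%:R - c) ^+ 2) u =
  a + b * ((n%:R * u - c) ^+ 2 + n%:R * u * (1 - u)).
Proof.
elim: n c => [|n IHn] c /=; first by ring.
rewrite IHn (_ : _ \o S = fun k => a + b * (k%:R - (c - 1)) ^+ 2); last first.
  by apply/funext => k /=; rewrite -natr1; ring.
by rewrite IHn -natr1; ring.
Qed.

(** Only [u] is confined to [0, 1]: [bernstein_le] asks for a comparison at every index k, so the
    points k/n with k > n must be covered too. *)
Lemma uniformly_continuous_itv h (e : R) : continuous h -> 0 < e ->
  exists2 dl, 0 < dl & forall u x, 0 <= u <= 1 -> `|x - u| < dl -> `|h x - h u| < e.
Proof.
move=> ch e0.
have := (@segment_compact R 0 1); rewrite compact_near_coveringP => cov.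
have := @cov R (0^'+)
  (fun dl u => forall x, `|x - u| < dl -> `|h x - h u| < e).
have H : forall u0, `[0, 1]%classic u0 -> \forall u' \near u0 & dl \near 0^'+,
    forall x, `|x - u'| < dl -> `|h x - h u'| < e.
  move=> u0 _.
  have e2 : 0 < e / 2 by rewrite divr_gt0.
  have := ch u0; move/cvgrPdist_lt => /(_ _ e2)/nbhs_ballP[et /= et0 Het].
  have et2 : 0 < et / 2 by rewrite divr_gt0.
  exists (ball u0 (et / 2), [set dl | dl < et / 2]) => /=.
    by split; [exact: nbhsx_ballx|exact: nbhs_right_lt].
  move=> [u' dl] /= [bu' dlt] x xu'.
  have h1 : `|h u0 - h u'| < e / 2.
    apply: Het => /=; apply: lt_trans bu' _; lra.
  have h2 : `|h u0 - h x| < e / 2.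
    apply: Het => /=; rewrite /ball /= in bu' *.
    have -> : u0 - x = (u0 - u') - (x - u') by ring.
    by apply: le_lt_trans (ler_normB _ _) _; lra.
  have -> : h x - h u' = (h u0 - h u') - (h u0 - h x) by ring.
  by apply: le_lt_trans (ler_normB _ _) _; lra.
move=> /(_ _ H) near0.
have := nbhs_right_gt (0 : R) => gt0.
have [dl [dl0 Hdl]] := filter_ex (filterI gt0 near0).
exists dl => // u x u01; apply: Hdl => /=.
by rewrite in_itv.
Qed.

Lemma weierstrass h (B e : R) : continuous h -> (forall x, `|h x| <= B) -> 0 < e ->
  exists q : {poly R}, forall u, 0 <= u <= 1 -> `|h u - q.[u]| <= e.
Proof.
move=> ch hB e0; have e2 : 0 < e / 2 by rewrite divr_gt0.
have [dl dl0 Hdl] := uniformly_continuous_itv ch e2.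
have B0 : 0 <= B by apply: le_trans (hB 0).
(* Within distance [dl] the oscillation is at most e/2, beyond it at most 2B <= C (x - u)^2; the sum
   of both bounds holds everywhere. *)
pose C := 2 * B / dl ^+ 2.
have C0 : 0 <= C by rewrite divr_ge0 ?mulr_ge0// ltW.
have hC u x : 0 <= u <= 1 -> `|h x - h u| <= e / 2 + C * (x - u) ^+ 2.
  move=> u01; have [lt|ge] := ltP `|x - u| dl.
    by apply: le_trans (ltW (Hdl u x u01 lt)) _; rewrite lerDl mulr_ge0// sqr_ge0.
  apply: (@le_trans _ _ (2 * B)).
    by apply: le_trans (ler_normB _ _) _; have := hB x; have := hB u; lra.
  rewrite -[leLHS]add0r; apply: lerD; first exact: ltW.
  rewrite /C mulrAC ler_pdivlMr ?exprn_gt0//.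
  by rewrite ler_wpM2l ?mulr_ge0// -[leRHS]real_normK ?num_real// lerXn2r ?nnegrE// ltW.
(* Brings C/n, which bounds the binomial mean of the quadratic term, below e/2. *)
pose n := (Num.truncn (2 * C / e)).+1.
have n0 : 0 < n%:R :> R by rewrite ltr0n.
have Cn : C / n%:R <= e / 2.
  have := truncnS_gt (2 * C / e); rewrite -/n => H.
  rewrite ltr_pdivrMr// in H.
  by rewrite ler_pdivrMr//; lra.
have [q qE] := bernstein_poly n (fun k => h (k%:R / n%:R)).
exists q => u u01; rewrite -qE distrC -bernsteinB.
have := @bernstein_le n (fun k => h (k%:R / n%:R) - h u)
   (fun k => e / 2 + (C / n%:R ^+ 2) * (k%:R - n%:R * u) ^+ 2) u u01.
have H k : `|h (k%:R / n%:R) - h u| <= e / 2 + C / n%:R ^+ 2 * (k%:R - n%:R * u) ^+ 2.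
  rewrite [X in _ <= _ + X](_ : _ = C * (k%:R / n%:R - u) ^+ 2); first exact: hC.
  by field; rewrite gt_eqF.
move=> /(_ H) /le_trans; apply.
rewrite bernstein_sqr subrr expr0n /= add0r.
rewrite [X in _ + X](_ : _ = C / n%:R * (u * (1 - u))); last first.
  by field; rewrite gt_eqF.
have /andP[u0 u1] := u01.
have uu : u * (1 - u) <= 1 by nra.
have Cn0 : 0 <= C / n%:R by rewrite divr_ge0// ltW.
have := ler_wpM2l Cn0 uu; lra.
Qed.

End bernstein.

(** * Convergence of means from Laplace transforms at integers *)

Section laplace_transforms.
Context {R : realType}.
Implicit Types (f g : R -> R) (L : (R -> R) -> R).

Definition bounded_continuous f : Prop :=
  continuous f /\ exists B : R, forall x : R, `|f x| <= B.

(* The expectation of functions of a nonnegative random variable. *)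
Definition mean_functional L : Prop :=
  [/\ L (cst 1) = 1,
      forall a f g, bounded_continuous f -> bounded_continuous g ->
        L (fun x => a * f x + g x) = a * L f + L g &
      forall f g, bounded_continuous f -> bounded_continuous g ->
        (forall x : R, 0 <= x -> f x <= g x) -> L f <= L g].

(** The absolute value keeps the function bounded on the whole line, as test functions must be, and
    is invisible to laws on [0, oo). *)
Definition laplace_fun (i : nat) (x : R) : R := expR (- (i%:R * `|x|)).

Lemma continuous_cst (c : R) : continuous (fun _ : R => c).
Proof. by move=> x; exact: cvg_cst. Qed.

Lemma bounded_continuous_cst c : bounded_continuous (fun=> c).
Proof. by split; [exact: continuous_cst|exists `|c|]. Qed.

Lemma bounded_continuousD f g : bounded_continuous f -> bounded_continuous g ->
  bounded_continuous (fun x => f x + g x).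
Proof.
move=> [cf [B fB]] [cg [C gC]]; split.
  by move=> x; apply: cvgD; [exact: cf|exact: cg].
by exists (B + C) => x; apply: le_trans (ler_normD _ _) _; exact: lerD.
Qed.

Lemma bounded_continuousM f g : bounded_continuous f -> bounded_continuous g ->
  bounded_continuous (fun x => f x * g x).
Proof.
move=> [cf [B fB]] [cg [C gC]]; split.
  by move=> x; apply: cvgM; [exact: cf|exact: cg].
by exists (B * C) => x; rewrite normrM; exact: ler_pM.
Qed.

Lemma laplace_fun_gt0 i x : 0 < laplace_fun i x.
Proof. exact: expR_gt0. Qed.

Lemma laplace_fun_le1 i x : laplace_fun i x <= 1.
Proof. by rewrite -expR0 ler_expR oppr_le0 mulr_ge0. Qed.

Lemma laplace_funE i x : laplace_fun i x = laplace_fun 1 x ^+ i.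
Proof. by rewrite -expRM_natl mulrN mul1r. Qed.

Lemma bounded_continuous_laplace i : bounded_continuous (laplace_fun i).
Proof.
split.
  move=> x; apply: (@continuous_comp _ _ _ (fun y : R => - (i%:R * `|y|)) expR).
    apply: cvgN; apply: cvgM; first exact: cvg_cst.
    by apply: cvg_norm.
  exact: continuous_expR.
by exists 1 => x; rewrite ger0_norm ?laplace_fun_le1 ?ltW ?laplace_fun_gt0.
Qed.

Lemma bounded_continuous_poly (q : {poly R}) :
  bounded_continuous (fun x => q.[laplace_fun 1 x]).
Proof.
elim/poly_ind: q => [|q c IHq].
  rewrite (_ : (fun x => _) = fun=> 0); first exact: bounded_continuous_cst.
  by apply/funext => x; rewrite horner0.
rewrite (_ : (fun x => _) = fun x => q.[laplace_fun 1 x] * laplace_fun 1 x + c).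
  apply: bounded_continuousD (bounded_continuous_cst _).
  exact: bounded_continuousM (bounded_continuous_laplace _).
by apply/funext => x; rewrite !hornerE.
Qed.

Lemma mean_poly L (q : {poly R}) : mean_functional L ->
  L (fun x => q.[laplace_fun 1 x]) = \sum_(i < size q) q`_i * L (laplace_fun i).
Proof.
move=> [L1 LD _].
have L0 : L (fun=> 0) = 0.
  have := LD 1 (fun=> 0) (fun=> 0) (bounded_continuous_cst _) (bounded_continuous_cst _).
  rewrite (_ : (fun x : R => _) = fun=> 0).
    by move=> H; move/eqP: H; rewrite mul1r -subr_eq subrr => /eqP.
  by apply/funext => x; rewrite mulr0 addr0.
transitivity (L (fun x => \sum_(i < size q) q`_i * laplace_fun i x)).
  congr L; apply/funext => x; rewrite horner_coef; apply: eq_bigr => i _.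
  by rewrite -laplace_funE.
have bc (s : seq 'I_(size q)) :
    bounded_continuous (fun x => \sum_(i <- s) q`_i * laplace_fun i x).
  elim: s => [|i s IHs].
    rewrite (_ : (fun x => _) = fun=> 0); first exact: bounded_continuous_cst.
    by apply/funext => x; rewrite big_nil.
  rewrite (_ : (fun x => _) = fun x => q`_i * laplace_fun i x +
      \sum_(i <- s) q`_i * laplace_fun i x).
    apply: bounded_continuousD IHs.
    exact: bounded_continuousM (bounded_continuous_cst _) (bounded_continuous_laplace _).
  by apply/funext => x; rewrite big_cons.
elim: (index_enum _) => [|i s IHs].
  rewrite big_nil -[RHS]L0; congr L; apply/funext => x; exact: big_nil.
rewrite big_cons -IHs -LD//; last exact: bounded_continuous_laplace.
by congr L; apply/funext => x; rewrite big_cons.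
Qed.

Lemma mean_poly_cvg (L_ : nat -> (R -> R) -> R) L (q : {poly R}) :
  (\forall n \near \oo, mean_functional (L_ n)) -> mean_functional L ->
  (forall i, L_ n (laplace_fun i) @[n --> \oo] --> L (laplace_fun i)) ->
  L_ n (fun x => q.[laplace_fun 1 x]) @[n --> \oo] --> L (fun x => q.[laplace_fun 1 x]).
Proof.
move=> mL_ mL LL; rewrite (mean_poly _ mL).
have := @cvg_sum_seq R _ (index_enum 'I_(size q)) (fun i n => q`_i * L_ n (laplace_fun i))
  (fun i => q`_i * L (laplace_fun i)).
move=> /(_ (fun i => cvgM (cvg_cst _) (LL i))).
apply: cvg_trans; apply: near_eq_cvg; apply: filterS mL_ => n mLn.
by rewrite (mean_poly _ mLn).
Qed.

(** f(- ln u) may oscillate as u decreases to 0; as f is bounded, the factor 1 - (1 - u)^N, which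
    vanishes at 0, restores continuity. *)
Lemma continuous_cutoff f (N : nat) : bounded_continuous f ->
  continuous (fun u : R => if u <= 0 then 0 else f (- ln u) * (1 - (1 - u) ^+ N)).
Proof.
move=> [cf [B fB]] u.
have cN v : {for v, continuous (fun v : R => 1 - (1 - v) ^+ N)}.
  apply: cvgB; first exact: cvg_cst.
  apply: (@continuous_comp _ _ _ (fun v : R => 1 - v) (fun v => v ^+ N)).
    by apply: cvgB; [exact: cvg_cst|exact: cvg_id].
  exact: exprn_continuous.
have [u0|u0|u0] := ltgtP u 0.
- apply: cvg_near_cst; near=> v.
  have v0 : v < 0 by near: v; exact: lt_nbhsl.
  by rewrite (ltW v0) (ltW u0).
- have H : (fun v => f (- ln v) * (1 - (1 - v) ^+ N)) v @[v --> u] -->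
      f (- ln u) * (1 - (1 - u) ^+ N).
    apply: cvgM; last exact: cN.
    apply: (@continuous_comp _ _ _ (fun v : R => - ln v) f); last exact: cf.
    by apply: cvgN; exact: continuous_ln.
  rewrite /continuous_at (leNgt u) u0 /=; apply: cvg_trans H; apply: near_eq_cvg; near=> v.
  have v0 : 0 < v by near: v; exact: lt_nbhsr.
  by rewrite leNgt v0.
- rewrite u0 /continuous_at lexx.
  have H : (fun v => B * `|1 - (1 - v) ^+ N|) v @[v --> (0 : R)] --> (0 : R).
    rewrite -[X in _ --> X](_ : B * `|1 - (1 - 0) ^+ N| = 0).
      apply: cvgM; first exact: cvg_cst.
      exact: cvg_norm (cN 0).
    by rewrite subr0 expr1n subrr normr0 mulr0.
  have Hm : (fun v => - (B * `|1 - (1 - v) ^+ N|)) v @[v --> (0 : R)] --> (0 : R).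
    by rewrite -[X in _ --> X]oppr0; exact: cvgN.
  apply: squeeze_cvgr Hm H; apply: nearW => v; rewrite -ler_norml.
  case: ifP => _; last by rewrite normrM ler_wpM2r.
  by rewrite normr0 mulr_ge0//; apply: le_trans (fB 0).
Unshelve. all: by end_near. Qed.

(* On [0, oo), f is within B (1 - e^-x)^N of f (1 - (1 - e^-x)^N), which is a
   continuous function of e^-x in [0, 1] and hence almost a polynomial in it. *)
Lemma laplace_approx f (B : R) (N : nat) (e : R) : continuous f -> (forall x, `|f x| <= B) -> 0 < e ->
  exists q : {poly R}, forall x, 0 <= x ->
    `|f x - q.[laplace_fun 1 x]| <= e + B * (1 - laplace_fun 1 x) ^+ N.
Proof.
move=> cf fB e0.
pose h (u : R) : R := if u <= 0 then 0 else f (- ln u) * (1 - (1 - u) ^+ N).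
(* The cut at 1 makes the function bounded on the whole line, as [weierstrass] demands, without
   changing it for u <= 1. *)
have ch : continuous (fun u : R => h (Num.min 1 u)).
  move=> u; apply: (@continuous_comp _ _ _ (fun u : R => Num.min 1 u) h).
    by apply: (@continuous_min _ _ (cst 1) id); [exact: cvg_cst|exact: cvg_id].
  by apply: continuous_cutoff; split; [exact: cf|exists B].
have c01 N' (v : R) : 0 <= v <= 1 -> 0 <= (1 - v) ^+ N' <= 1.
  by move=> v01; rewrite exprn_ge0 ?exprn_ile1//; lra.
have hB (u : R) : `|h (Num.min 1 u)| <= B.
  have B0 : 0 <= B by apply: le_trans (fB 0).
  rewrite /h; set v := Num.min 1 u; case: (leP v 0) => [_|v0]; first by rewrite normr0.
  have v1 : v <= 1 by rewrite /v ge_min lexx.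
  have := c01 N v; rewrite (ltW v0) v1 => /(_ isT) c.
  rewrite normrM -[leRHS]mulr1; apply: ler_pM => //.
  by rewrite ger0_norm; lra.
have [q Hq] := weierstrass ch hB e0; exists q => x x0.
set u := laplace_fun 1 x.
have u0 : 0 < u by exact: laplace_fun_gt0.
have u1 : u <= 1 by exact: laplace_fun_le1.
have := Hq u; rewrite (ltW u0) u1 => /(_ isT); rewrite min_r// /h (leNgt u) u0 /=.
have -> : - ln u = x by rewrite /u /laplace_fun expRK mul1r opprK ger0_norm.
move=> H; have := c01 N u; rewrite (ltW u0) u1 => /(_ isT)/andP[c0 c1].
have -> : f x - q.[u] = (f x * (1 - (1 - u) ^+ N) - q.[u]) + f x * (1 - u) ^+ N by ring.
apply: le_trans (ler_normD _ _) _; apply: lerD => //.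
by rewrite normrM (ger0_norm c0) ler_wpM2r.
Qed.

(** The approximation is not uniform at infinity. Its error B (1 - e^-x)^N has small mean under [L]
    by the tail hypothesis, and under [L_ n] by convergence, being itself a polynomial in e^-x. *)
Lemma laplace_cvg (L_ : nat -> (R -> R) -> R) L f :
  (\forall n \near \oo, mean_functional (L_ n)) -> mean_functional L ->
  (forall i, L_ n (laplace_fun i) @[n --> \oo] --> L (laplace_fun i)) ->
  L (fun x => (1 - laplace_fun 1 x) ^+ N) @[N --> \oo] --> 0 ->
  bounded_continuous f -> L_ n f @[n --> \oo] --> L f.
Proof.
move=> mL_ mL LL tail bcf; have [cf [B fB]] := bcf.
have B0 : 0 <= B by apply: le_trans (fB 0).
have gap M q N (e : R) : mean_functional M ->
    (forall x : R, 0 <= x -> `|f x - q.[laplace_fun 1 x]| <= e + B * (1 - laplace_fun 1 x) ^+ N) ->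
    `|M f - M (fun x => q.[laplace_fun 1 x])| <=
      e + B * M (fun x => (1 - laplace_fun 1 x) ^+ N).
  move=> [M1 MD Mle] H.
  have bcN : bounded_continuous (fun x => (1 - laplace_fun 1 x) ^+ N).
    have := bounded_continuous_poly ((1 - 'X) ^+ N); congr bounded_continuous.
    by apply/funext => x; rewrite !hornerE.
  have bcq := bounded_continuous_poly q.
  have bcE : bounded_continuous (fun x => B * (1 - laplace_fun 1 x) ^+ N + e).
    apply: bounded_continuousD (bounded_continuous_cst _).
    exact: bounded_continuousM (bounded_continuous_cst _) bcN.
  have Me : M (fun=> e) = e.
    transitivity (M (fun x => (e - 1) * cst 1 x + cst 1 x)).
      by congr M; apply/funext => x; rewrite /= mulr1 subrK.
    rewrite (MD (e - 1) _ _ (bounded_continuous_cst _) (bounded_continuous_cst _)) M1.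
    by rewrite mulr1 subrK.
  have ME : M (fun x => B * (1 - laplace_fun 1 x) ^+ N + e) =
      e + B * M (fun x => (1 - laplace_fun 1 x) ^+ N).
    by rewrite (MD B _ _ bcN (bounded_continuous_cst e)) Me; exact: addrC.
  have bcS g : bounded_continuous g -> bounded_continuous (fun x =>
      1 * g x + (B * (1 - laplace_fun 1 x) ^+ N + e)).
    move=> bg; apply: bounded_continuousD bcE.
    exact: bounded_continuousM (bounded_continuous_cst _) bg.
  have up g1 g2 : bounded_continuous g1 -> bounded_continuous g2 ->
      (forall x, 0 <= x -> g1 x - g2 x <= e + B * (1 - laplace_fun 1 x) ^+ N) ->
      M g1 - M g2 <= e + B * M (fun x => (1 - laplace_fun 1 x) ^+ N).
    move=> b1 b2 H12; rewrite -ME lerBlDr addrC.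
    have := MD 1 g2 (fun x => B * (1 - laplace_fun 1 x) ^+ N + e) b2 bcE.
    rewrite mul1r => <-; apply: Mle => //; first exact: bcS.
    by move=> x x0; have := H12 x x0; lra.
  rewrite ler_norml; apply/andP; split.
    rewrite lerNl opprB; apply: up => // x x0.
    by apply: le_trans (ler_norm _) _; rewrite distrC; exact: H.
  by apply: up => // x x0; apply: le_trans (ler_norm _) _; exact: H.
apply/cvgrPdist_lt => e e0.
(* Six errors of size e/8 add up at the end. *)
have e8 : 0 < e / 8 by rewrite divr_gt0.
have tB : B * L (fun x => (1 - laplace_fun 1 x) ^+ N) @[N --> \oo] --> 0.
  by rewrite -[X in _ --> X](mulr0 B); apply: cvgM tail; exact: cvg_cst.
have [N Ntail] : exists N, B * L (fun x => (1 - laplace_fun 1 x) ^+ N) < e / 8.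
  move/cvgrPdist_lt: tB => /(_ _ e8) H; have [N] := filter_ex H.
  by rewrite sub0r normrN => /(le_lt_trans (ler_norm _)); exists N.
have [q qf] := laplace_approx N cf fB e8.
have cq := @mean_poly_cvg _ _ q mL_ mL LL.
have tE : (fun x => ((1 - 'X) ^+ N : {poly R}).[laplace_fun 1 x]) =
    (fun x => (1 - laplace_fun 1 x) ^+ N).
  by apply/funext => x; rewrite !hornerE.
have cN := @mean_poly_cvg _ _ ((1 - 'X) ^+ N) mL_ mL LL.
rewrite tE in cN.
have cNB : B * L_ n (fun x => (1 - laplace_fun 1 x) ^+ N) @[n --> \oo] -->
    B * L (fun x => (1 - laplace_fun 1 x) ^+ N).
  by apply: cvgM cN; exact: cvg_cst.
move/cvgrPdist_lt: cNB => /(_ _ e8) nN.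
move/cvgrPdist_lt: cq => /(_ _ e8) nq.
near=> n.
have mn : mean_functional (L_ n) by near: n.
have h1 := gap _ _ _ _ mL qf.
have h2 := gap _ _ _ _ mn qf.
have h3 : `|L (fun x => q.[laplace_fun 1 x]) - L_ n (fun x => q.[laplace_fun 1 x])| < e / 8 by near: n.
have h4 : `|B * L (fun x => (1 - laplace_fun 1 x) ^+ N) - B * L_ n (fun x => (1 - laplace_fun 1 x) ^+ N)| < e / 8 by near: n.
move: h1 h2 h3 h4; rewrite ltr_norml ltr_norml !ler_norml ltr_norml.
move=> /andP[] ? ? /andP[] ? ? /andP[] ? ? /andP[] ? ?; apply/andP; split; lra.
Unshelve. all: by end_near. Qed.

End laplace_transforms.

(* m is a finite measure of mass 1 on [0, oo), as far as integrals of bounded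
   continuous functions can tell. *)
Definition nonneg_law {R : realType} (m : set (measurableTypeR R) -> \bar R) : Prop :=
  mean_functional (fun f => fine (\int[m]_x (f x)%:E)) /\
  forall f : R -> R, bounded_continuous f -> (\int[m]_x (f x)%:E)%E \is a fin_num.

(** * Image measures with a density *)

Section weighted_law.
Local Open Scope ereal_scope.
Context {R : realType} d (T : measurableType d) (mu : {measure set T -> \bar R}).
Variables (X : T -> measurableTypeR R) (h : T -> R).
Hypothesis mX : measurable_fun setT X.
Hypothesis mh : measurable_fun setT h.
Hypothesis h_ge0 : forall w, (0 <= h w)%R.
Variable m : set (measurableTypeR R) -> \bar R.
Hypothesis m_ge0 : forall A, 0 <= m A.
(** The common form of the laws at hand: [h] is 1 for a law, the normalized indicator of the
    condition for a conditional law, and the density itself when [X] is the identity. *)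
Hypothesis mE : forall A, measurable A -> m A = \int[mu]_(w in X @^-1` A) (h w)%:E.

Let mXA A : measurable A -> measurable (X @^-1` A).
Proof. by move=> mA; rewrite -[X in measurable X]setTI; exact: mX. Qed.

Let m0 : m set0 = 0.
Proof. by rewrite mE// preimage_set0 integral_set0. Qed.

Let m_sigma_additive : semi_sigma_additive m.
Proof.
move=> /= F mF tF mUF; rewrite mE//.
rewrite (_ : (fun n => _) = (fun n => \sum_(0 <= i < n) \int[mu]_(w in X @^-1` (F i)) (h w)%:E)); last first.
  by apply/funext => n; apply: eq_bigr => i _; rewrite mE.
rewrite preimage_bigcup ge0_integral_bigcup//=.
- apply: cvg_toP => //; apply: ereal_nondecreasing_is_cvgn => k n kn.
  apply: lee_sum_nneg_natr => // i _ _; apply: integral_ge0 => /= x _.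
  by rewrite lee_fin.
- by move=> i; exact: mXA.
- by apply/measurable_EFinP; exact: measurable_funTS.
- by move=> w _; rewrite lee_fin.
- move=> i j _ _ [w [Fi Fj]]; apply: (tF i j Logic.I Logic.I); by exists (X w).
Qed.

(** Laws are bare set functions in the theorem. Packed as a measure, [m] can be used with
    convergence theorems, and integrals against [M] and [m] are convertible. *)
Let m_mixin := isMeasure.Build _ _ _ m m0 m_ge0 m_sigma_additive.
Let M : {measure set (measurableTypeR R) -> \bar R} := HB.pack m m_mixin.

Import HBNNSimple.

Let integral_nnsfun (g : {nnsfun (measurableTypeR R) >-> R}) :
  \int[M]_x (g x)%:E = \int[mu]_w ((g (X w))%:E * (h w)%:E).
Proof.
under [LHS]eq_integral do rewrite fimfunE -fsumEFin//.
rewrite ge0_integral_fsum//; last 2 first.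
  - by move=> r; exact/measurable_EFinP/measurable_funM.
  - by move=> r x _; rewrite nnfun_muleindic_ge0.
under [RHS]eq_integral.
  move=> w _; rewrite fimfunE -fsumEFin// ge0_mule_fsuml; last first.
    by move=> r; exact: nnfun_muleindic_ge0.
  over.
rewrite ge0_integral_fsum//; last 2 first.
- move=> r; apply: emeasurable_funM; last exact/measurable_EFinP.
  apply/measurable_EFinP/measurable_funM => //.
  by apply: (@measurableT_comp _ _ _ _ _ _ (\1_(g @^-1` [set r]) : _ -> R) _ X).
- by move=> r w _; rewrite mule_ge0// ?nnfun_muleindic_ge0// lee_fin.
apply: eq_fsbigr => r _; rewrite integralZl_indic_nnsfun// integral_indic//= setIT mE//.
rewrite integral_mkcond.
under [RHS]eq_integral do rewrite EFinM -muleA.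
have [r0|r0] := ltP r 0%R.
  rewrite preimage_nnfun0// !integral0_eq ?mule0//.
    by move=> w _; rewrite indic0 mul0e mule0.
  by move=> w _; rewrite patchE /= in_set0.
rewrite ge0_integralZl//.
- congr (_ * _); apply: eq_integral => w _; rewrite patchE indicE.
  have -> : (w \in X @^-1` (g @^-1` [set r])) = (X w \in g @^-1` [set r]).
    by apply/idP/idP; rewrite !inE.
  by case: (_ \in _); rewrite ?mul1e ?mul0e.
- apply: emeasurable_funM; last exact/measurable_EFinP.
  apply/measurable_EFinP.
  by apply: (@measurableT_comp _ _ _ _ _ _ (\1_(g @^-1` [set r]) : _ -> R) _ X).
- by move=> w _; rewrite mule_ge0// lee_fin.
Qed.

Lemma weighted_ge0_integral (f : measurableTypeR R -> \bar R) :
  measurable_fun setT f -> (forall x, 0 <= f x) ->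
  \int[m]_x f x = \int[mu]_w (f (X w) * (h w)%:E).
Proof.
move=> mf f0; pose f_ := nnsfun_approx measurableT mf.
change (\int[M]_x f x = \int[mu]_w (f (X w) * (h w)%:E)).
transitivity (limn (fun n => \int[M]_x (f_ n x)%:E)).
  rewrite -monotone_convergence//.
  - apply: eq_integral => x _; apply/esym/cvg_lim => //.
    by apply: cvg_nnsfun_approx => // y _; exact: f0.
  - by move=> n; exact/measurable_EFinP/measurable_funP.
  - by move=> n x _; rewrite lee_fin.
  - by move=> x _ a b ab; rewrite lee_fin; exact/lefP/nd_nnsfun_approx.
under eq_fun do rewrite integral_nnsfun.
rewrite -monotone_convergence//.
- apply: eq_integral => w _; apply/cvg_lim => //.
  apply: cvgeZr => //.
  by apply: cvg_nnsfun_approx => // y _; exact: f0.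
- move=> n; apply: emeasurable_funM; last exact/measurable_EFinP.
  apply/measurable_EFinP.
  by apply: (@measurableT_comp _ _ _ _ _ _ (f_ n : _ -> R) _ X).
- by move=> n w _; rewrite mule_ge0// lee_fin.
- move=> w _ a b ab; rewrite lee_wpmul2r// lee_fin//.
  by exact/lefP/nd_nnsfun_approx.
Qed.

Lemma weighted_integral (f : R -> R) : measurable_fun setT f ->
  \int[m]_x (f x)%:E = \int[mu]_w (f (X w) * h w)%:E.
Proof.
move=> mf.
have mF (g : R -> R) : measurable_fun setT g -> (forall x, (0 <= g x)%R) ->
    \int[m]_x (g x)%:E = \int[mu]_w (g (X w) * h w)%:E.
  move=> mg g0; rewrite (@weighted_ge0_integral (EFin \o g)).
  - by [].
  - exact/measurable_EFinP.
  - by move=> x; rewrite /= lee_fin.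
change (\int[M]_x (f x)%:E = \int[mu]_w (f (X w) * h w)%:E).
rewrite [LHS]integralE [RHS]integralE; congr (_ - _).
- transitivity (\int[M]_x (Num.max (f x) 0)%:E).
    by apply: eq_integral => x _; rewrite funeposE EFin_max.
  rewrite [LHS](mF (fun x => Num.max (f x) 0)%R).
  + apply: eq_integral => w _.
    by rewrite funeposE maxr_pMl// mul0r EFin_max.
  + by apply: measurable_maxr => //.
  + by move=> x; rewrite le_max lexx orbT.
- transitivity (\int[M]_x (Num.max (- f x) 0)%:E).
    by apply: eq_integral => x _; rewrite funenegE EFin_max.
  rewrite [LHS](mF (fun x => Num.max (- f x) 0)%R).
  + apply: eq_integral => w _.
    by rewrite funenegE maxr_pMl// mul0r EFin_max mulNr.
  + by apply: measurable_maxr => //; exact: measurableT_comp.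
  + by move=> x; rewrite le_max lexx orbT.
Qed.

Hypothesis h1 : \int[mu]_w (h w)%:E = 1.

Lemma weighted_integrable (f : R -> R) : bounded_continuous f ->
  mu.-integrable setT (fun w => (f (X w) * h w)%:E).
Proof.
move=> [cf [B fB]].
have mf : measurable_fun setT (fun w => f (X w)).
  exact: measurableT_comp (continuous_measurable_fun cf) mX.
have B0 : (0 <= B)%R by apply: le_trans (fB 0%R).
apply/integrableP; split; first by apply/measurable_EFinP; exact: measurable_funM.
apply: (@le_lt_trans _ _ (\int[mu]_w (B%:E * (h w)%:E))).
  apply: ge0_le_integral => //.
  - by apply/measurableT_comp => //; apply/measurable_EFinP; exact: measurable_funM.
  - by apply: emeasurable_funM => //; exact/measurable_EFinP.
  move=> w _; rewrite -EFinM lee_fin normrM (ger0_norm (h_ge0 w)).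
  by rewrite ler_wpM2r.
rewrite ge0_integralZl//.
- by rewrite h1 mule1 ltry.
- exact/measurable_EFinP.
- by move=> w _; rewrite lee_fin.
Qed.

Hypothesis h_nneg : forall w, (X w < 0)%R -> h w = 0%R.

Lemma weighted_nonneg_law : nonneg_law m.
Proof.
have EF f : bounded_continuous f -> \int[m]_x (f x)%:E = \int[mu]_w (f (X w) * h w)%:E.
  by move=> [cf _]; apply: weighted_integral; exact: continuous_measurable_fun.
have EF' f : bounded_continuous f -> \int[m]_x (f x)%:E \is a fin_num.
  by move=> bf; rewrite EF//; apply: integrable_fin_num => //; exact: weighted_integrable.
split => //; split.
- rewrite EF; last exact: bounded_continuous_cst.
  by under eq_integral do rewrite /= mul1r; rewrite h1.
- move=> a f g bf bg.
  have baf := bounded_continuousM (bounded_continuous_cst a) bf.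
  rewrite EF; last exact: bounded_continuousD.
  rewrite -[RHS]/(fine (a * fine (\int[m]_x (f x)%:E) + fine (\int[m]_x (g x)%:E))%:E).
  congr fine; rewrite EFinD EFinM !fineK ?EF'// !EF//.
  rewrite -integralZl//; last exact: weighted_integrable.
  rewrite -integralD//; last 2 first.
  + by apply: integrableZl => //; exact: weighted_integrable.
  + exact: weighted_integrable.
  by apply: eq_integral => w _; rewrite -EFinM -EFinD mulrDl mulrA.
- move=> f g bf bg fg; apply: fine_le; rewrite ?EF'// !EF//.
  apply: le_integral => //; try exact: weighted_integrable.
  move=> w _; rewrite lee_fin; have [/h_nneg ->|X0] := ltP (X w) 0%R.
    by rewrite !mulr0.
  by rewrite ler_wpM2r// fg.
Qed.

(** Dominated convergence with majorant [h]: 1 - e^-|X| is less than 1 at every point, so its powers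
    vanish. *)
Lemma weighted_tail :
  fine (\int[m]_x ((1 - laplace_fun 1 x) ^+ N)%:E) @[N --> \oo] --> (0%R : R).
Proof.
have bN N : bounded_continuous (fun x : R => (1 - laplace_fun 1 x) ^+ N)%R.
  have := bounded_continuous_poly ((1 - 'X)%R ^+ N : {poly R}); congr bounded_continuous.
  by apply/funext => x; rewrite !hornerE.
have u01 x : (0 <= 1 - @laplace_fun R 1 x < 1)%R.
  by rewrite subr_ge0 laplace_fun_le1 ltrBlDr ltrDl laplace_fun_gt0.
have ih : mu.-integrable setT (EFin \o h).
  apply: eq_integrable (weighted_integrable (bounded_continuous_cst 1)) => //.
  by move=> w _; rewrite mul1r.
have H : \int[mu]_w ((1 - laplace_fun 1 (X w)) ^+ N * h w)%:E @[N --> \oo] -->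
    \int[mu]_w (cst 0 w).
  apply: (@dominated_cvg _ _ _ _ _ _ _ _ (EFin \o h)) => //.
  - move=> N; apply/measurable_EFinP; apply: measurable_funM => //.
    apply: (@measurableT_comp _ _ _ _ _ _ (fun x : R => (1 - laplace_fun 1 x) ^+ N)%R) => //.
    by apply: continuous_measurable_fun; case: (bN N).
  - move=> w _; apply/fine_cvgP; split; first exact: nearW.
    rewrite (_ : _ \o _ = (fun N => (1 - laplace_fun 1 (X w)) ^+ N * h w)%R)//.
    rewrite -[X in _ --> X](mul0r (h w)); apply: cvgM; last exact: cvg_cst.
    apply: cvg_expr; have /andP[u0 u1] := u01 (X w).
    by rewrite ger0_norm.
  - move=> N w _; rewrite lee_fin normrM (ger0_norm (h_ge0 w)) ler_piMl//.
    have /andP[u0 u1] := u01 (X w).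
    by rewrite ger0_norm ?exprn_ge0// exprn_ile1// ltW.
rewrite integral0 in H; move/fine_cvgP: H => [_]; apply: cvg_trans.
apply: near_eq_cvg; apply: nearW => N /=.
by rewrite (@weighted_integral (fun x => (1 - laplace_fun 1 x) ^+ N)%R)//;
  apply: continuous_measurable_fun; case: (bN N).
Qed.

End weighted_law.

(** The laws [m_ n] are constrained only eventually, because conditioning makes sense once the
    condition has positive probability. *)
Lemma weak_cvg_laplace {R : realType} (m_ : nat -> set (measurableTypeR R) -> \bar R)
    (m : set (measurableTypeR R) -> \bar R) :
  (\forall n \near \oo, nonneg_law (m_ n)) -> nonneg_law m ->
  (forall i, fine (\int[m_ n]_x (laplace_fun i x)%:E) @[n --> \oo] -->
             fine (\int[m]_x (laplace_fun i x)%:E)) ->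
  fine (\int[m]_x ((1 - laplace_fun 1 x) ^+ N)%:E) @[N --> \oo] --> (0 : R) ->
  weakly_converges m_ m.
Proof.
move=> nm_ [mm fm] lc tail f cf [B [_ fB]].
have bf : bounded_continuous f.
  split => //; exists (B + 1) => x; apply: (fB _ _ x) => //; lra.
rewrite -(fineK (fm _ bf)); apply/fine_cvgP; split.
  by apply: filterS nm_ => n [_ fmn]; exact: fmn.
apply: (@laplace_cvg _ (fun n g => fine (\int[m_ n]_x (g x)%:E))
  (fun g => fine (\int[m]_x (g x)%:E)) f) => //.
by apply: filterS nm_ => n [].
Qed.

(** * Laws and conditional laws of nonnegative variables *)

Section conditional_laws.
Local Open Scope ereal_scope.
Context {R : realType} d (Om : measurableType d) (Q : probability Om R).
Variable X : Om -> measurableTypeR R.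
Hypothesis mX : measurable_fun setT X.
Hypothesis X_ge0 : forall w, (0 <= X w :> R)%R.

Let lawE A : measurable A -> law Q X A = \int[Q]_(w in X @^-1` A) (cst 1%R w)%:E.
Proof.
move=> mA; rewrite -[LHS]mul1e; apply/esym; apply: (integral_cst Q _ 1).
by rewrite -[X in measurable X]setTI; exact: mX.
Qed.

Lemma law_nonneg : nonneg_law (law Q X).
Proof.
apply: (@weighted_nonneg_law _ _ _ Q X (cst 1%R)) => //.
- exact: (integral_prob_cst Q 1).
- by move=> w; rewrite ltNge X_ge0.
Qed.

Lemma law_integral (f : R -> R) : measurable_fun setT f ->
  \int[law Q X]_x (f x)%:E = \int[Q]_w (f (X w))%:E.
Proof.
move=> mf; rewrite (@weighted_integral _ _ _ Q X (cst 1%R))//.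
by apply: eq_integral => w _; rewrite mulr1.
Qed.

Variable B : set Om.
Hypothesis mB : measurable B.
Hypothesis B_gt0 : (0 < fine (Q B))%R.

Let h w : R := ((fine (Q B))^-1 * \1_B w)%R.

Let h_ge0 w : (0 <= h w)%R. Proof. by rewrite mulr_ge0// invr_ge0 (ltW B_gt0). Qed.

Let mh : measurable_fun setT h.
Proof. by apply: measurable_funM => //; exact: measurable_indic. Qed.

Let finQ A : measurable A -> Q A \is a fin_num.
Proof. by move=> mA; exact: fin_num_measure. Qed.

Let integral_h A : measurable A -> \int[Q]_(w in A) (h w)%:E = (cond_prob Q A B)%:E.
Proof.
move=> mA; under eq_integral do rewrite EFinM.
rewrite ge0_integralZl//.
- rewrite (integral_indic Q mA mB) /cond_prob setIC mulrC EFinM fineK; first by [].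
  by apply: finQ; exact: measurableI.
- by apply/measurable_EFinP; apply: measurable_funTS; exact: measurable_indic.
- by rewrite lee_fin invr_ge0 (ltW B_gt0).
Qed.

Let cond_law_ge0 A : 0 <= cond_law Q X B A.
Proof.
rewrite lee_fin; apply: divr_ge0; last exact: ltW B_gt0.
by apply: fine_ge0; exact: measure_ge0.
Qed.

Let cond_lawE A : measurable A -> cond_law Q X B A = \int[Q]_(w in X @^-1` A) (h w)%:E.
Proof.
by move=> mA; rewrite integral_h// -[X in measurable X]setTI; exact: mX.
Qed.

Lemma cond_law_nonneg : nonneg_law (cond_law Q X B).
Proof.
apply: (@weighted_nonneg_law _ _ _ Q X h) => //.
- rewrite integral_h// /cond_prob setTI divff// gt_eqF//.
- by move=> w; rewrite ltNge X_ge0.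
Qed.

Lemma cond_law_integral (f : R -> R) : measurable_fun setT f ->
  Q.-integrable setT (fun w => (f (X w) * \1_B w)%:E) ->
  fine (\int[cond_law Q X B]_x (f x)%:E) =
  (fine (\int[Q]_w (f (X w) * \1_B w)%:E) / fine (Q B))%R.
Proof.
move=> mf iF; rewrite (@weighted_integral _ _ _ Q X h)//.
transitivity (fine (\int[Q]_w ((fine (Q B))^-1 * (f (X w) * \1_B w))%:E)).
  by congr fine; apply: eq_integral => w _; congr EFin; rewrite /h; ring.
by rewrite (integral_scaleR _ iF) fineM ?integrable_fin_num// mulrC.
Qed.

End conditional_laws.

(** * The exponential law and the gamma law of shape 2 *)

Section gamma2_law.
Local Open Scope ereal_scope.
Context {R : realType}.
Notation mu := (@lebesgue_measure R).
Variable rate : R.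
Hypothesis rate_gt0 : (0 < rate)%R.

Lemma gamma2_pdf_ge0 x : (0 <= gamma2_pdf rate x)%R.
Proof.
by rewrite /gamma2_pdf; case: ifP => // x0; rewrite !mulr_ge0 ?expR_ge0// ltW.
Qed.

Let g x : R := (rate ^+ 2 * x * expR (- (rate * x)))%R.

Let cexp : continuous (fun x : R => expR (- (rate * x))).
Proof.
move=> x; apply: (@continuous_comp _ _ _ (fun y : R => - (rate * y))%R expR).
  by apply: cvgN; apply: cvgM; [exact: cvg_cst|exact: cvg_id].
exact: continuous_expR.
Qed.

Let cg : continuous g.
Proof.
move=> x; apply: cvgM; last exact: cexp.
by apply: cvgM; [exact: cvg_cst|exact: cvg_id].
Qed.

Lemma measurable_gamma2_pdf : measurable_fun setT (gamma2_pdf rate).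
Proof.
rewrite (_ : gamma2_pdf rate = g \_ `[0%R, +oo[).
  apply/measurable_restrict => //; apply: measurable_funTS.
  exact: continuous_measurable_fun.
by apply/funext => x; rewrite patchE mem_setE in_itv /= andbT.
Qed.

(** The primitive of [g] that vanishes at infinity. *)
Let F x : R := (- ((rate * x + 1) * expR (- (rate * x))))%R.

Let F_derive x : is_derive x (1%R : R) F (g x).
Proof.
rewrite /F /g.
apply: is_derive_eq.
rewrite /GRing.scale /=; ring.
Qed.

Let F_cvg : F x @[x --> +oo%R] --> (0%R : R).
Proof.
rewrite -oppr0; apply: cvgN.
have H : (4 * expR (- (rate / 2 * x)))%R @[x --> +oo%R] --> (0%R : R).
  rewrite -[X in _ --> X](mulr0 4%R); apply: cvgM; first exact: cvg_cst.
  apply: (@cvg_comp _ _ _ (fun z : R => rate / 2 * z)%R (fun z => expR (- z)) _ (pinfty_nbhs R)).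
    by apply: gt0_cvgMry; rewrite ?divr_gt0//; exact: cvg_id.
  exact: cvgr_expR.
apply: squeeze_cvgr (@cvg_cst _ 0%R _ _ _) H; near=> x.
have x0 : (0 <= x)%R by near: x; exact: nbhs_pinfty_ge.
have y0 : (0 <= rate / 2 * x)%R by rewrite mulr_ge0// ltW// divr_gt0.
(* Half of the exponent absorbs the linear factor, as 1 + 2y <= 4 e^y. *)
set y := (rate / 2 * x)%R in y0 *.
have -> : (rate * x = y + y)%R by rewrite /y; field.
rewrite opprD expRD; apply/andP; split.
  by rewrite mulr_ge0 ?mulr_ge0 ?expR_ge0//; lra.
rewrite mulrA ler_wpM2r ?expR_ge0//.
have ey : (1 + y <= expR y)%R by exact: expR_ge1Dx.
have e1 : (expR y * expR (- y) = 1)%R by rewrite -expRD subrr expR0.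
have := expR_gt0 (- y); nra.
Unshelve. all: by end_near. Qed.

Lemma integral_gamma2_pdf : \int[mu]_x (gamma2_pdf rate x)%:E = 1.
Proof.
rewrite -(setUv `[0%R, +oo[%classic) ge0_integral_setU//=; last 4 first.
- exact: measurableC.
- by rewrite setUv; apply/measurable_EFinP; exact: measurable_gamma2_pdf.
- by move=> x _; rewrite lee_fin gamma2_pdf_ge0.
- exact/disj_setPCl.
rewrite [X in _ + X]integral0_eq ?adde0; last first.
  by move=> x /=; rewrite in_itv /= andbT /gamma2_pdf => /negP/negbTE ->.
transitivity (\int[mu]_(x in `[0%R, +oo[) (g x)%:E).
  apply: eq_integral => x; rewrite inE /= in_itv /= andbT => x0.
  by rewrite /gamma2_pdf x0.
rewrite (@ge0_continuous_FTC2y _ _ F _ 0%R)//.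
- by rewrite -EFinB; congr EFin; rewrite /F mulr0 oppr0 expR0; ring.
- by move=> x x0; rewrite /g !mulr_ge0 ?expR_ge0// ltW.
- exact: continuous_subspaceT.
- apply: cvg_at_right_filter.
  apply: differentiable_continuous; apply/derivable1_diffP.
  by have [] := F_derive 0%R.
- by move=> x _; rewrite derive1E; have [_] := F_derive x.
Qed.


Let lt0_gamma2_pdf x : (x < 0)%R -> gamma2_pdf rate x = 0%R.
Proof. by move=> x0; rewrite /gamma2_pdf leNgt x0. Qed.

Let gamma2_law_ge0 (A : set (measurableTypeR R)) : 0 <= law_of_density (gamma2_pdf rate) A.
Proof. by apply: integral_ge0 => x _; rewrite lee_fin gamma2_pdf_ge0. Qed.

Lemma gamma2_nonneg : nonneg_law (law_of_density (gamma2_pdf rate)).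
Proof.
apply: (@weighted_nonneg_law _ _ _ lebesgue_measure id (gamma2_pdf rate)) => //.
- exact: measurable_gamma2_pdf.
- exact: gamma2_pdf_ge0.
- exact: integral_gamma2_pdf.
Qed.

Lemma gamma2_tail :
  fine (\int[law_of_density (gamma2_pdf rate)]_x ((1 - laplace_fun 1 x) ^+ N)%:E)
    @[N --> \oo] --> (0%R : R).
Proof.
apply: (@weighted_tail _ _ _ lebesgue_measure id (gamma2_pdf rate)) => //.
- exact: measurable_gamma2_pdf.
- exact: gamma2_pdf_ge0.
- exact: integral_gamma2_pdf.
Qed.

Lemma gamma2_integral (f : R -> R) : measurable_fun setT f ->
  \int[law_of_density (gamma2_pdf rate)]_x (f x)%:E = \int[mu]_x (f x * gamma2_pdf rate x)%:E.
Proof.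
move=> mf; apply: (@weighted_integral _ _ _ lebesgue_measure id (gamma2_pdf rate)) => //.
- exact: measurable_gamma2_pdf.
- exact: gamma2_pdf_ge0.
Qed.

Lemma exponential_nonneg : nonneg_law (exponential_prob rate).
Proof.
apply: (@weighted_nonneg_law _ _ _ lebesgue_measure id (exponential_pdf rate)) => //.
- exact: measurable_exponential_pdf.
- by move=> x; rewrite exponential_pdf_ge0// ltW.
- by move=> A; apply: integral_ge0 => x _; rewrite lee_fin exponential_pdf_ge0// ltW.
- exact: integral_exponential_pdf.
- by move=> x; exact: lt0_exponential_pdf.
Qed.

Lemma exponential_tail :
  fine (\int[exponential_prob rate]_x ((1 - laplace_fun 1 x) ^+ N)%:E)
    @[N --> \oo] --> (0%R : R).
Proof.
apply: (@weighted_tail _ _ _ lebesgue_measure id (exponential_pdf rate)) => //.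
- exact: measurable_exponential_pdf.
- by move=> x; rewrite exponential_pdf_ge0// ltW.
- by move=> A; apply: integral_ge0 => x _; rewrite lee_fin exponential_pdf_ge0// ltW.
- exact: integral_exponential_pdf.
Qed.

Lemma exponential_integral (f : R -> R) : measurable_fun setT f ->
  \int[exponential_prob rate]_x (f x)%:E = \int[mu]_x (f x * exponential_pdf rate x)%:E.
Proof.
move=> mf; apply: (@weighted_integral _ _ _ lebesgue_measure id (exponential_pdf rate)) => //.
- exact: measurable_exponential_pdf.
- by move=> x; rewrite exponential_pdf_ge0// ltW.
- by move=> A; apply: integral_ge0 => x _; rewrite lee_fin exponential_pdf_ge0// ltW.
Qed.

End gamma2_law.

Section laplace_of_laws.
Local Open Scope ereal_scope.
Context {R : realType}.
Notation mu := (@lebesgue_measure R).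
Variable rate : R.
Hypothesis rate_gt0 : (0 < rate)%R.
Variable j : nat.

Let rj : (0 < rate + j%:R)%R. Proof. by rewrite ltr_wpDr. Qed.

Let mlap : measurable_fun setT (@laplace_fun R j).
Proof. by apply: continuous_measurable_fun; case: (bounded_continuous_laplace (R := R) j). Qed.

Let laplaceM x : (0 <= x)%R ->
  (laplace_fun j x * expR (- (rate * x)) = expR (- ((rate + j%:R) * x)))%R.
Proof. by move=> x0; rewrite /laplace_fun (ger0_norm x0) -expRD; congr expR; ring. Qed.

(** Tilting by e^(-j x) turns the exponential density of rate r into r / (r + j) times the one of
    rate r + j. *)
Lemma exponential_laplace :
  fine (\int[exponential_prob rate]_x (laplace_fun j x)%:E) = (rate / (rate + j%:R))%R.
Proof.
rewrite exponential_integral//.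
transitivity (fine (\int[mu]_x ((rate / (rate + j%:R))%:E * (exponential_pdf (rate + j%:R) x)%:E))).
  congr fine; apply: eq_integral => x _; rewrite -EFinM; congr EFin.
  have [x0|x0] := ltP x 0%R; first by rewrite !lt0_exponential_pdf// !mulr0.
  rewrite !exponential_pdfE// mulrCA !mulNr laplaceM// mulrA divfK// gt_eqF//.
rewrite ge0_integralZl//.
- by rewrite integral_exponential_pdf// mule1.
- by apply/measurable_EFinP; exact: measurable_exponential_pdf.
- by move=> x _; rewrite lee_fin exponential_pdf_ge0// ltW.
- by rewrite lee_fin divr_ge0// ltW.
Qed.

Lemma gamma2_laplace :
  fine (\int[law_of_density (gamma2_pdf rate)]_x (laplace_fun j x)%:E) =
  ((rate / (rate + j%:R)) ^+ 2)%R.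
Proof.
rewrite gamma2_integral//.
transitivity (fine (\int[mu]_x (((rate / (rate + j%:R)) ^+ 2)%:E * (gamma2_pdf (rate + j%:R) x)%:E))).
  congr fine; apply: eq_integral => x _; rewrite -EFinM; congr EFin.
  rewrite /gamma2_pdf; case: ifP => x0; last by rewrite !mulr0.
  rewrite mulrCA laplaceM// mulrA; congr (_ * _)%R.
  by field; rewrite gt_eqF.
rewrite ge0_integralZl//.
- by rewrite integral_gamma2_pdf// mule1.
- by apply/measurable_EFinP; exact: measurable_gamma2_pdf.
- by move=> x _; rewrite lee_fin gamma2_pdf_ge0.
- by rewrite lee_fin exprn_ge0// divr_ge0// ltW.
Qed.

(** The factor x turns the tilted exponential density into a multiple of a gamma density; dividing
    by the mean 1/rate gives the transform in [gamma2_laplace]. *)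
Lemma exponential_size_biased_laplace :
  fine (\int[exponential_prob rate]_x (`|x| * laplace_fun j x)%:E) =
  (rate / (rate + j%:R) ^+ 2)%R.
Proof.
rewrite exponential_integral//; last first.
  by apply: measurable_funM => //; exact: measurableT_comp.
transitivity (fine (\int[mu]_x ((rate / (rate + j%:R) ^+ 2)%:E * (gamma2_pdf (rate + j%:R) x)%:E))).
  congr fine; apply: eq_integral => x _; rewrite -EFinM; congr EFin.
  have [x0|x0] := ltP x 0%R.
    by rewrite lt0_exponential_pdf// /gamma2_pdf leNgt x0 !mulr0.
  rewrite exponential_pdfE// /gamma2_pdf x0 (ger0_norm x0) mulNr.
  transitivity (x * rate * (laplace_fun j x * expR (- (rate * x))))%R; first by ring.
  by rewrite laplaceM// mulrA; congr (_ * _)%R; field; rewrite gt_eqF.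
rewrite ge0_integralZl//.
- by rewrite integral_gamma2_pdf// mule1.
- by apply/measurable_EFinP; exact: measurable_gamma2_pdf.
- by move=> x _; rewrite lee_fin gamma2_pdf_ge0.
- by rewrite lee_fin divr_ge0// ?exprn_ge0// ltW.
Qed.

End laplace_of_laws.

(** * Quenched limits *)

Section levels.
Variable e : seq nat -> nat.
Notation T := (galton_watson_tree e).

(** Links the sets of words in the statement to the lists on which the estimates are made. *)
Lemma level_root_cluster (b : seq nat -> bool) n :
  level (root_cluster T b) n = [set` cluster [::] (tree e n [::]) b].
Proof.
apply/seteqP; split => v /=; rewrite (cluster_tree e n [::] b v).
  move=> [[Tv bv] <-]; rewrite eqxx; apply/allP => k; rewrite mem_iota add0n => /= kv.
  by rewrite Tv// bv//.
move=> /andP[/eqP sv /allP H]; split => //; split.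
  by move=> k kv; have /H/andP[] : k \in iota 0 n by rewrite mem_iota add0n -sv.
by case=> // k kv; have /H/andP[] : k \in iota 0 n by rewrite mem_iota add0n -sv.
Qed.

Lemma root_cluster_all : root_cluster T (fun=> true) = T.
Proof. by apply/seteqP; split => v // []. Qed.

Lemma card_fset_set_seq (s : seq (seq nat)) : uniq s -> #|` fset_set [set` s]| = size s.
Proof.
move=> us; rewrite (_ : [set` s] = [set` [fset x in s]%fset]); last first.
  by apply/seteqP; split => x /=; rewrite inE.
by rewrite set_fsetK card_fseq undup_id.
Qed.

Lemma level_size_root_cluster (b : seq nat -> bool) n :
  level_size (root_cluster T b) n = size (cluster [::] (tree e n [::]) b).
Proof. by rewrite /level_size level_root_cluster card_fset_set_seq// uniq_cluster. Qed.

Lemma level_size_tree n :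
  level_size T n = size (cluster [::] (tree e n [::]) (fun=> true)).
Proof. by rewrite -level_size_root_cluster root_cluster_all. Qed.

Lemma martingale_limitE (R : realType) (mu : R) :
  martingale_limit mu T = limn (fun n => Wf mu^-1 (tree e n [::])).
Proof.
rewrite /martingale_limit; under eq_fun => n do
  rewrite level_size_tree mulrC -exprVn -Wf_cluster.
by [].
Qed.

Lemma level_size_truncation (U : set (seq nat)) n :
  level_size (truncation U n) n = level_size U n.
Proof.
congr #|` fset_set _|; apply/seteqP; split => v /= [].
  by case.
by move=> Uv <-; split.
Qed.

Lemma truncation_seq n : exists2 s : seq (seq nat), uniq s & truncation T n = [set` s].
Proof.
set s := flatten [seq cluster [::] (tree e k [::]) (fun=> true) | k <- iota 0 n.+1].
have H v : truncation T n v <-> v \in s.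
  split=> [[Tv vn]|/flattenP[_ /mapP[k + ->]]].
    apply/flattenP; exists (cluster [::] (tree e (size v) [::]) (fun=> true)).
      by apply/mapP; exists (size v) => //; rewrite mem_iota.
    have : level (root_cluster T (fun=> true)) (size v) v by rewrite root_cluster_all; split.
    by rewrite level_root_cluster.
  rewrite mem_iota add0n => /andP[_ kn] vc.
  have : level (root_cluster T (fun=> true)) k v by rewrite level_root_cluster.
  by rewrite root_cluster_all => -[Tv vk]; split=> //; rewrite vk.
move: s H => s H; exists (undup s); first exact: undup_uniq.
by apply/seteqP; split=> [v /H|v]; rewrite /mkset mem_undup// => /H.
Qed.

Lemma truncation_rooted (U : set (seq nat)) n : rooted_subtree T U ->
  rooted_subtree (truncation T n) (truncation U n).
Proof.
move=> [U0 UT US]; split => //.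
- by move=> v [/UT Tv vn]; split.
- move=> u i [Uui]; rewrite size_rcons => un; split; first exact: US Uui.
  exact: ltnW.
Qed.

Lemma root_cluster_rooted (b : seq nat -> bool) : rooted_subtree T (root_cluster T b).
Proof.
split.
- by split => -[].
- by move=> v [].
move=> u i [Tu bu]; split.
  move=> k ku; have := Tu k; rewrite size_rcons nth_rcons ku -cats1 takel_cat ?(ltnW ku)//.
  by apply; exact: ltnW.
move=> k /andP[k0 ku]; have := bu k; rewrite size_rcons k0 -cats1 takel_cat//.
by apply; exact: leqW.
Qed.

End levels.

(** * Random subsets of a finite truncated tree *)

Section random_subtrees.
Context {R : realType} (T : set (seq nat)) (n : nat) (V : seq (seq nat)).
Hypotheses (uV : uniq V) (TV : truncation T n = [set` V]).

(** Coding subsets by bit tuples makes the truncated random set a discrete variable and sums over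
    its values sums over a finite type. *)
Definition subset_of_bits (a : (size V).-tuple bool) : set (seq nat) :=
  [set v | v \in V /\ nth false a (index v V)].

Context d (Om : measurableType d) (P : probability Om R) (U : Om -> set (seq nat)).
Hypotheses (UT : forall w, U w `<=` T) (mU : forall v, measurable [set w | U w v]).

Let bits w : (size V).-tuple bool := [tuple of map (fun v => `[< U w v >]) (in_tuple V)].

Let bitsE w a : bits w = a <-> truncation (U w) n = subset_of_bits a.
Proof.
have nthE v : v \in V -> nth false (bits w) (index v V) = `[< U w v >].
  by move=> vV; rewrite /= (nth_map [::]) ?index_mem// nth_index.
have VE v : v \in V -> (size v <= n)%N.
  by move=> vV; have : [set` V] v by []; rewrite -TV => -[].
split=> [<-|H].
  apply/seteqP; split => v [].
    move=> Uv vn; have vV : [set` V] v by rewrite -TV; split => //; exact: UT Uv.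
    by split => //; rewrite nthE//; apply/asboolP.
  by move=> vV; rewrite nthE// => /asboolP Uv; split => //; exact: VE.
apply: val_inj; apply: (@eq_from_nth _ false); first by rewrite !size_tuple.
move=> i; rewrite size_tuple => iV.
have vV : nth [::] V i \in V by exact: mem_nth.
have := nthE _ vV; rewrite index_uniq// => ->.
apply/asboolP/idP.
  move=> Uv; have : truncation (U w) n (nth [::] V i) by split => //; exact: VE.
  by rewrite H => -[_]; rewrite index_uniq.
move=> ai; have : subset_of_bits a (nth [::] V i) by split => //; rewrite index_uniq.
by rewrite -H => -[].
Qed.

Let truncation_event a :
  [set w | truncation (U w) n = subset_of_bits a] = bits @^-1` [set a].
Proof. by apply/seteqP; split => w /=; rewrite bitsE. Qed.

Let mbits a : measurable (bits @^-1` [set a]).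
Proof.
have -> : bits @^-1` [set a] = (fun w => [seq `[< U w v >] | v <- V]) @^-1` [set val a].
  by apply/seteqP; split => w /= => [<-//|H]; apply: val_inj.
have dU v : discrete (fun w => `[< U w v >]).
  case.
    rewrite (_ : _ @^-1` _ = [set w | U w v])//.
    by apply/seteqP; split => w /= /asboolP.
  rewrite (_ : _ @^-1` _ = ~` [set w | U w v]); first exact: measurableC.
  by apply/seteqP; split=> [w /= /negbT/asboolPn|w /= /asboolPn/negbTE].
exact: (discrete_map V dU).
Qed.

Lemma truncation_measurable (G : set (seq nat) -> R) :
  measurable_fun setT (fun w => G (truncation (U w) n)).
Proof.
rewrite (_ : (fun w => _) = (fun a => G (subset_of_bits a)) \o bits).
  exact: (discrete_measurable _ mbits).
by apply/funext => w /=; rewrite ((bitsE w _).1 erefl).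
Qed.

Lemma truncation_integral (G : set (seq nat) -> R) (B : set Om) :
  (forall A, 0 <= G A) -> measurable B ->
  (\int[P]_w (G (truncation (U w) n) * \1_B w)%:E)%E =
  (\sum_a G (subset_of_bits a) *
    fine (P ([set w | truncation (U w) n = subset_of_bits a] `&` B)))%:E.
Proof.
move=> G0 mB; rewrite -sumEFin.
transitivity (\int[P]_w (\sum_a (G (subset_of_bits a))%:E *
    (\1_(bits @^-1` [set a] `&` B) w)%:E))%E.
  apply: eq_integral => w _; rewrite (bigD1 (bits w))//= big1 ?adde0; last first.
    move=> a /eqP aw; rewrite indicE memNset ?mule0// => -[/= wa _].
    by apply: aw.
  rewrite -EFinM; congr EFin.
  rewrite ((bitsE w _).1 erefl); congr (_ * _); rewrite !indicE; congr ((nat_of_bool _)%:R).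
  by apply/idP/idP; rewrite !inE => //= -[].
rewrite ge0_integral_sum//; last 2 first.
- move=> a; apply: emeasurable_funM; first exact: measurable_cst.
  by apply/measurable_EFinP; apply: measurable_indic; exact: measurableI.
- by move=> a w _; rewrite mule_ge0// lee_fin.
apply: eq_bigr => a _; rewrite ge0_integralZl//; last 2 first.
- apply/measurable_EFinP; apply: measurable_indic; exact: measurableI.
- by rewrite lee_fin.
have mI : measurable (bits @^-1` [set a] `&` B) by exact: measurableI.
rewrite (integral_indic P measurableT mI) setIT truncation_event EFinM fineK//.
exact: fin_num_measure.
Qed.

End random_subtrees.

Section quenched.
Context {R : realType} d (Om : measurableType d) (Q : probability Om R).
Variables (xi : seq nat -> {RV Q >-> bool}) (p : R) (e : seq nat -> nat).
Hypothesis xi_perc : bernoulli_percolation xi p.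

Notation T := (galton_watson_tree e).
Notation t n := (tree e n [::]).
Notation conf w := (fun v : seq nat => xi v w).
Notation surv n := (survives T xi n).

Lemma YE n w : Y T xi n w = size (cluster [::] (t n) (conf w)).
Proof. exact: level_size_root_cluster. Qed.

Lemma survivesE n : surv n = [set w | cluster [::] (t n) (conf w) != [::]].
Proof. by apply/seteqP; split=> w; rewrite /survives /= YE lt0n size_eq0. Qed.

Let measurable_cluster n (g : seq (seq nat) -> R) :
  measurable_fun setT (fun w => g (cluster [::] (t n) (conf w))).
Proof.
exact: (@local_measurable _ _ _ _ xi (edges [::] (t n))
  (fun b => g (cluster [::] (t n) b)) (local_cluster g)).
Qed.

Let measurable_bool (b : (seq nat -> bool) -> bool) :
  measurable_fun setT (fun w => (b (conf w))%:R : R) -> measurable [set w | b (conf w)].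
Proof.
move=> mb; have := mb measurableT [set 1%R] (measurable_set1 _).
rewrite setTI (_ : _ @^-1` _ = [set w | b (conf w)])//.
apply/seteqP; split=> w /=; case: (b (conf w)) => // /eqP.
by rewrite eq_sym oner_eq0.
Qed.

Lemma measurable_survives n : measurable (surv n).
Proof.
rewrite survivesE; apply: (@measurable_bool (fun b => cluster [::] (t n) b != [::])).
exact: (measurable_cluster n (fun l => (l != [::])%:R)).
Qed.

Lemma measurable_open_cluster v : measurable [set w | open_cluster T xi w v].
Proof.
rewrite (_ : [set w | _] = [set w | v \in cluster [::] (t (size v)) (conf w)]).
  apply: (@measurable_bool (fun b => v \in cluster [::] (t (size v)) b)).
  exact: (measurable_cluster (size v) (fun l => (v \in l)%:R)).
apply/seteqP; split=> w /= H.
  have : level (root_cluster T (conf w)) (size v) v by split.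
  by rewrite level_root_cluster.
have : level (root_cluster T (conf w)) (size v) v by rewrite level_root_cluster.
by case.
Qed.

Lemma measurable_Y n : measurable_fun setT (fun w => (Y T xi n w)%:R : R).
Proof.
rewrite (_ : (fun w => _) = fun w => (size (cluster [::] (t n) (conf w)))%:R).
  exact: (measurable_cluster n (fun l => (size l)%:R)).
by apply/funext => w; rewrite YE.
Qed.

Lemma survives_probability n : Q (surv n) = (Gf p 1 (t n))%:E.
Proof.
rewrite -(cluster_survival xi_perc [::]) -[X in Q X]setIT.
rewrite -(integral_indic Q measurableT (measurable_survives n)).
apply: eq_integral => w _; rewrite indicE; congr (((nat_of_bool _)%:R)%:E).
by apply/idP/idP; rewrite survivesE !inE.
Qed.

(** The truncated cluster takes finitely many values, so convergence of its marginals carries over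
    to means. *)
Lemma iic_integral_cvg d' (Om' : measurableType d') (P' : probability Om' R)
    (S : Om' -> set (seq nat)) n (G : set (seq nat) -> R) :
  quenched_IIC T xi P' S -> (forall A, 0 <= G A) ->
  fine (\int[Q]_w (G (truncation (open_cluster T xi w) n) * \1_(surv M) w)%:E)%E /
    fine (Q (surv M)) @[M --> \oo] -->
  fine (\int[P']_w (G (truncation (S w) n))%:E)%E.
Proof.
move=> [rS mS limS] G0.
have [V uV TV] := truncation_seq e n.
have OT w : open_cluster T xi w `<=` T by move=> v [].
have ST w : S w `<=` T by case: (rS w) => -[].
have -> : (\int[P']_w (G (truncation (S w) n))%:E)%E =
    (\int[P']_w (G (truncation (S w) n) * \1_setT w)%:E)%E.
  by apply: eq_integral => w _; rewrite indicE in_setT mulr1.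
rewrite (truncation_integral uV TV P' ST mS G0 measurableT) /=.
rewrite (_ : (fun M => _) = (fun M => \sum_(a : (size V).-tuple bool) G (subset_of_bits a) *
    cond_prob Q [set w | truncation (open_cluster T xi w) n = subset_of_bits a] (surv M))).
  apply: cvg_sum_seq => a; apply: cvgM; first exact: cvg_cst.
  rewrite setIT.
  (* The limits are assumed for rooted subtrees only; any other subset has probability 0 on both
     sides, because both random sets are rooted subtrees. *)
  have [ra|nra] := pselect (rooted_subtree (truncation T n) (subset_of_bits a)).
    exact: limS.
  have E0 (O : Type) (U : O -> set (seq nat)) : (forall w, rooted_subtree T (U w)) ->
      [set w | truncation (U w) n = subset_of_bits a] = set0.
    move=> rU; apply/seteqP; split=> w //= Ea; apply: nra.
    by rewrite -Ea; exact: truncation_rooted (rU w).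
  rewrite (E0 _ S); last by move=> w; case: (rS w).
  rewrite measure0 (E0 _ (open_cluster T xi)); last by move=> w; exact: root_cluster_rooted.
  rewrite (_ : (fun M => _) = cst 0); first exact: cvg_cst.
  by apply/funext => M; rewrite /cond_prob set0I measure0 mul0r.
apply/funext => M.
rewrite (truncation_integral uV TV Q OT measurable_open_cluster G0 (measurable_survives M)) /=.
by rewrite mulr_suml; apply: eq_bigr => a _; rewrite -mulrA.
Qed.

End quenched.

(** * The three limits on a fixed tree *)

Section quenched_limits.
Context {R : realType} d (Om : measurableType d) (Q : probability Om R).
Variables (xi : seq nat -> {RV Q >-> bool}) (p : R) (e : seq nat -> nat).
Hypothesis xi_perc : bernoulli_percolation xi p.

Notation T := (galton_watson_tree e).
Notation t n := (tree e n [::]).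
Notation conf w := (fun v : seq nat => xi v w).
Notation surv n := (survives T xi n).
Notation laplace_base j n := (expR (- (j%:R / n%:R)) : R).

(** From here on the tree is deterministic and the hypotheses are the almost sure limits. [W] is
    defined on all words because the incipient infinite cluster involves W(v) below every vertex. *)
Variables (lam : R) (W : seq nat -> R).
Hypothesis lam_gt0 : 0 < lam.
Hypothesis W_gt0 : 0 < W [::].
Hypothesis Gf1_cvg : forall v, n%:R * Gf p 1 (tree e n v) @[n --> \oo] --> lam * W v.
Hypothesis Gf_laplace_cvg : forall j, (0 < j)%N ->
  n%:R * Gf p (laplace_arg j n) (t n) @[n --> \oo] --> (lam^-1 + j%:R^-1)^-1 * W [::].
Hypothesis coef_cvg : forall j,
  \sum_(v <- cluster [::] (t n) (fun=> true))
    coef xi (laplace_base j n) (t n) v * (W v - 1) @[n --> \oo] --> 0.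

Let lw : 0 < lam * W [::]. Proof. exact: mulr_gt0. Qed.

Let base01 j n : 0 <= laplace_base j n <= 1.
Proof.
rewrite expR_ge0 -[leRHS]expR0 ler_expR oppr_le0 divr_ge0//.
Qed.

Lemma survives_cvg : n%:R * fine (Q (surv n)) @[n --> \oo] --> lam * W [::].
Proof.
rewrite (_ : (fun n => _) = fun n => n%:R * Gf p 1 (t n)); first exact: Gf1_cvg.
by apply/funext => n; rewrite (survives_probability _ xi_perc).
Qed.

Lemma near_survives_gt0 : \forall n \near \oo, (0 < n)%N /\ 0 < fine (Q (surv n)).
Proof.
have := survives_cvg; move/cvgrPdist_lt => /(_ _ lw) H.
near=> n; have n0 : (0 < n)%N by near: n; exists 1%N.
split=> //.
have : `|lam * W [::] - n%:R * fine (Q (surv n))| < lam * W [::] by near: n.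
rewrite ltr_norml => /andP[_ h].
have : 0 < n%:R * fine (Q (surv n)) by lra.
by rewrite pmulr_rgt0// ltr0n.
Unshelve. all: by end_near. Qed.

Let X n w : measurableTypeR R := (Y T xi n w)%:R / n%:R.

Let mX n : measurable_fun setT (X n).
Proof. by apply: measurable_funM => //; exact: measurable_Y. Qed.

Let X_ge0 n w : (0 <= X n w :> R).
Proof. by rewrite /X divr_ge0. Qed.

Let laplaceX j n w : laplace_fun j (X n w) = laplace_base j n ^+ Y T xi n w.
Proof.
rewrite /laplace_fun ger0_norm ?X_ge0// -expRM_natl; congr expR.
by rewrite /X mulrN; congr (- _); exact: mulrCA.
Qed.

Let genfun j n :
  (\int[Q]_w (laplace_base j n ^+ Y T xi n w)%:E)%E = (1 - Gf p (laplace_arg j n) (t n))%:E.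
Proof.
rewrite -(cluster_genfun xi_perc [::] (t n) (base01 j n)).
by apply: eq_integral => w _; rewrite YE.
Qed.

Let mlap j n : measurable_fun setT (fun w => laplace_base j n ^+ Y T xi n w).
Proof.
apply: (@eq_measurable_fun _ _ _ _ _ (@laplace_fun R j \o X n)).
  by move=> w _; rewrite /= laplaceX.
apply: (@measurableT_comp _ _ _ _ _ _ (@laplace_fun R j) _ (X n)); last exact: mX.
by apply: continuous_measurable_fun; case: (@bounded_continuous_laplace R j).
Qed.

Let cond_laplace j n : (0 < n)%N -> 0 < fine (Q (surv n)) ->
  fine (\int[cond_law Q (X n) (surv n)]_x (laplace_fun j x)%:E)%E =
  1 - (n%:R * Gf p (laplace_arg j n) (t n)) / (n%:R * fine (Q (surv n))).
Proof.
move=> n0 s0.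
have ilap : Q.-integrable setT (fun w => (laplace_base j n ^+ Y T xi n w)%:E).
  apply/integrableP; split; first exact/measurable_EFinP.
  under eq_integral do rewrite gee0_abs ?lee_fin ?exprn_ge0 ?expR_ge0//.
  by rewrite genfun ltry.
have isurv : Q.-integrable setT (fun w => (\1_(surv n) w)%:E).
  by apply: integrable_indic => //; exact: measurable_survives.
have i1 : Q.-integrable setT (fun w : Om => 1%R%:E) by exact: finite_measure_integrable_cst.
(* Off the survival event Y = 0 and s^Y = 1, so the mean restricted to survival is E s^Y minus the
   extinction probability. *)
have E w : laplace_fun j (X n w) * \1_(surv n) w =
    laplace_base j n ^+ Y T xi n w + (-1 * 1 + \1_(surv n) w).
  rewrite laplaceX indicE; have [wS|wS] := boolP (w \in surv n).
    by rewrite (_ : true%:R = 1 :> R)//; ring.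
  have -> : Y T xi n w = 0%N.
    by apply/eqP; rewrite -leqn0 leqNgt; apply: contraNN wS; rewrite inE.
  by rewrite expr0 (_ : false%:R = 0 :> R)//; ring.
have mcl := measurable_survives xi e n.
rewrite (cond_law_integral (mX n) mcl s0).
- under eq_integral do rewrite E.
  rewrite (integral_addR ilap); last exact: integrable_addR (integrable_scaleR _ i1) isurv.
  rewrite (integral_addR (integrable_scaleR _ i1) isurv) (integral_scaleR _ i1).
  rewrite genfun (integral_prob_cst Q 1) (integral_indic Q measurableT mcl) setIT.
  have sp := survives_probability e xi_perc n.
  rewrite sp /= in s0 *; rewrite [X in (_ + (_ + X))%E]sp /=.
  by field; rewrite !gt_eqF// ltr0n.
- by apply: continuous_measurable_fun; case: (@bounded_continuous_laplace R j).
- rewrite (_ : (fun w => _) = fun w => (laplace_base j n ^+ Y T xi n w +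
      (-1 * 1 + \1_(surv n) w))%:E); last by apply/funext => w; rewrite E.
  exact: integrable_addR ilap (integrable_addR (integrable_scaleR _ i1) isurv).
Qed.

Lemma cond_law_cvg : weakly_converges
  (fun n => cond_law Q (fun w => (Y T xi n w)%:R / n%:R) (surv n)) (exponential_prob lam).
Proof.
apply: weak_cvg_laplace.
- apply: filterS near_survives_gt0 => n [n0 s0].
  exact: (cond_law_nonneg (mX n) (X_ge0 n) (measurable_survives xi e n) s0).
- exact: exponential_nonneg.
- move=> j; rewrite exponential_laplace//.
  have H : 1 - (n%:R * Gf p (laplace_arg j n) (t n)) / (n%:R * fine (Q (surv n)))
      @[n --> \oo] --> lam / (lam + j%:R).
    (* At j = 0 the formula for the limit would read 1/0 as 0 and be wrong; there the transform is
       constantly 1. *)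
    have [->|j0] := posnP j.
      rewrite addr0 divff ?gt_eqF// (_ : (fun n => _) = cst 1); first exact: cvg_cst.
      apply/funext => n; have := genfun 0 n.
      rewrite mul0r oppr0 expR0 => H.
      have : (1 - Gf p (laplace_arg 0 n) (t n))%:E = (1%R%:E : \bar R).
        rewrite -H -[RHS](integral_prob_cst Q 1).
        by apply: eq_integral => w _; rewrite expr1n.
      move=> [/eqP]; rewrite subr_eq addrC -subr_eq subrr => /eqP <-.
      by rewrite mulr0 mul0r subr0.
    have -> : lam / (lam + j%:R) = 1 - (lam^-1 + j%:R^-1)^-1 * W [::] / (lam * W [::]).
      have j0' : 0 < j%:R :> R by rewrite ltr0n.
      by field; rewrite !gt_eqF// ltr_wpDl.
    apply: cvgB; first exact: cvg_cst.
    apply: cvgM; first exact: Gf_laplace_cvg.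
    by apply: cvgV; [rewrite gt_eqF|exact: survives_cvg].
  apply: cvg_trans H; apply: near_eq_cvg; apply: filterS near_survives_gt0 => n [n0 s0].
  by rewrite cond_laplace.
- exact: exponential_tail.
Qed.

(** Bounded for j >= 1, hence an admissible test function for (b): the size-biased limit needs no
    uniform integrability of |Y_n|/n. *)
Let size_biased j (x : R) : R := `|x| * laplace_fun j x.

Let bounded_continuous_size_biased j : (0 < j)%N -> bounded_continuous (size_biased j).
Proof.
move=> j0; split.
  move=> x; apply: cvgM; last by have [c _] := @bounded_continuous_laplace R j; exact: c.
  by apply: cvg_norm.
exists 1 => x; rewrite /size_biased ger0_norm ?mulr_ge0 ?(ltW (laplace_fun_gt0 _ _))//.
rewrite /laplace_fun expRN ler_pdivrMr ?expR_gt0// mul1r.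
apply: (@le_trans _ _ (j%:R * `|x|)); last first.
  by have := expR_ge1Dx (j%:R * `|x|); lra.
by rewrite ler_peMl// ler1n.
Qed.

(** The sum is E |Y_n| s^|Y_n|, which is n P(|Y_n| > 0) times the conditional mean of (|Y_n|/n)
    s^|Y_n|; (a) and (b) give the two limits. *)
Lemma coef_sum_cvg j : (0 < j)%N ->
  \sum_(v <- cluster [::] (t n) (fun=> true)) coef xi (laplace_base j n) (t n) v
    @[n --> \oo] --> lam * W [::] * (lam / (lam + j%:R) ^+ 2).
Proof.
move=> j0; have bs := bounded_continuous_size_biased j0; have [cs [B sB]] := bs.
have H : fine (\int[cond_law Q (X n) (surv n)]_x (size_biased j x)%:E)%E @[n --> \oo] -->
    lam / (lam + j%:R) ^+ 2.
  rewrite -exponential_size_biased_laplace//.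
  apply: fine_cvg; rewrite fineK; last by case: (exponential_nonneg lam_gt0) => _; exact.
  apply: cond_law_cvg => //.
  by exists B; split; [exact: num_real|move=> M BM x _; apply: le_trans (sB x) (ltW BM)].
have HH : (n%:R * fine (Q (surv n))) *
      fine (\int[cond_law Q (X n) (surv n)]_x (size_biased j x)%:E)%E @[n --> \oo] -->
    lam * W [::] * (lam / (lam + j%:R) ^+ 2).
  by apply: cvgM H; exact: survives_cvg.
apply: cvg_trans HH; apply: near_eq_cvg.
apply: filterS near_survives_gt0 => n [n0 s0] /=.
have mcl := measurable_survives xi e n.
have mX' := mX n.
have ms : measurable_fun setT (size_biased j) by exact: continuous_measurable_fun.
have msX : measurable_fun setT (fun w => size_biased j (X n w)).
  apply: (@eq_measurable_fun _ _ _ _ _ (size_biased j \o X n)) => //.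
  apply: (@measurableT_comp _ _ _ _ _ _ (size_biased j) _ (X n)); last exact: mX.
  exact: continuous_measurable_fun.
have E w : size_biased j (X n w) * \1_(surv n) w =
    n%:R^-1 * ((size (cluster [::] (t n) (conf w)))%:R *
      laplace_base j n ^+ size (cluster [::] (t n) (conf w))).
  rewrite /size_biased laplaceX (ger0_norm (X_ge0 n w)) /X indicE YE.
  have [wS|wS] := boolP (w \in surv n).
    by rewrite (_ : true%:R = 1 :> R)// mulr1 mulrA [n%:R^-1 * _]mulrC.
  have -> : size (cluster [::] (t n) (conf w)) = 0%N.
    by apply/eqP; rewrite -leqn0 leqNgt; apply: contraNN wS; rewrite inE /survives /= YE.
  by rewrite !(mul0r, mulr0).
have iE : Q.-integrable setT (fun w => (size_biased j (X n w) * \1_(surv n) w)%:E).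
  apply/integrableP; split.
    apply/measurable_EFinP; apply: measurable_funM.
      exact: msX.
    exact: measurable_indic.
  apply: (@le_lt_trans _ _ (\int[Q]_w (cst B%:E w))%E); last first.
    by rewrite (integral_prob_cst Q B%:E) ltry.
  apply: ge0_le_integral => //.
  - apply/measurableT_comp => //; apply/measurable_EFinP; apply: measurable_funM.
      exact: msX.
    exact: measurable_indic.
  - move=> w _; rewrite /= lee_fin normrM -[leRHS]mulr1; apply: ler_pM => //.
    by rewrite indicE; case: (_ \in _); rewrite ?normr1 ?normr0.
rewrite (cond_law_integral mX' mcl s0 ms iE).
have -> : (\int[Q]_w (size_biased j (X n w) * \1_(surv n) w)%:E)%E =
    (n%:R^-1 * \sum_(v <- cluster [::] (t n) (fun=> true)) coef xi (laplace_base j n) (t n) v)%:E.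
  under eq_integral do rewrite E EFinM.
  rewrite ge0_integralZl//.
  - by rewrite (coef_sum xi_perc (base01 j n)) EFinM.
  - apply/measurable_EFinP; apply: (@eq_measurable_fun _ _ _ _ _
      (fun w => n%:R * (size_biased j (X n w) * \1_(surv n) w))).
      by move=> w _; rewrite E mulrA mulfV ?mul1r// gt_eqF// ltr0n.
    apply: measurable_funM => //; apply: measurable_funM.
      exact: msX.
    exact: measurable_indic.
by rewrite /=; field; rewrite !gt_eqF// ltr0n.
Qed.

Section incipient_infinite_cluster.
Context d' (Om' : measurableType d') (P' : probability Om' R).
Variable S : Om' -> set (seq nat).
Hypothesis iicS : quenched_IIC T xi P' S.

Let C n w : measurableTypeR R := (level_size (S w) n)%:R / n%:R.

Let mC n : measurable_fun setT (C n).
Proof.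
have [V uV TV] := truncation_seq e n; have [rS mS _] := iicS.
have ST w : S w `<=` T by case: (rS w) => -[].
apply: (@eq_measurable_fun _ _ _ _ _
  (fun w => (level_size (truncation (S w) n) n)%:R / n%:R : R)).
  by move=> w _; rewrite level_size_truncation.
exact: (truncation_measurable uV TV ST mS (fun A => (level_size A n)%:R / n%:R)).
Qed.

Let C_ge0 n w : (0 <= C n w :> R).
Proof. by rewrite /C divr_ge0. Qed.

(** An identity at each n: as the depth M of the conditioning grows, one and the same ratio tends to
    the left side by definition of the incipient infinite cluster, and to the right side by
    [survival_coef_cvg] and (a). *)
Lemma iic_laplace j n :
  fine (\int[law P' (C n)]_x (laplace_fun j x)%:E)%E =
  (\sum_(v <- cluster [::] (t n) (fun=> true)) coef xi (laplace_base j n) (t n) v * W v) / W [::].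
Proof.
have G0 A : 0 <= laplace_base j n ^+ level_size A n by rewrite exprn_ge0// expR_ge0.
have -> : (\int[law P' (C n)]_x (laplace_fun j x)%:E)%E =
    (\int[P']_w (laplace_base j n ^+ level_size (truncation (S w) n) n)%:E)%E.
  rewrite (law_integral P' (mC n)); last first.
    by apply: continuous_measurable_fun; case: (@bounded_continuous_laplace R j).
  apply: eq_integral => w _; rewrite level_size_truncation; congr EFin.
  rewrite /laplace_fun ger0_norm ?C_ge0// -expRM_natl; congr expR.
  by rewrite /C mulrN; congr (- _); exact: mulrCA.
have lim1 := iic_integral_cvg iicS G0.
have lim2 := survival_coef_cvg xi_perc (base01 j n) Gf1_cvg.
have lim3 : (M%:R * fine (\int[Q]_w (laplace_base j n ^+ size (cluster [::] (t n) (conf w)) *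
      (cluster [::] (t M) (conf w) != [::])%:R)%:E)%E) / (M%:R * fine (Q (surv M)))
    @[M --> \oo] --> lam * (\sum_(v <- cluster [::] (t n) (fun=> true))
      coef xi (laplace_base j n) (t n) v * W v) / (lam * W [::]).
  by apply: cvgM; [exact: lim2|apply: cvgV; [rewrite gt_eqF|exact: survives_cvg]].
have -> : (\sum_(v <- cluster [::] (t n) (fun=> true)) coef xi (laplace_base j n) (t n) v * W v) / W [::] =
    lam * (\sum_(v <- cluster [::] (t n) (fun=> true))
      coef xi (laplace_base j n) (t n) v * W v) / (lam * W [::]).
  by field; rewrite !gt_eqF.
apply: cvg_unique (lim1 n) _ => //.
apply: cvg_trans lim3; apply: near_eq_cvg; apply: filterS near_survives_gt0 => M [M0 s0].
rewrite -mulf_div divff ?gt_eqF ?ltr0n// mul1r; congr (fine _ / _).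
apply: eq_integral => w _; rewrite level_size_truncation; congr (_ * _)%:E.
  by rewrite -[level_size _ _]/(Y T xi n w) YE.
rewrite indicE; congr ((nat_of_bool _)%:R).
by apply/idP/idP; rewrite survivesE !inE.
Qed.

Lemma iic_cvg : weakly_converges
  (fun n => law P' (fun w => (level_size (S w) n)%:R / n%:R))
  (law_of_density (gamma2_pdf lam)).
Proof.
apply: weak_cvg_laplace.
- by apply: nearW => n; exact: law_nonneg (mC n) (C_ge0 n).
- exact: gamma2_nonneg.
- move=> j; rewrite gamma2_laplace//.
  have [->|j0] := posnP j.
    rewrite addr0 divff ?gt_eqF// expr1n.
    rewrite (_ : (fun n => _) = cst 1); first exact: cvg_cst.
    apply/funext => n; have [[L1 _ _] _] := law_nonneg P' (mC n) (C_ge0 n).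
    rewrite (_ : @laplace_fun R 0 = cst 1); first exact: L1.
    by apply/funext => x; rewrite /laplace_fun mul0r oppr0 expR0.
  (* W(v) = (W(v) - 1) + 1: the fluctuations vanish, and the sum of the coefficients alone yields
     the limit. *)
  rewrite (_ : (fun n => _) = fun n =>
      (\sum_(v <- cluster [::] (t n) (fun=> true)) coef xi (laplace_base j n) (t n) v * (W v - 1) +
       \sum_(v <- cluster [::] (t n) (fun=> true)) coef xi (laplace_base j n) (t n) v) / W [::]).
    rewrite [X in _ --> X](_ : _ = (0 + lam * W [::] * (lam / (lam + j%:R) ^+ 2)) / W [::]).
      apply: cvgM; last exact: cvg_cst.
      by apply: cvgD; [exact: coef_cvg|exact: coef_sum_cvg].
    by field; rewrite !gt_eqF// ltr_wpDr.
  apply/funext => n; rewrite iic_laplace -big_split; congr (_ / _).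
  by apply: eq_bigr => v _ /=; ring.
- exact: gamma2_tail.
Qed.

End incipient_infinite_cluster.

End quenched_limits.

Lemma ae_forall_countable (R : realType) d (Om : measurableType d)
    (P : probability Om R) (I : countType) (F : I -> Om -> Prop) :
  (forall i, {ae P, forall w, F i w}) -> {ae P, forall w, forall i, F i w}.
Proof.
move=> aF.
have : {ae P, forall w, forall n, if choice.unpickle n is Some i then F i w else True}.
  apply: ae_foralln => n; case: (choice.unpickle n) => [i|]; first exact: aF.
  exact: aeW.
by apply: filterS => w H i; have := H (choice.pickle i); rewrite choice.pickleK.
Qed.

Theorem theorem1p3 (R : realType)
    (d : measure_display) (Om : measurableType d) (P : probability Om R)
    (Z : {RV P >-> nat}) (nu : seq nat -> {RV P >-> nat})
    (dQ : measure_display) (OmQ : measurableType dQ) (Q : probability OmQ R)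
    (xi : seq nat -> {RV Q >-> bool})
    (Z_ge1 : forall w, (1 <= Z w)%N)
    (EZ_gt1 : (1 < 'E_P[fun w => (Z w)%:R])%E)
    (Z_moments : forall p : R, 1 <= p ->
      ('E_P[fun w => ((Z w)%:R `^ p)%R] < +oo)%E)
    (nu_iid : iid_offspring Z nu)
    (xi_perc : bernoulli_percolation xi (progeny_mean Z)^-1) :
  {ae P, forall w : Om,
    let T := galton_watson_tree (fun v => nu v w) in
    let W := martingale_limit (progeny_mean Z) T in
    [/\ n%:R * fine (Q (survives T xi n)) @[n --> \oo] --> GW_lambda Z * W,
        weakly_converges
          (fun n => cond_law Q (fun w' => (Y T xi n w')%:R / n%:R)
                      (survives T xi n))
          (exponential_prob (GW_lambda Z)) &
        forall (dI : measure_display) (OmI : measurableType dI)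
               (PI : probability OmI R) (S : OmI -> set (seq nat)),
          quenched_IIC T xi PI S ->
          weakly_converges
            (fun n => law PI (fun w' => (level_size (S w') n)%:R / n%:R))
            (law_of_density (gamma2_pdf (GW_lambda Z)))]}.
Proof.
set p := (progeny_mean Z)^-1.
have p0 : 0 < p := p_gt0 EZ_gt1 Z_moments.
have lam0 : 0 < GW_lambda Z.
  by rewrite (GW_lambdaE Z_moments) invr_gt0 (kolmo_gt0 Z_ge1 EZ_gt1 Z_moments).
have s01 j n : 0 <= (expR (- (j%:R / n%:R)) : R) <= 1.
  by rewrite expR_ge0 -[leRHS]expR0 ler_expR oppr_le0 divr_ge0.
(* A single null set serves all words [u], which are countably many; the limits below every vertex
   are needed for (c). *)
have aW : {ae P, forall w, forall u, cvgn (fun n => Wf p (gw_tree nu n u w))}.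
  by apply: ae_forall_countable => u; exact: ae_Wf_cvg.
have a1 : {ae P, forall w, forall u,
    n%:R * (Gf p 1 (gw_tree nu n u w) - surv_iter Z 1 n * Wf p (gw_tree nu n u w))
    @[n --> \oo] --> 0}.
  apply: ae_forall_countable => u.
  by apply: (ae_Gf Z_ge1 EZ_gt1 Z_moments nu_iid (b := fun=> 1)) => n; rewrite ler01 lexx.
have aL : {ae P, forall w, forall j,
    n%:R * (Gf p (laplace_arg j n) (gw_tree nu n [::] w) -
      surv_iter Z (laplace_arg j n) n * Wf p (gw_tree nu n [::] w)) @[n --> \oo] --> 0}.
  apply: ae_forall_countable => j.
  by apply: (ae_Gf Z_ge1 EZ_gt1 Z_moments nu_iid (b := laplace_arg j)) => n; exact: laplace_arg_itv.
(* The sequence [y] is quantified inside, so that it can be built from the limits W(v) once the tree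
   is fixed. *)
have aC : {ae P, forall w, forall j, forall y : nat -> R,
    (forall n, \sum_(v <- cluster [::] (gw_tree nu n [::] w) (fun=> true))
      coef xi (expR (- (j%:R / n%:R))) (gw_tree nu n [::] w) v *
      (Wf p (gw_tree nu k v w) - 1) @[k --> \oo] --> y n) ->
    y n @[n --> \oo] --> 0}.
  apply: ae_forall_countable => j.
  apply: (ae_level EZ_gt1 Z_moments nu_iid
    (L := fun n t => cluster [::] t (fun=> true))
    (c := fun n t v => coef xi (expR (- (j%:R / n%:R))) t v)).
  - by move=> n t; exact: same_depth_cluster.
  - by move=> n t; rewrite (Wf_cluster _ [::]).
  - move=> n t v; have /andP[c0 c1] := coef_itv xi_perc (s01 j n) t v.
    by rewrite ger0_norm.
have a0 := ae_Wf_neq0 Z_ge1 EZ_gt1 Z_moments nu_iid.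
near=> w.
have aWw : forall u, cvgn (fun n => Wf p (gw_tree nu n u w)) by near: w; exact: aW.
have a1w : forall u,
    n%:R * (Gf p 1 (gw_tree nu n u w) - surv_iter Z 1 n * Wf p (gw_tree nu n u w))
    @[n --> \oo] --> 0 by near: w; exact: a1.
have aLw : forall j,
    n%:R * (Gf p (laplace_arg j n) (gw_tree nu n [::] w) -
      surv_iter Z (laplace_arg j n) n * Wf p (gw_tree nu n [::] w)) @[n --> \oo] --> 0.
  by near: w; exact: aL.
have aCw : forall j, forall y : nat -> R,
    (forall n, \sum_(v <- cluster [::] (gw_tree nu n [::] w) (fun=> true))
      coef xi (expR (- (j%:R / n%:R))) (gw_tree nu n [::] w) v *
      (Wf p (gw_tree nu k v w) - 1) @[k --> \oo] --> y n) ->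
    y n @[n --> \oo] --> 0 by near: w; exact: aC.
have a0w : ~ (Wf p (gw_tree nu n [::] w) @[n --> \oo] --> (0 : R)) by near: w; exact: a0.
set T := galton_watson_tree _; set W := martingale_limit _ T.
pose e v := nu v w.
pose Wl (v : seq nat) : R := limn (fun n => Wf p (tree e n v)).
have Wc v : Wf p (tree e n v) @[n --> \oo] --> Wl v by exact: aWw.
have WE : W = Wl [::] by rewrite /W /T martingale_limitE.
have W0 : 0 < Wl [::].
  rewrite lt0r; apply/andP; split.
    apply/eqP => Wl0; have := Wc [::]; rewrite Wl0.
    exact: a0w.
  apply: limr_ge; first exact: cvgP (Wc [::]).
  by apply: nearW => n; rewrite Wf_ge0// ltW.
(* G_n = D_n + r_n W_n: once n D_n tends to 0, the limit of n r_n is multiplied by that of W_n. *)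
have combine (b : nat -> R) v (l : R) : n%:R * (Gf p (b n) (tree e n v) -
      surv_iter Z (b n) n * Wf p (tree e n v)) @[n --> \oo] --> 0 ->
    n%:R * surv_iter Z (b n) n @[n --> \oo] --> l ->
    n%:R * Gf p (b n) (tree e n v) @[n --> \oo] --> l * Wl v.
  move=> h1 h2; rewrite -[X in _ --> X]add0r.
  rewrite (_ : (fun n => _) = fun n => n%:R * (Gf p (b n) (tree e n v) -
      surv_iter Z (b n) n * Wf p (tree e n v)) +
      n%:R * surv_iter Z (b n) n * Wf p (tree e n v)).
    by apply: cvgD => //; apply: cvgM => //; exact: Wc.
  by apply/funext => n; ring.
have H2 v : n%:R * Gf p 1 (tree e n v) @[n --> \oo] --> GW_lambda Z * Wl v.
  rewrite (GW_lambdaE Z_moments); apply: (combine (fun=> 1)).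
    exact: a1w.
  exact: surv_iter1_cvg.
have H3 j : (0 < j)%N -> n%:R * Gf p (laplace_arg j n) (tree e n [::]) @[n --> \oo] -->
    ((GW_lambda Z)^-1 + j%:R^-1)^-1 * Wl [::].
  move=> j0; rewrite (GW_lambdaE Z_moments) invrK; apply: (combine (laplace_arg j)).
    exact: aLw.
  exact: surv_iter_laplace_cvg.
have H5 j : \sum_(v <- cluster [::] (tree e n [::]) (fun=> true))
    coef xi (expR (- (j%:R / n%:R))) (tree e n [::]) v * (Wl v - 1) @[n --> \oo] --> 0.
  apply: (aCw j (fun n => \sum_(v <- cluster [::] (tree e n [::]) (fun=> true))
    coef xi (expR (- (j%:R / n%:R))) (tree e n [::]) v * (Wl v - 1))) => n.
  apply: cvg_sum_seq => v; apply: cvgM; first exact: cvg_cst.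
  by apply: cvgB; [exact: Wc|exact: cvg_cst].
split.
- by rewrite WE; exact: (survives_cvg xi_perc H2).
- exact: (cond_law_cvg xi_perc lam0 W0 H2 H3).
- move=> dI OmI PI S iicS.
  exact: (iic_cvg xi_perc lam0 W0 H2 H3 H5 iicS).
Unshelve. all: by end_near. Qed.
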